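(* Let $0<\delta\le1$, $d\ge1$, and let $\mathcal{R}$ be a set of $2^d$ points in $\mathbb{Z}^{5d}$ forming the vertices of a $d$-dimensional rectangle, with side lengths $t_1,\dots,t_d$. (i) If $S\subseteq\mathbb{Z}^{5d}$ has upper Banach density at least $\delta$, then there exist integers $q_0=q_0(\delta,\mathcal{R})$ and $\lambda_0=\lambda_0(S,\mathcal{R})$ such that $S$ contains an isometric copy of $q_0\lambda\mathcal{R}$ for all $\lambda\in\sqrt{\mathbb{N}}$ with $\lambda\ge\lambda_0$. (ii) There exists a constant $N(\delta,\mathcal{R})$ such that if $N\ge N(\delta,\mathcal{R})$, then any $S\subseteq\{1,\dots,N\}^{5d}$ with $|S|\ge\delta N^{5d}$ contains an isometric copy of $\lambda\mathcal{R}$ for some $\lambda\in\sqrt{\mathbb{N}}$ with $1\le\lambda\le N$. Moreover, each of the isometric copies in (i) and (ii) can be realized in the form $\{x_{11},x_{12}\}\times\cdots\times\{x_{d1},x_{d2}\}\subseteq\mathbb{Z}^5\times\cdots\times\mathbb{Z}^5=\mathbb{Z}^{5d}$ with $|x_{j2}-x_{j1}|=q_0\lambda t_j$ (in (i)) and $|x_{j2}-x_{j1}|=\lambda t_j$ (in (ii)) for each $1\le j\le d$.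
   Context: $\sqrt{\mathbb{N}}:=\{\lambda:\lambda>0,\ \lambda^2\in\mathbb{Z}\}$. The upper Banach density of $S\subseteq\mathbb{Z}^n$ is $\delta^*(S)=\lim_{N\to\infty}\sup_{t\in\mathbb{R}^n}|S\cap(t+Q(N))|/|Q(N)|$ where $|\cdot|$ is counting measure and $Q(N)=[-N/2,N/2]^n\cap\mathbb{Z}^n$. A finite configuration $\Delta'$ is an isometric copy of $\lambda\Delta$ if there is a bijection $\phi:\Delta\to\Delta'$ with $|\phi(v)-\phi(w)|=\lambda|v-w|$ for all $v,w\in\Delta$. *)

(* Defs.v *)
From HB Require Import structures.
From mathcomp Require Import all_boot all_order all_algebra.
From mathcomp Require Import finmap.
From mathcomp Require Import all_classical all_reals all_analysis.

Set Implicit Arguments.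
Unset Strict Implicit.
Unset Printing Implicit Defensive.

Import Order.TTheory GRing.Theory Num.Theory.
Import numFieldNormedType.Exports.

Local Open Scope classical_set_scope.
Local Open Scope ring_scope.

Definition sqrtN (R : realType) : set R :=
  [set lambda : R | 0 < lambda /\ lambda ^+ 2 \is a Num.int].

(* The library's norm `|x| on row vectors is the sup norm. *)
Definition enorm (R : realType) (n : nat) (x : 'rV[int]_n) : R :=
  Num.sqrt (\sum_i (x 0 i)%:~R ^+ 2).

Definition dotz (n : nat) (x y : 'rV[int]_n) : int := \sum_i x 0 i * y 0 i.

(* Meaningful for finite A only: fset_set A is empty when A is infinite. *)
Definition card_pts (n : nat) (A : set 'rV[int]_n) : nat := #|` fset_set A|.

Definition Qcube (R : realType) (n N : nat) : set 'rV[int]_n :=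
  [set x : 'rV[int]_n |
    forall i, - (N%:R / 2) <= (x 0 i)%:~R :> R /\
              (x 0 i)%:~R <= N%:R / 2 :> R].

Arguments Qcube R n N : clear implicits.

(* The integer points of t + A, for a real translation vector t. *)
Definition translate (R : realType) (n : nat) (t : 'rV[R]_n)
    (A : set 'rV[int]_n) : set 'rV[int]_n :=
  [set x : 'rV[int]_n | exists2 q, A q & map_mx intr x = t + map_mx intr q].

Definition upper_banach_density (R : realType) (n : nat)
    (S : set 'rV[int]_n) : R :=
  limn (fun N : nat =>
    sup [set (card_pts (S `&` translate t (Qcube R n N)))%:R
               / (card_pts (Qcube R n N))%:R | t in [set: 'rV[R]_n]]).

Definition isometric_copy (R : realType) (m n : nat) (lambda : R)
    (D : set 'rV[int]_m) (D' : set 'rV[int]_n) : Prop :=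
  exists phi : 'rV[int]_m -> 'rV[int]_n,
    set_bij D D' phi /\
    forall v w, D v -> D w ->
      enorm R (phi v - phi w) = lambda * enorm R (v - w).

(* Edge vectors u_j are nonzero and pairwise orthogonal, so the 2^d vertices
   v0 + \sum_(j in J) u_j, for J a set of indices, are pairwise distinct. *)
Definition is_rectangle (R : realType) (n d : nat) (V : set 'rV[int]_n)
    (t : 'I_d -> R) : Prop :=
  exists (v0 : 'rV[int]_n) (u : 'I_d -> 'rV[int]_n),
    [/\ forall j, u j != 0,
        forall i j, i != j -> dotz (u i) (u j) = 0,
        forall j, enorm R (u j) = t j
      & V = [set v0 + \sum_(j in J) u j | J in [set: {set 'I_d}]]].

(* vec_mx identifies Z^(d * 5) with (Z^5)^d: row j (vec_mx y) consists of the
   coordinates 5j, ..., 5j + 4 of y. *)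
Definition pair_product (d : nat) (x1 x2 : 'I_d -> 'rV[int]_5) :
    set 'rV[int]_(d * 5) :=
  [set y : 'rV[int]_(d * 5) |
    forall j, row j (vec_mx y) = x1 j \/ row j (vec_mx y) = x2 j].

Definition contains_product_copy (R : realType) (d : nat)
    (S V : set 'rV[int]_(d * 5)) (t : 'I_d -> R) (mu : R) : Prop :=
  exists x1 x2 : 'I_d -> 'rV[int]_5,
    [/\ pair_product x1 x2 `<=` S,
        isometric_copy mu V (pair_product x1 x2)
      & forall j, enorm R (x2 j - x1 j) = mu * t j].

Definition grid (n N : nat) : set 'rV[int]_n :=
  [set x : 'rV[int]_n | forall i, 1 <= x 0 i /\ x 0 i <= N%:Z].

Arguments grid n N : clear implicits.

(* Main.v *)
(** The number of configurations in a set is a 2^d-linear form whose kernels are the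
    normalised indicators T_m of the spheres |x' - x|^2 = m in a box of Z^5.  By Weyl's
    inequality the exponential sum over a box of Z^5 has a fifth-power saving, so the
    circle method replaces T_m, up to a small error in operator norm, by a majorised
    kernel M_m living on a shell of width eta m and on a residue class modulo a fixed q.
    M_m dominates a constant times the flat kernel once functions are averaged over
    cells (a residue class modulo q intersected with a cube of side l).  Hence, when no
    configuration occurs, the box form of the set averaged over small cells must exceed
    its box form on the large box by a fixed amount: the energy increases when passing
    to a smaller scale.  Iterating, a set without configurations at a suitable finite set
    of scales has arbitrarily small box form, hence arbitrarily small density by
    repeated Cauchy-Schwarz. *)

Require Import Defs.
From HB Require Import structures.
From mathcomp Require Import all_boot all_order all_algebra.
From mathcomp Require Import finmap.
From mathcomp Require Import all_classical all_reals all_analysis.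
From mathcomp Require Import complex.
From mathcomp Require Import ring lra zify.

Set Implicit Arguments.
Unset Strict Implicit.
Unset Printing Implicit Defensive.

Import Order.TTheory GRing.Theory Num.Theory.
Import numFieldNormedType.Exports.

Local Open Scope ring_scope.

(** * Box forms and the comparison of kernels one coordinate at a time *)

Section BoxForms.
Variables (R : realFieldType) (X : finType).
Implicit Types (K : nat -> X -> X -> R) (D : X -> X -> R) (f : seq X -> R).

(** Why dimension five: about 16^i frequencies have level i and each contributes (4^i)^(-5/2) =
    32^-i, so the levels sum to a geometric series of ratio 1/2; dimension four would leave ratio 1.
    The order of the constants is the main obstacle. The error eps must be small against c, and q
    depends on eps, so c may not depend on q. This calls for a lower bound, uniform in q, for the
    zeros modulo q of a sum of five squares; an explicit Gauss sum estimate supplies it. The cell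
    side l must be negligible against the square root of m, so each step is given a small box and
    picks a larger one: the iteration climbs, from the trivial bound 1. The gain does not depend on
    the scale, so the number of steps is bounded and the total dilation is a constant. The
    admissible scales form an arbitrary unbounded set: those at which S fails serve (i), all
    positive ones serve (ii). Kernels are compared one-sidedly and on unit-valued functions only,
    which is what the slices of an indicator are. Sums over residues modulo a large prime replace
    integrals over the circle. *)

Definition quad D (F : X -> R) : R := \sum_x \sum_x' D x x' * (F x * F x').

Definition mass D : R := \sum_x \sum_x' D x x'.

(** The Gowers box form on X^d with a separate kernel for each coordinate. Points are lists, so that
    induction peels off the head, which carries the kernel of index d - 1. *)
Fixpoint bform K d f : R :=
  if d is d'.+1 then
    \sum_x \sum_x' K d' x x' * bform K d' (fun s => f (x :: s) * f (x' :: s))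
  else f [::].

Definition unit_valued (A : Type) (f : A -> R) := forall a, 0 <= f a <= 1.

Lemma unit_valuedM (A : Type) (f g : A -> R) :
  unit_valued f -> unit_valued g -> unit_valued (fun a => f a * g a).
Proof.
move=> f01 g01 a; have /andP[f0 f1] := f01 a; have /andP[g0 g1] := g01 a.
by rewrite mulr_ge0 //= mulr_ile1.
Qed.

Lemma eq_bform K d f g : f =1 g -> bform K d f = bform K d g.
Proof.
elim: d f g => [|d IH] f g fg /=; first exact: fg.
by apply: eq_bigr => x _; apply: eq_bigr => x' _; congr (_ * _); apply: IH => s; rewrite !fg.
Qed.

(* Expanding the inner form writes it as a nonnegative combination of products
   F x * F x' with F unit valued. *)
Lemma quad_bform_ge D K (eps C : R) :
    (forall k x x', 0 <= K k x x') -> (forall k, mass (K k) <= C) -> 0 <= eps ->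
    (forall F, unit_valued F -> - eps <= quad D F) ->
  forall d (g : X -> seq X -> R), (forall x, unit_valued (g x)) ->
  - (eps * C ^+ d) <= \sum_x \sum_x' D x x' * bform K d (fun s => g x s * g x' s).
Proof.
move=> K0 KC e0 De; elim=> [|d IH] g g01 /=.
  by rewrite expr0 mulr1; apply: (De (fun x => g x [::])) => x; apply: g01.
have -> : \sum_x \sum_x' D x x' * (\sum_y \sum_y' K d y y' *
      bform K d (fun s => g x (y :: s) * g x' (y :: s) * (g x (y' :: s) * g x' (y' :: s)))) =
    \sum_y \sum_y' K d y y' * (\sum_x \sum_x' D x x' *
      bform K d (fun s => g x (y :: s) * g x (y' :: s) * (g x' (y :: s) * g x' (y' :: s)))).
  transitivity (\sum_x \sum_x' \sum_y \sum_y' D x x' * (K d y y' *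
      bform K d (fun s => g x (y :: s) * g x' (y :: s) * (g x (y' :: s) * g x' (y' :: s))))).
    by apply: eq_bigr => x _; apply: eq_bigr => x' _; rewrite mulr_sumr;
      apply: eq_bigr => y _; rewrite mulr_sumr.
  transitivity (\sum_y \sum_y' \sum_x \sum_x' D x x' * (K d y y' *
      bform K d (fun s => g x (y :: s) * g x' (y :: s) * (g x (y' :: s) * g x' (y' :: s))))).
    under eq_bigr => x _ do rewrite exchange_big.
    rewrite exchange_big; apply: eq_bigr => y _ /=.
    under eq_bigr => x _ do rewrite exchange_big.
    by rewrite exchange_big.
  apply: eq_bigr => y _; apply: eq_bigr => y' _.
  rewrite mulr_sumr; apply: eq_bigr => x _; rewrite mulr_sumr; apply: eq_bigr => x' _.
  rewrite mulrCA; congr (_ * (_ * _)); apply: eq_bform => s.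
  by rewrite mulrACA.
have step y y' : K d y y' * - (eps * C ^+ d) <= K d y y' * (\sum_x \sum_x' D x x' *
      bform K d (fun s => g x (y :: s) * g x (y' :: s) * (g x' (y :: s) * g x' (y' :: s)))).
  apply: ler_wpM2l => //; apply: (IH (fun x s => g x (y :: s) * g x (y' :: s))) => x.
  by apply: unit_valuedM => s; apply: g01.
apply: (@le_trans _ _ (\sum_y \sum_y' K d y y' * - (eps * C ^+ d))); last first.
  by apply: ler_sum => y _; apply: ler_sum => y' _; apply: step.
under eq_bigr => y _ do rewrite -mulr_suml.
rewrite -mulr_suml mulrN lerN2 exprS [leRHS]mulrCA ler_wpM2r //; last exact: KC.
have [->|d0] := eqVneq d 0%N; first by rewrite expr0 mulr1.
rewrite mulr_ge0 // exprn_ge0 //; apply: le_trans (KC 0%N).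
by apply: sumr_ge0 => x _; apply: sumr_ge0.
Qed.

Lemma massE_quad D : mass D = quad D (fun=> 1).
Proof. by apply: eq_bigr => x _; apply: eq_bigr => x' _; rewrite !mulr1. Qed.

Lemma quad_sub D E F : quad (fun x x' => D x x' - E x x') F = quad D F - quad E F.
Proof.
rewrite /quad -sumrB; apply: eq_bigr => x _; rewrite -sumrB; apply: eq_bigr => x' _.
by rewrite mulrBl.
Qed.

Lemma bform_le1 K d f : (forall k x x', 0 <= K k x x') -> (forall k, mass (K k) <= 1) ->
  unit_valued f -> bform K d f <= 1.
Proof.
move=> K0 K1; elim: d f => [|d IH] f f01 /=; first by case/andP: (f01 [::]).
apply: le_trans (K1 d); apply: ler_sum => x _; apply: ler_sum => x' _.
rewrite ler_piMr // IH //; apply: unit_valuedM => s; exact: f01.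
Qed.

(** Only the quadratic forms are ordered, not the kernels pointwise. The outer kernel is exchanged
    by [quad_bform_ge] with error 0 while the inner form still carries K; the inner kernels follow
    by induction because L is nonnegative. *)
Lemma bform_homo K L d f :
    (forall k x x', 0 <= K k x x') -> (forall k x x', 0 <= L k x x') ->
    (forall k, mass (K k) <= 1) -> (forall k, mass (L k) <= 1) ->
    (forall k F, unit_valued F -> quad (K k) F <= quad (L k) F) ->
  unit_valued f -> bform K d f <= bform L d f.
Proof.
move=> K0 L0 K1 L1 KL; elim: d f => [|d IH] f f01 //=.
apply: (@le_trans _ _ (\sum_x \sum_x' L d x x' * bform K d (fun s => f (x :: s) * f (x' :: s)))).
  rewrite -subr_ge0 -sumrB.
  under eq_bigr => x _ do rewrite -sumrB.
  under eq_bigr => x _ do under eq_bigr => x' _ do rewrite -mulrBl.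
  have := @quad_bform_ge (fun x x' => L d x x' - K d x x') K 0 1 K0 K1 (lexx _) _ d
    (fun x s => f (x :: s)).
  rewrite mul0r oppr0; apply=> [F F01|x s]; last exact: f01.
  by rewrite quad_sub subr_ge0 KL.
apply: ler_sum => x _; apply: ler_sum => x' _; apply: ler_wpM2l => //; apply: IH.
by apply: unit_valuedM => s; apply: f01.
Qed.

(* The dichotomy behind the energy increment: if the configuration form T is
   much smaller than U, then refining U to P increases the box form. *)
Lemma bform_lower (T M : nat -> X -> X -> R) (U P : X -> X -> R) (eps c C1 C2 C3 : R) (d : nat) :
    0 <= eps -> 0 <= c -> 1 <= C1 -> 0 <= C2 -> 0 <= C3 ->
    (forall k x x', 0 <= T k x x') -> (forall k, mass (T k) <= C1) ->
    (forall k F, unit_valued F -> - eps <= quad (fun x x' => T k x x' - M k x x') F) ->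
    (forall k x x', 0 <= M k x x' <= C2 * U x x') -> (forall k, mass (M k) <= C1) ->
    (forall k F, unit_valued F ->
       - eps <= quad (M k) F - c * quad U F + C3 * (quad P F - quad U F)) ->
    (forall x x', 0 <= U x x') -> (forall x x', 0 <= P x x') ->
    mass U <= 1 -> mass P <= 1 ->
    (forall F, unit_valued F -> quad U F <= quad P F) ->
  forall f, unit_valued f ->
  c ^+ d * bform (fun=> U) d f
    - eps * (\sum_(i < d) (C1 ^+ d + C1 ^+ d * c ^+ i))
    - (\sum_(i < d) c ^+ i * C3 * C2 ^+ (d - i.+1)) * (bform (fun=> P) d f - bform (fun=> U) d f)
  <= bform T d f.
Proof.
move=> e0 c0 C10 C20 C30 T0 TC TM M01 MC MUP U0 P0 U1 P1 UP.
have M0 k x x' : 0 <= M k x x' by case/andP: (M01 k x x').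
have C1_ge0 : 0 <= C1 by apply: le_trans C10.
have C1X m n : (m <= n)%N -> C1 ^+ m <= C1 ^+ n by move=> mn; rewrite ler_weXn2l.
(* From T to M. The induction hypothesis is integrated against the outer T, whose mass C1 multiplies
   the old error; exchanging the outer kernel adds one more eps C1^n. *)
have phase1 f : unit_valued f -> bform M d f - eps * d%:R * C1 ^+ d <= bform T d f.
  elim: d f => [|n IH] f f01 /=; first by rewrite mulr0 mul0r subr0.
  have f2 x x' : unit_valued (fun s => f (x :: s) * f (x' :: s)).
    by apply: unit_valuedM => s; apply: f01.
  have A : \sum_x \sum_x' T n x x' * (bform M n (fun s => f (x :: s) * f (x' :: s))
       - eps * n%:R * C1 ^+ n) <= bform T n.+1 f.
    apply: ler_sum => x _; apply: ler_sum => x' _; apply: ler_wpM2l => //; exact: IH.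
  have B : - (eps * C1 ^+ n) <= \sum_x \sum_x' (T n x x' - M n x x') *
      bform M n (fun s => f (x :: s) * f (x' :: s)).
    by apply: (quad_bform_ge (K := M) (C := C1)) => // [F F01|x s]; [apply: TM|apply: f01].
  have E1 : \sum_x \sum_x' T n x x' * (bform M n (fun s => f (x :: s) * f (x' :: s))
       - eps * n%:R * C1 ^+ n) =
     \sum_x \sum_x' T n x x' * bform M n (fun s => f (x :: s) * f (x' :: s))
       - mass (T n) * (eps * n%:R * C1 ^+ n).
    rewrite /mass mulr_suml -sumrB; apply: eq_bigr => x _.
    by rewrite mulr_suml -sumrB; apply: eq_bigr => x' _; rewrite mulrBr.
  have E2 : \sum_x \sum_x' (T n x x' - M n x x') *
      bform M n (fun s => f (x :: s) * f (x' :: s)) =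
     \sum_x \sum_x' T n x x' * bform M n (fun s => f (x :: s) * f (x' :: s)) - bform M n.+1 f.
    rewrite /= -sumrB; apply: eq_bigr => x _; rewrite -sumrB; apply: eq_bigr => x' _.
    by rewrite mulrBl.
  rewrite E1 in A; rewrite E2 in B.
  have Z : mass (T n) * (eps * n%:R * C1 ^+ n) <= C1 * (eps * n%:R * C1 ^+ n).
    apply: ler_wpM2r => //; by rewrite !mulr_ge0 // ?exprn_ge0.
  have W : eps * C1 ^+ n <= eps * C1 ^+ n.+1 by rewrite ler_wpM2l // C1X.
  have W' : eps * n.+1%:R * C1 ^+ n.+1 = C1 * (eps * n%:R * C1 ^+ n) + eps * C1 ^+ n.+1.
    by rewrite -natr1 exprS; ring.
  rewrite W' /=; rewrite /= in A B; lra.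
have UPd n f : unit_valued f -> bform (fun=> U) n f <= bform (fun=> P) n f.
  by move=> f01; apply: bform_homo.
(* From M to c U, where every exchange also pays a multiple of the increment from U to P. *)
have phase2 f : unit_valued f ->
   c ^+ d * bform (fun=> U) d f - eps * (\sum_(i < d) C1 ^+ d * c ^+ i)
    - (\sum_(i < d) c ^+ i * C3 * C2 ^+ (d - i.+1)) * (bform (fun=> P) d f - bform (fun=> U) d f)
   <= bform M d f.
  elim: d {phase1} f => [|n IH] f f01; first by rewrite /= !big_ord0 expr0; lra.
  have f2 x x' : unit_valued (fun s => f (x :: s) * f (x' :: s)).
    by apply: unit_valuedM => s; apply: f01.
  have [Cn CnE] : exists v, v = \sum_(i < n) c ^+ i * C3 * C2 ^+ (n - i.+1) by eexists.
  have [en enE] : exists v, v = \sum_(i < n) C1 ^+ n * c ^+ i by eexists.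
  rewrite -CnE -enE in IH.
  have Cn0 : 0 <= Cn by rewrite CnE; apply: sumr_ge0 => i _; rewrite !mulr_ge0 // exprn_ge0.
  have en0 : 0 <= en by rewrite enE; apply: sumr_ge0 => i _; rewrite !mulr_ge0 // exprn_ge0.
  pose g x x' := fun s => f (x :: s) * f (x' :: s).
  pose S (D : X -> X -> R) (V : X -> X -> R) := \sum_x \sum_x' D x x' * bform (fun=> V) n (g x x').
  have SE D E V : S (fun x x' => D x x' - E x x') V = S D V - S E V.
    rewrite /S -sumrB; apply: eq_bigr => x _; rewrite -sumrB; apply: eq_bigr => x' _.
    by rewrite mulrBl.
  (* Inner coordinates: the induction hypothesis is integrated against M, and M <= C2 U turns the
     weight of the nonnegative inner increment into U. *)
  have A : c ^+ n * S (M n) U - C1 * (eps * en) - C2 * Cn * (S U P - S U U) <= bform M n.+1 f.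
    apply: (@le_trans _ _ (\sum_x \sum_x' (M n x x' * (c ^+ n * bform (fun=> U) n (g x x') - eps * en)
       - C2 * U x x' * (Cn * (bform (fun=> P) n (g x x') - bform (fun=> U) n (g x x')))))).
      have -> : \sum_x \sum_x' (M n x x' * (c ^+ n * bform (fun=> U) n (g x x') - eps * en)
       - C2 * U x x' * (Cn * (bform (fun=> P) n (g x x') - bform (fun=> U) n (g x x')))) =
         c ^+ n * S (M n) U - mass (M n) * (eps * en) - C2 * Cn * (S U P - S U U).
        rewrite /S /mass mulr_suml mulrBr !mulr_sumr -!sumrB.
        apply: eq_bigr => x _; rewrite mulr_suml !mulr_sumr -!sumrB.
        by apply: eq_bigr => x' _; ring.
      rewrite !lerD2r lerD2l lerN2; apply: ler_wpM2r; first exact: mulr_ge0.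
      exact: MC.
    apply: ler_sum => x _; apply: ler_sum => x' _.
    apply: (@le_trans _ _ (M n x x' * (c ^+ n * bform (fun=> U) n (g x x') - eps * en
         - Cn * (bform (fun=> P) n (g x x') - bform (fun=> U) n (g x x'))))); last first.
      by apply: ler_wpM2l => //; apply: IH; apply: f2.
    rewrite [in leRHS]mulrBr lerD2l lerN2; apply: ler_wpM2r.
      by rewrite mulr_ge0 // subr_ge0 UPd //; apply: f2.
    by case/andP: (M01 n x x').
  have B : - (eps * 1 ^+ n) <= S (fun x x' => M n x x' - c * U x x' + C3 * (P x x' - U x x')) U.
    apply: (@quad_bform_ge _ (fun=> U) eps 1 (fun=> U0) (fun=> U1) e0 _ n (fun x s => f (x :: s)))
      => [F F01|x s]; last exact: f01.
      apply: le_trans (MUP n F F01) _.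
      rewrite le_eqVlt; apply/orP; left; apply/eqP.
      rewrite /quad mulrBr !mulr_sumr -!sumrB -big_split /=; apply: eq_bigr => x _.
      by rewrite !mulr_sumr -!sumrB -big_split /=; apply: eq_bigr => x' _; ring.
  have B' : S (fun x x' => M n x x' - c * U x x' + C3 * (P x x' - U x x')) U =
     S (M n) U - c * S U U + C3 * (S P U - S U U).
    rewrite /S mulrBr !mulr_sumr -!sumrB -big_split /=; apply: eq_bigr => x _.
    by rewrite !mulr_sumr -!sumrB -big_split /=; apply: eq_bigr => x' _; ring.
  rewrite B' expr1n mulr1 in B.
  (* The mixed forms S P U and S U P are at most S P P, so each partial increment is at most the
     full one, S P P - S U U. *)
  have D1 : S P U <= S P P.
    apply: ler_sum => x _; apply: ler_sum => x' _; apply: ler_wpM2l => //; exact: (UPd _ _ (f2 x x')).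
  have D2 : S U P <= S P P.
    rewrite -subr_ge0 -SE.
    have := @quad_bform_ge (fun x x' => P x x' - U x x') (fun=> P) 0 1 (fun=> P0) (fun=> P1) (lexx _) _ n
      (fun x s => f (x :: s)).
    rewrite mul0r oppr0; apply=> [F F01|x s]; last exact: f01.
    by rewrite quad_sub subr_ge0 UP.
  have D3 : S U U <= S P U.
    rewrite -subr_ge0 -SE.
    have := @quad_bform_ge (fun x x' => P x x' - U x x') (fun=> U) 0 1 (fun=> U0) (fun=> U1) (lexx _) _ n
      (fun x s => f (x :: s)).
    rewrite mul0r oppr0; apply=> [F F01|x s]; last exact: f01.
    by rewrite quad_sub subr_ge0 UP.
  have -> : bform (fun=> U) n.+1 f = S U U by [].
  have -> : bform (fun=> P) n.+1 f = S P P by [].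
  have eE : \sum_(i < n.+1) C1 ^+ n.+1 * c ^+ i = C1 * en + C1 ^+ n.+1 * c ^+ n.
    rewrite big_ord_recr /= enE mulr_sumr; congr (_ + _).
    by apply: eq_bigr => i _; rewrite exprS mulrA.
  have CE : \sum_(i < n.+1) c ^+ i * C3 * C2 ^+ (n.+1 - i.+1) = C2 * Cn + c ^+ n * C3.
    rewrite big_ord_recr /= subnn expr0 mulr1 CnE mulr_sumr; congr (_ + _).
    apply: eq_bigr => i _; rewrite subSn ?exprS; last exact: ltn_ord.
    by ring.
  rewrite eE CE; apply: le_trans A.
  have cn0 : 0 <= c ^+ n by rewrite exprn_ge0.
  have H1 : c ^+ n * (c * S U U - C3 * (S P U - S U U) - eps) <= c ^+ n * S (M n) U.
    by apply: ler_wpM2l => //; lra.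
  have H2 : C2 * Cn * (S U P - S U U) <= C2 * Cn * (S P P - S U U).
    by apply: ler_wpM2l; [exact: mulr_ge0|lra].
  have H3 : c ^+ n * C3 * (S P U - S U U) <= c ^+ n * C3 * (S P P - S U U).
    by apply: ler_wpM2l; [exact: mulr_ge0|lra].
  have H4 : eps * c ^+ n <= eps * (C1 ^+ n.+1 * c ^+ n).
    by rewrite ler_wpM2l // ler_peMl // -(expr0 C1) C1X.
  rewrite exprS; lra.
move=> f f01; have := phase1 f f01; have := phase2 f f01.
have -> : \sum_(i < d) (C1 ^+ d + C1 ^+ d * c ^+ i) = d%:R * C1 ^+ d + \sum_(i < d) C1 ^+ d * c ^+ i.
  by rewrite big_split /= sumr_const card_ord mulr_natl.
rewrite -mulrA; lra.
Qed.

End BoxForms.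

(** * Complex exponentials and geometric sums *)

Section Characters.
Variable R : realType.
Implicit Types (s t : R) (z w : R[i]) (m n : int).

(** A modulus with values in R, so that all estimates are real inequalities. *)
Definition nrm (z : R[i]) : R := Num.sqrt (complex.Re z ^+ 2 + complex.Im z ^+ 2).

Definition nrm2 (z : R[i]) : R := complex.Re z ^+ 2 + complex.Im z ^+ 2.

Lemma nrmE z : nrm z = ComplexField.Normc.normc z. Proof. by case: z. Qed.

Lemma nrm_ge0 z : 0 <= nrm z. Proof. exact: sqrtr_ge0. Qed.

Lemma nrm2_ge0 z : 0 <= nrm2 z. Proof. by rewrite addr_ge0 ?sqr_ge0. Qed.

Lemma nrm_sqr z : nrm z ^+ 2 = nrm2 z. Proof. by rewrite sqr_sqrtr ?nrm2_ge0. Qed.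

Lemma nrmM z w : nrm (z * w) = nrm z * nrm w.
Proof. by rewrite !nrmE ComplexField.Normc.normcM. Qed.

Lemma ler_nrmD z w : nrm (z + w) <= nrm z + nrm w.
Proof. by rewrite !nrmE; apply: (@le_normcD R z w). Qed.

Lemma nrm0 : nrm 0 = 0.
Proof. by rewrite nrmE ComplexField.Normc.normc0. Qed.

Lemma nrm1 : nrm 1 = 1.
Proof. by rewrite nrmE ComplexField.Normc.normc1. Qed.

Lemma nrm_real (x : R) : nrm x%:C%C = `|x|.
Proof. by rewrite /nrm /= expr0n /= addr0 sqrtr_sqr. Qed.

Lemma nrmN z : nrm (- z) = nrm z.
Proof. by case: z => a b; rewrite /nrm /= !sqrrN. Qed.

Lemma nrm_conj z : nrm z^*%C = nrm z.
Proof. by case: z => a b; rewrite /nrm /= sqrrN. Qed.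

Lemma ler_nrm_sum (I : Type) (r : seq I) (P : pred I) (F : I -> R[i]) :
  nrm (\sum_(i <- r | P i) F i) <= \sum_(i <- r | P i) nrm (F i).
Proof.
elim/big_rec2: _ => [|i x y _ h]; first by rewrite nrm0.
by apply: le_trans (ler_nrmD _ _) _; rewrite lerD2l.
Qed.

Lemma mulJ_nrm2 z : z * z^*%C = (nrm2 z)%:C%C.
Proof. by case: z => a b; rewrite /nrm2 /=; apply/eqP; rewrite eq_complex /=; apply/andP; split; apply/eqP; ring. Qed.

Lemma Re_le_nrm z : complex.Re z <= nrm z.
Proof.
case: z => a b; rewrite /nrm /=; apply: le_trans (ler_norm a) _.
by rewrite -sqrtr_sqr ler_wsqrtr // lerDl sqr_ge0.
Qed.

Definition ee t : R[i] := Complex (cos (2 * pi * t)) (sin (2 * pi * t)).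

Lemma ee0 : ee 0 = 1.
Proof. by rewrite /ee mulr0 cos0 sin0. Qed.

Lemma eeD s t : ee (s + t) = ee s * ee t.
Proof.
rewrite /ee mulrDr cosD sinD; apply/eqP; rewrite eq_complex /=; apply/andP; split; apply/eqP; ring.
Qed.

Lemma nrm_ee t : nrm (ee t) = 1.
Proof. by rewrite /nrm /= cos2Dsin2 sqrtr1. Qed.

Lemma ee_conj t : (ee t)^*%C = ee (- t).
Proof. by rewrite /ee mulrN cosN sinN. Qed.

Lemma ee1 : ee 1 = 1.
Proof. by rewrite /ee mulr1 mulr_natl cos2pi sin2pi. Qed.

Lemma eeN t : ee t * ee (- t) = 1.
Proof. by rewrite -eeD subrr ee0. Qed.

Lemma ee_nat (k : nat) : ee k%:R = 1.
Proof. by elim: k => [|k IH]; rewrite ?ee0 // -natr1 eeD IH ee1 mulr1. Qed.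

Lemma ee_int n : ee n%:~R = 1.
Proof.
case: n => k; first exact: ee_nat.
by have := eeN k.+1%:R; rewrite ee_nat mul1r NegzE mulrNz.
Qed.

Lemma eeDint t n : ee (t + n%:~R) = ee t. Proof. by rewrite eeD ee_int mulr1. Qed.

Lemma ee_half : ee (1 / 2) = - 1.
Proof.
rewrite /ee (_ : 2 * pi * (1 / 2) = pi); last by field.
by rewrite cospi sinpi; apply/eqP; rewrite eq_complex /= oppr0 !eqxx.
Qed.

Lemma eeX t (k : nat) : ee t ^+ k = ee (t * k%:R).
Proof.
elim: k => [|k IH]; first by rewrite mulr0 ee0 expr0.
by rewrite exprS IH -eeD -natr1 mulrDr mulr1 addrC.
Qed.

Lemma le_sin (x : R) : 0 <= x -> sin x <= x.
Proof.
move=> x0; have [c _] := @MVT_segment R sin cos 0 x x0 (fun y _ => is_derive_sin y)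
  (continuous_subspaceT (@continuous_sin R)).
rewrite sin0 !subr0 => ->; rewrite ler_piMl // cos_le1 //.
Qed.

(** By the doubling formula sin x = 2 sin(x/2) cos(x/2). On [0, pi/4] the mean value theorem gives
    sin y >= y cos(pi/4), and cos(pi/4)^2 = 1/2. *)
Lemma sin_ge_half (x : R) : 0 <= x <= pi / 2 -> x / 2 <= sin x.
Proof.
case/andP=> x0 x1; pose y := x / 2.
have y0 : 0 <= y by rewrite divr_ge0.
have y1 : y <= pi / 4 by rewrite /y; lra.
have pi0 := @pi_gt0 R.
have cosm c : 0 <= c <= pi / 4 -> cos (pi / 4) <= cos c.
  move=> /andP[c0]; rewrite le_eqVlt => /orP[/eqP -> //|c1].
  by apply/ltW; rewrite ltr_cos ?in_itv //=; lra.
have c4 : cos (pi / 4 : R) ^+ 2 = 1 / 2.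
  have := @cos_mulr2n R (pi / 4).
  rewrite (_ : pi / 4 *+ 2 = pi / 2); last by rewrite -mulr_natr; field.
  rewrite cos_pihalf mulr2n; lra.
have c40 : 0 <= cos (pi / 4 : R) by rewrite cos_ge0_pihalf //; lra.
have siny : y * cos (pi / 4) <= sin y.
  have [c] := @MVT_segment R sin cos 0 y y0 (fun y _ => is_derive_sin y)
    (continuous_subspaceT (@continuous_sin R)).
  rewrite in_itv /= => /andP[c0 c1].
  rewrite sin0 !subr0 => ->; rewrite mulrC ler_wpM2r // cosm //; lra.
rewrite -/y (_ : x = y *+ 2); last by rewrite /y -mulr_natr; field.
rewrite sin_mulr2n.
have cy : cos (pi / 4) <= cos y by apply: cosm; rewrite y0.
have h : cos (pi / 4) * (y * cos (pi / 4)) <= cos y * sin y.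
  by apply: ler_pM => //; rewrite mulr_ge0.
rewrite mulr2n mulrCA -expr2 c4 in h *; lra.
Qed.

Lemma nrm2_1Bee t : nrm2 (1 - ee t) = (2 * sin (pi * t)) ^+ 2.
Proof.
rewrite /nrm2 /= (_ : 2 * pi * t = (pi * t) *+ 2); last by rewrite -mulr_natr; ring.
rewrite cos_mulr2n sin_mulr2n !mulr2n.
have := @cos2Dsin2 R (pi * t); move: (cos _) (sin _) => c s cs.
have -> : (0 - (c * s + c * s)) ^+ 2 = 4 * c ^+ 2 * s ^+ 2 by ring.
have -> : c ^+ 2 = 1 - s ^+ 2 by lra.
ring.
Qed.

Lemma nrm_1Bee t : nrm (1 - ee t) = 2 * `|sin (pi * t)|.
Proof. by rewrite {1}/nrm -/(nrm2 _) nrm2_1Bee sqrtr_sqr normrM ger0_norm. Qed.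

(** Since |1 - e(t)| = 2 |sin(pi t)|, the constant 2 here and the 8 of [nrm_1Bee_le] come from the
    crude bounds 2 <= pi < 4. *)
Lemma nrm_1Bee_ge t n : `|t - n%:~R| <= 1 / 2 -> 2 * `|t - n%:~R| <= nrm (1 - ee t).
Proof.
have -> : ee t = ee (t - n%:~R) by rewrite -[in LHS](subrK n%:~R t) eeDint.
move: (t - _) => {}t ht; rewrite nrm_1Bee ler_wpM2l //.
have pi2 := @pi_ge2 R.
have key (u : R) : 0 <= u <= 1 / 2 -> u <= `|sin (pi * u)|.
  move=> /andP[u0 u1]; have pu0 : 2 * u <= pi * u by rewrite ler_wpM2r.
  have pu1 : pi * u <= pi * (1 / 2) by rewrite ler_wpM2l // pi_ge0.
  apply: (@le_trans _ _ (pi * u / 2)); first by lra.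
  apply: le_trans (ler_norm _); apply: sin_ge_half; lra.
have [t0|t0] := leP 0 t.
  by rewrite (ger0_norm t0) in ht *; apply: key; rewrite t0 ht.
by rewrite (ltr0_norm t0) in ht *; rewrite -normrN -sinN -mulrN; apply: key; lra.
Qed.

Lemma nrm_1Bee_le t n : nrm (1 - ee t) <= 8 * `|t - n%:~R|.
Proof.
have -> : ee t = ee (t - n%:~R) by rewrite -[in LHS](subrK n%:~R t) eeDint.
move: (t - _) => {}t; rewrite nrm_1Bee.
have pi2 := @pihalf_lt2 R; have pi0 := @pi_gt0 R.
have key (u : R) : 0 <= u -> `|sin u| <= u.
  move=> u0; rewrite ler_norml le_sin // andbT.
  have [u1|u1] := leP u 1; last by apply: le_trans (sin_geN1 _); lra.
  suff : 0 <= sin u by lra.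
  have := @pihalf_ge1 R => h; apply: sin_ge0_pi; lra.
have h : `|sin (pi * t)| <= pi * `|t|.
  have [t0|t0] := leP 0 t; first by rewrite (ger0_norm t0) key // mulr_ge0 // ltW.
  by rewrite (ltr0_norm t0) -normrN -sinN -mulrN key // mulr_ge0 ?oppr_ge0 // ltW.
have : pi * `|t| <= 4 * `|t| by apply: ler_wpM2r => //; lra.
lra.
Qed.

Lemma near_int t : exists n, `|t - n%:~R| <= 1 / 2.
Proof.
exists (Num.floor (t + 1 / 2)); have := floor_itv (t + 1 / 2).
rewrite intrD /= => /andP[h1 h2]; rewrite ler_norml; lra.
Qed.

Lemma ee_eq1 t : ee t = 1 -> exists n, t = n%:~R.
Proof.
move=> h; have [n hn] := near_int t; exists n; have := nrm_1Bee_ge hn.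
rewrite h subrr nrm0 => h2; apply/eqP; rewrite -subr_eq0 -normr_le0; lra.
Qed.

(** In product form, to avoid a division by zero at integral t. *)
Lemma nrm_geometric t (k : nat) : nrm (\sum_(i < k) ee (t * i%:R)) * nrm (1 - ee t) <= 2.
Proof.
have -> : \sum_(i < k) ee (t * i%:R) = \sum_(i < k) ee t ^+ i.
  by apply: eq_bigr => i _; rewrite eeX.
rewrite -nrmM mulrC -nrmN -mulNr opprB -subrX1 eeX.
by apply: le_trans (ler_nrmD _ _) _; rewrite nrmN nrm1 nrm_ee.
Qed.

Lemma nrm_sum_ee_le (k : nat) (F : nat -> R) : nrm (\sum_(i < k) ee (F i)) <= k%:R.
Proof.
apply: le_trans (ler_nrm_sum _ _ _) _.
under eq_bigr => i _ do rewrite nrm_ee.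
by rewrite sumr_const card_ord.
Qed.

Lemma sum_ee_orthogonal (P : nat) n : (0 < P)%N ->
  \sum_(c < P) ee (c%:R * n%:~R / P%:R) = if (P%:Z %| n)%Z then P%:R else 0.
Proof.
move=> P0; have P0' : P%:R != 0 :> R by rewrite pnatr_eq0 -lt0n.
pose z := ee (n%:~R / P%:R).
have -> : \sum_(c < P) ee (c%:R * n%:~R / P%:R) = \sum_(c < P) z ^+ c.
  by apply: eq_bigr => i _; rewrite eeX; congr ee; field.
have zP : z ^+ P = 1 by rewrite eeX mulfVK // ee_int.
case: ifPn => [/dvdzP[k nE]|nd].
  have -> : z = 1 by rewrite /z nE intrM -pmulrn mulfK // ee_int.
  under eq_bigr => i _ do rewrite expr1n.
  by rewrite sumr_const card_ord.
have := subrX1 z P; rewrite zP subrr => /esym/eqP; rewrite mulf_eq0 => /orP[|/eqP //].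
rewrite subr_eq0 => /eqP /ee_eq1 [k] hk; case/negP: nd; apply/dvdzP; exists k.
apply: (@intr_inj R); rewrite intrM -pmulrn -hk; field.
by [].
Qed.

End Characters.

(** * Operator norms of quadratic phases *)

Section Operators.
Variable R : realType.

(** Here kap bounds the square of the l^2 operator norm; squares are multiplicative under tensor
    products and need no roots. *)
Definition op_bound (A : finType) (k : A -> A -> R[i]) (kap : R) :=
  forall b : A -> R[i],
    \sum_s nrm2 (\sum_s' k s s' * b s') <= kap * \sum_s' nrm2 (b s').

Lemma op_bound_tensor (A B : finType) (k : A -> A -> R[i]) (l : B -> B -> R[i]) (kap lam : R) :
  0 <= kap -> op_bound k kap -> op_bound l lam ->
  op_bound (fun p p' : A * B => k p.1 p'.1 * l p.2 p'.2) (kap * lam).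
Proof.
move=> kap0 hk hl b.
pose H s' t := \sum_t' l t t' * b (s', t').
have -> : \sum_(p : A * B) nrm2 (\sum_(p' : A * B) k p.1 p'.1 * l p.2 p'.2 * b p') =
    \sum_t \sum_s nrm2 (\sum_s' k s s' * H s' t).
  rewrite exchange_big /=.
  rewrite pair_bigA /=; apply: eq_bigr => -[s t] _ /=; congr nrm2.
  transitivity (\sum_(p : A * B) k s p.1 * l t p.2 * b (p.1, p.2)); first by apply: eq_bigr => -[].
  rewrite -(pair_bigA _ (fun s' t' => k s s' * l t t' * b (s', t'))) /=.
  by apply: eq_bigr => s' _; rewrite mulr_sumr; apply: eq_bigr => t' _; rewrite mulrA.
have -> : \sum_(p : A * B) nrm2 (b p) = \sum_s' \sum_t' nrm2 (b (s', t')).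
  by rewrite pair_bigA; apply: eq_bigr => -[].
apply: (@le_trans _ _ (\sum_t kap * \sum_s' nrm2 (H s' t))).
  by apply: ler_sum => t _; apply: hk.
rewrite -mulr_sumr -mulrA ler_wpM2l // exchange_big mulr_sumr /=.
by apply: ler_sum => s' _; apply: (hl (fun t' => b (s', t'))).
Qed.

Lemma sqr_sum_le (A : finType) (x : A -> R) : (\sum_s x s) ^+ 2 <= #|A|%:R * \sum_s x s ^+ 2.
Proof.
have : 0 <= \sum_s \sum_t (x s - x t) ^+ 2.
  by apply: sumr_ge0 => s _; apply: sumr_ge0 => t _; apply: sqr_ge0.
have -> : \sum_s \sum_t (x s - x t) ^+ 2 =
    2 * (#|A|%:R * (\sum_s x s ^+ 2)) - 2 * (\sum_s x s) ^+ 2.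
  transitivity (\sum_s \sum_t (x s ^+ 2 + x t ^+ 2 - 2 * (x s * x t))).
    by apply: eq_bigr => s _; apply: eq_bigr => t _; ring.
  under eq_bigr => s _ do rewrite sumrB big_split /= sumr_const -mulr_sumr -mulr_sumr.
  rewrite sumrB big_split /= sumr_const -mulr_sumr -mulr_suml expr2.
  by rewrite sumrMnl -(mulr_natl (\sum_s x s ^+ 2)); ring.
lra.
Qed.

Lemma op_bound_quad (A : finType) (k : A -> A -> R[i]) (kap : R) (F : A -> R) :
    0 <= kap -> op_bound k kap -> (forall s, 0 <= F s <= 1) ->
  nrm (\sum_s \sum_s' k s s' * (F s * F s')%:C%C) ^+ 2 <= kap * #|A|%:R ^+ 2.
Proof.
move=> kap0 hk F01.
pose y s := \sum_s' k s s' * (F s')%:C%C.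
have F0 s : 0 <= F s by case/andP: (F01 s).
have F1 s : F s <= 1 by case/andP: (F01 s).
have h1 : nrm (\sum_s \sum_s' k s s' * (F s * F s')%:C%C) <= \sum_s nrm (y s).
  apply: le_trans (ler_nrm_sum _ _ _) _; apply: ler_sum => s _.
  have -> : \sum_s' k s s' * (F s * F s')%:C%C = (F s)%:C%C * y s.
    by rewrite mulr_sumr; apply: eq_bigr => s' _; rewrite rmorphM /=; ring.
  by rewrite nrmM nrm_real ger0_norm // ler_piMl // nrm_ge0.
have h2 : nrm (\sum_s \sum_s' k s s' * (F s * F s')%:C%C) ^+ 2 <= (\sum_s nrm (y s)) ^+ 2.
  rewrite lerXn2r ?nnegrE ?nrm_ge0 //; apply: sumr_ge0 => s _; exact: nrm_ge0.
apply: le_trans h2 _; apply: le_trans (sqr_sum_le _) _.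
under eq_bigr => s _ do rewrite nrm_sqr.
rewrite mulrC expr2 mulrA ler_wpM2r //; apply: le_trans (hk _) _.
rewrite ler_wpM2l // -[leRHS]mulr1 mulr_natl -sumr_const; apply: ler_sum => s _.
by rewrite /nrm2 /= expr0n addr0 expr_le1.
Qed.

Lemma conjcM (z w : R[i]) : (z * w)^*%C = z^*%C * w^*%C.
Proof. exact: rmorphM. Qed.

Lemma conjc_sum (I : Type) (r : seq I) (P : pred I) (F : I -> R[i]) :
  (\sum_(i <- r | P i) F i)^*%C = \sum_(i <- r | P i) (F i)^*%C.
Proof. exact: rmorph_sum. Qed.

Definition geom (n : nat) (t : R) : R[i] := \sum_(i < n) ee (t * i%:R).

Lemma geom_conj n t : (geom n t)^*%C = geom n (- t).
Proof.
rewrite /geom conjc_sum; apply: eq_bigr => i _.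
by rewrite ee_conj mulNr.
Qed.

Lemma nrm2_conj (z : R[i]) : nrm2 z^*%C = nrm2 z.
Proof. by rewrite -!nrm_sqr nrm_conj. Qed.

Lemma nrm2_geomN n t : nrm2 (geom n (- t)) = nrm2 (geom n t).
Proof. by rewrite -geom_conj nrm2_conj. Qed.

(** The sum of Weyl differencing. The factor 2 accounts for both signs of the difference h, and 1 /
    L for the averaging over windows. *)
Definition kappa (L : nat) (a : R) : R :=
  2 / L%:R * \sum_(0 <= h < L) nrm2 (geom (2 * L) (2 * a * h%:R)).

Lemma kappa_ge0 L a : 0 <= kappa L a.
Proof.
by rewrite mulr_ge0 ?divr_ge0 //; apply: sumr_ge0 => h _; apply: nrm2_ge0.
Qed.

Lemma ler_sum_nat_sub (F : nat -> R) (a b n : nat) : (forall i, 0 <= F i) -> (b <= n)%N ->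
  \sum_(a <= i < b) F i <= \sum_(0 <= i < n) F i.
Proof.
move=> F0 bn; have [ba|ab] := leqP b a.
  by rewrite big_geq // sumr_ge0.
rewrite [leRHS](big_cat_nat (n := b)) //= [X in _ <= X + _](big_cat_nat (n := a)) //=; last exact: ltnW.
by rewrite -addrA addrCA lerDl addr_ge0 // sumr_ge0.
Qed.

(** Each s < L is a difference i - j for every j < L. Summing over a full square of pairs (i, j),
    rather than over s, is what makes the cross terms factor into squares of geometric sums. *)
Lemma window_average (g : R -> R) (L : nat) : (forall x, 0 <= g x) ->
  L%:R * \sum_(s < L) g s%:R <=
  \sum_(i < 2 * L) \sum_(j < 2 * L) g (i%:R - j%:R).
Proof.
move=> g0; rewrite exchange_big /=.
rewrite -(big_mkord xpredT (fun j => \sum_(i < 2 * L) g (i%:R - j%:R))) /=.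
apply: le_trans (@ler_sum_nat_sub _ 0 L _ _ _); last 2 first.
- by move=> j; apply: sumr_ge0.
- by rewrite leq_pmull.
rewrite [leLHS](_ : _ = \sum_(0 <= j < L) \sum_(s < L) g s%:R); last first.
  by rewrite big_const_nat iter_addr addr0 subn0 mulr_natl.
rewrite big_nat_cond [leRHS]big_nat_cond; apply: ler_sum => j; rewrite andbT => /andP[_ jL].
rewrite -(big_mkord xpredT (fun i => g (i%:R - j%:R))) -(big_mkord xpredT (fun s => g s%:R)).
apply: (@le_trans _ _ (\sum_(0 + j <= i < L + j) g (i%:R - j%:R))); last first.
  apply: ler_sum_nat_sub => //; lia.
rewrite big_addn addnK; apply: ler_sum => s _.
by rewrite natrD addrK.
Qed.

Lemma sum_dist_le (w : R -> R) (L s : nat) : (forall x, 0 <= w x) -> (forall x, w (- x) = w x) ->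
  (s < L)%N -> \sum_(t < L) w (s%:R - t%:R) <= 2 * \sum_(0 <= h < L) w h%:R.
Proof.
move=> w0 wN sL; rewrite -(big_mkord xpredT (fun t => w (s%:R - t%:R))).
rewrite (big_cat_nat (n := s.+1)) //= mulr_natl mulr2n; apply: lerD.
  rewrite big_nat_rev /= add0n.
  apply: (@le_trans _ _ (\sum_(0 <= t < s.+1) w t%:R)); last exact: ler_sum_nat_sub.
  rewrite big_nat_cond [leRHS]big_nat_cond; apply: ler_sum => t; rewrite andbT => /andP[_ ts].
  by rewrite subSS -natrB ?leq_subr // subKn.
rewrite -{1}[s.+1]add1n big_addn.
apply: (@le_trans _ _ (\sum_(1 <= h < L - s) w h%:R)); last by apply: ler_sum_nat_sub => //; lia.
apply: ler_sum => h _.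
by rewrite natrD opprD addrCA subrr addr0 wN.
Qed.

(** The output B is defined at every real point, so its l^2 norm on [0, L) may be replaced by an
    average over differences i - j. Expanding the square then leaves the nonnegative weights W, to
    which Schur's test applies. *)
Lemma op_bound_phase (L : nat) (a : R) :
  op_bound (fun s s' : 'I_L => ee (a * (s'%:R - s%:R) ^+ 2)) (kappa L a).
Proof.
move=> b; have [L0|Lpos] := posnP L.
  by subst L; rewrite !big_ord0 mulr0.
pose B (z : R) := \sum_(s' < L) ee (a * (s'%:R - z) ^+ 2) * b s'.
pose W (s s' : 'I_L) := nrm2 (geom (2 * L) (2 * a * (s%:R - s'%:R))).
have LR : 0 < L%:R :> R by rewrite ltr0n.
have WC s s' : W s s' = W s' s by rewrite /W -nrm2_geomN; congr (nrm2 (geom _ _)); ring.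
have key : \sum_(i < 2 * L) \sum_(j < 2 * L) nrm2 (B (i%:R - j%:R)) <=
    \sum_s \sum_s' nrm (b s) * nrm (b s') * W s s'.
  (* The terms quadratic in i - j cancel; what is left is linear in i - j, and its double sum is the
     square of a geometric sum. *)
  have E : (\sum_(i < 2 * L) \sum_(j < 2 * L) nrm2 (B (i%:R - j%:R)))%:C%C =
     \sum_(s < L) \sum_(s' < L) b s * (b s')^*%C * ee (a * (s%:R ^+ 2 - s'%:R ^+ 2)) * (W s s')%:C%C.
    transitivity (\sum_(i < 2 * L) \sum_(j < 2 * L) \sum_(s < L) \sum_(s' < L)
        b s * (b s')^*%C * ee (a * (s%:R ^+ 2 - s'%:R ^+ 2)) *
          (ee (- (2 * a * (s%:R - s'%:R)) * i%:R) * ee (2 * a * (s%:R - s'%:R) * j%:R))).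
      rewrite rmorph_sum; apply: eq_bigr => i _ /=; rewrite rmorph_sum; apply: eq_bigr => j _ /=.
      rewrite -mulJ_nrm2 conjc_sum mulr_suml; apply: eq_bigr => s _.
      rewrite mulr_sumr; apply: eq_bigr => s' _; rewrite conjcM ee_conj.
      rewrite mulrACA mulrC -mulrA; congr (_ * _); rewrite -!eeD; congr ee; ring.
    under eq_bigr => i _ do rewrite exchange_big.
    rewrite exchange_big; apply: eq_bigr => s _ /=.
    under eq_bigr => i _ do rewrite exchange_big.
    rewrite exchange_big; apply: eq_bigr => s' _ /=.
    rewrite -mulJ_nrm2 geom_conj mulr_suml !mulr_sumr.
    rewrite exchange_big; apply: eq_bigr => i _ /=.
    rewrite !mulr_sumr; apply: eq_bigr => j _ /=; rewrite -!mulrA; congr (_ * (_ * (_ * _))).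
    by rewrite mulrC.
  have : complex.Re ((\sum_(i < 2 * L) \sum_(j < 2 * L) nrm2 (B (i%:R - j%:R)))%:C%C) <=
      \sum_s \sum_s' nrm (b s) * nrm (b s') * W s s'.
    rewrite E; apply: le_trans (Re_le_nrm _) _; apply: le_trans (ler_nrm_sum _ _ _) _.
    apply: ler_sum => s _; apply: le_trans (ler_nrm_sum _ _ _) _; apply: ler_sum => s' _.
    by rewrite !nrmM nrm_real nrm_conj nrm_ee mulr1 ger0_norm // nrm2_ge0.
  by [].
have avg := window_average (g := fun z => nrm2 (B z)) L (fun z => nrm2_ge0 _).
rewrite -(ler_pM2l LR); apply: le_trans avg _; apply: le_trans key _.
(* Schur's test: 2 |b_s| |b_s'| <= |b_s|^2 + |b_s'|^2 and W is symmetric. *)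
apply: (@le_trans _ _ (\sum_s \sum_s' nrm2 (b s) * W s s')).
  have {1}-> : \sum_s \sum_s' nrm (b s) * nrm (b s') * W s s' =
     (\sum_s \sum_s' nrm (b s) * nrm (b s') * W s s' + \sum_s \sum_s' nrm (b s) * nrm (b s') * W s s') / 2.
    by field.
  have -> : \sum_s \sum_s' nrm2 (b s) * W s s' =
     (\sum_s \sum_s' nrm2 (b s) * W s s' + \sum_s \sum_s' nrm2 (b s') * W s s') / 2.
    rewrite [X in _ + X]exchange_big /=.
    under [X in _ + X]eq_bigr => s _ do under eq_bigr => s' _ do rewrite WC.
    by field.
  rewrite ler_wpM2r ?invr_ge0 // -!big_split /=; apply: ler_sum => s _.
  rewrite -!big_split /=; apply: ler_sum => s' _; rewrite -!mulrDl ler_wpM2r ?nrm2_ge0 //.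
  rewrite -!nrm_sqr; have := sqr_ge0 (nrm (b s) - nrm (b s')); rewrite sqrrB; lra.
rewrite mulrA mulr_sumr; apply: ler_sum => s _; rewrite -mulr_sumr mulrC ler_wpM2r ?nrm2_ge0 //.
apply: le_trans (@sum_dist_le (fun z => nrm2 (geom (2 * L) (2 * a * z))) L s _ _ _) _ => //.
- by move=> z; apply: nrm2_ge0.
- by move=> z; rewrite mulrN nrm2_geomN.
by rewrite /kappa mulrA mulrCA mulfV ?mulr1 // gt_eqF.
Qed.

End Operators.

(** * Rational approximation and Weyl's inequality *)

Section Arcs.
Variable R : realType.

(** Pigeonhole: n + 1 fractional parts lie in n intervals of length 1 / n. *)
Lemma dirichlet_approx (n : nat) (t : R) : (0 < n)%N ->
  exists (r : nat) (A : int), [/\ (0 < r)%N, (r <= n)%N & `|r%:R * t - A%:~R| <= 1 / n%:R].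
Proof.
case: n => // n _; set N := n.+1.
have N0 : 0 < N%:R :> R by rewrite ltr0n.
pose fl (j : nat) := Num.floor (j%:R * t).
pose fr (j : nat) := j%:R * t - (fl j)%:~R.
have fr01 j : 0 <= fr j < 1.
  have := floor_itv (j%:R * t); rewrite intrD /fr /fl /=; lra.
have tr j : (Num.truncn (N%:R * fr j) < N)%N.
  have /andP[f0 f1] := fr01 j.
  rewrite -(ltr_nat R); apply: (@le_lt_trans _ _ (N%:R * fr j)).
    by rewrite truncn_le mulr_ge0.
  by rewrite gtr_pMr.
pose f (j : 'I_N.+1) : 'I_N := Ordinal (tr j).
have : ~~ injectiveb f.
  apply/negP => /injectiveP finj.
  have := leq_card f finj; rewrite !card_ord; lia.
case/injectivePn => x [y xy fxy].
wlog lt : x y xy fxy / (x < y)%N.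
  move=> h; have [lt|lt|e] := ltngtP x y; first exact: (h x y).
    by apply: (h y x) => //; rewrite eq_sym.
  by case/eqP: xy; apply: val_inj.
exists (y - x)%N, (fl y - fl x); split; first by lia.
  by have := ltn_ord y; lia.
have e : Num.truncn (N%:R * fr x) = Num.truncn (N%:R * fr y) by case: fxy.
have bx j : (Num.truncn (N%:R * fr j))%:R <= N%:R * fr j < (Num.truncn (N%:R * fr j)).+1%:R.
  by have /andP[f0 f1] := fr01 j; apply: truncn_itv; rewrite mulr_ge0.
have := bx x; have := bx y; rewrite -e -natr1 => hy hx.
have -> : (y - x)%:R * t - (fl y - fl x)%:~R = fr y - fr x.
  by rewrite natrB 1?ltnW // intrB /fr; ring.
rewrite -(ler_pM2l N0) -{1}(gtr0_norm N0) -normrM mulrBr mul1r mulfV ?gt_eqF // ler_norml; lra.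
Qed.

Lemma coprime_dirichlet_approx (n : nat) (t : R) : (0 < n)%N ->
  exists (r : nat) (A : int), [/\ (0 < r)%N, (r <= n)%N, coprime r `|A| &
    `|r%:R * t - A%:~R| <= 1 / n%:R].
Proof.
move=> n0; have [r0 [A0 [r00 r0n h0]]] := dirichlet_approx t n0.
pose g := gcdn r0 `|A0|.
have g0 : (0 < g)%N by rewrite gcdn_gt0 r00.
have /dvdnP[r rE] : (g %| r0)%N by apply: dvdn_gcdl.
have /dvdzP[A AE] : (g%:Z %| A0)%Z by rewrite dvdzE /=; apply: dvdn_gcdr.
have r1 : (0 < r)%N by move: r00; rewrite rE muln_gt0 => /andP[].
exists r, A; split=> //.
- by apply: leq_trans r0n; rewrite rE leq_pmulr.
- rewrite /coprime; apply/eqP.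
  have : gcdn r0 `|A0| = (gcdn r `|A| * g)%N by rewrite rE AE abszM absz_nat muln_gcdl.
  rewrite -/g => /eqP; rewrite -{1}[g]mul1n eqn_pmul2r // => /eqP //.
- apply: le_trans h0; rewrite rE AE intrM natrM -pmulrn.
  rewrite (_ : r%:R * g%:R * t - A%:~R * g%:R = g%:R * (r%:R * t - A%:~R)); last by ring.
  by rewrite normrM ler_peMl // normr_nat ler1n.
Qed.

Lemma sum_nat_blocks (V : zmodType) (F : nat -> V) (r K : nat) :
  \sum_(0 <= h < r * K) F h = \sum_(0 <= k < K) \sum_(0 <= j < r) F (r * k + j)%N.
Proof.
elim: K => [|K IH]; first by rewrite muln0 !big_geq.
rewrite big_nat_recr //= -IH mulnS addnC (big_cat_nat (n := (r * K)%N)) //= ?leq_addr //.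
congr (_ + _); rewrite -{1}[(r * K)%N]add0n big_addn addKn.
by apply: eq_bigr => j _; rewrite addnC.
Qed.

Lemma sum_mul_mod (V : zmodType) (u : nat -> V) (a r : nat) : coprime r a -> (0 < r)%N ->
  \sum_(0 <= j < r) u ((a * j) %% r)%N = \sum_(0 <= j < r) u j.
Proof.
move=> cra r0; rewrite !big_mkord.
have lt (j : 'I_r) : ((a * j) %% r < r)%N by rewrite ltn_mod.
pose h (j : 'I_r) := Ordinal (lt j).
have hinj : injective h.
  move=> i j [] /eqP.
  wlog ij : i j / (i <= j)%N.
    move=> H; have [le|le] := leqP i j; first exact: H.
    by rewrite eq_sym => e; apply/esym/H => //; apply: ltnW.
  rewrite eq_sym eqn_mod_dvd ?leq_mul2l ?ij ?orbT // -mulnBr Gauss_dvdr // => d.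
  apply: val_inj; apply/eqP; rewrite eqn_leq ij /=.
  have lt2 : (j - i < r)%N by apply: leq_ltn_trans (ltn_ord j); apply: leq_subr.
  by move: d; rewrite /dvdn modn_small // subn_eq0.
by rewrite [RHS](reindex_inj hinj).
Qed.

Lemma sum_inv_sqr_le (r : nat) : \sum_(1 <= b < r) (b%:R ^- 2 : R) <= 2.
Proof.
have [r1|r1] := leqP r 1; first by rewrite big_geq.
suff : \sum_(1 <= b < r) (b%:R ^- 2 : R) <= 2 - 1 / (r.-1)%:R.
  move=> h; apply: le_trans h _; rewrite gerBl divr_ge0 //.
elim: r r1 => // -[|r] // IH; case: r IH => [_ _|r IH _].
  by rewrite big_nat1 expr1n invr1; lra.
rewrite big_nat_recr //=; have := IH isT; rewrite /= => h.
apply: le_trans (lerD h (lexx _)) _.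
have x0 : 0 < r.+1%:R :> R by rewrite ltr0n.
rewrite -[r.+2]addn1 natrD; set x := r.+1%:R in x0 *.
rewrite -subr_ge0 (_ : _ - _ = 1 / (x * (x + 1) ^+ 2)).
  by apply: divr_ge0 => //; apply: mulr_ge0; [exact: ltW|exact: sqr_ge0].
by field; rewrite ?gt_eqF //; lra.
Qed.

Lemma min_residue_le_absz (T m : int) (b r : nat) :
  T - b%:Z = m * r%:Z -> (b < r)%N -> (minn b (r - b) <= `|T|)%N.
Proof.
move=> hm br; have [m0|[m0|m0]] : m = 0 \/ m <= -1 \/ 1 <= m by lia.
- by move: hm; rewrite m0 mul0r; lia.
- have : m * r%:Z <= -1 * r%:Z by apply: ler_wpM2r.
  lia.
- have : 1 * r%:Z <= m * r%:Z by apply: ler_wpM2r.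
  lia.
Qed.

(** Comparison of the sum of 4 / (u + k z)^2 with an integral, in telescoping form. *)
Lemma telescope_step (u y z : R) : 0 < u -> 0 <= y -> 0 < z ->
  4 / z * (1 / u - 1 / (u + y)) + 4 / (u + (y + z)) ^+ 2 <=
  4 / z * (1 / u - 1 / (u + (y + z))).
Proof.
move=> u0 y0 z0; have uy : 0 < u + y by lra.
have uyz : 0 < u + (y + z) by lra.
rewrite -subr_ge0 [leRHS](_ : _ = 4 * z / ((u + y) * (u + (y + z)) ^+ 2)).
  by apply: divr_ge0; apply: mulr_ge0; rewrite ?sqr_ge0 // ltW.
by field; rewrite !gt_eqF.
Qed.

Lemma three_mul_lt_exp4 (n : nat) : (0 < n)%N -> (3 * n < 4 ^ n)%N.
Proof. by elim: n => // -[|n] IH _ //; have := IH isT; rewrite [(4 ^ n.+2)%N]expnS; lia. Qed.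

Lemma succ_div_mul_le (L r : nat) : (r <= L * 2)%N -> ((L %/ r).+1 * r <= 3 * L)%N.
Proof. by move=> h; rewrite mulSn; have := leq_divM L r; lia. Qed.

Lemma geom_le (n : nat) (t : R) : nrm (geom n t) <= n%:R.
Proof. exact: (@nrm_sum_ee_le R n (fun i => t * i%:R)). Qed.

Lemma geom_dist (n : nat) (t : R) (z : int) : `|t - z%:~R| <= 1 / 2 ->
  nrm (geom n t) * `|t - z%:~R| <= 1.
Proof.
move=> h; have := nrm_geometric t n; have := nrm_1Bee_ge h; rewrite -/(geom n t).
move: (nrm_ge0 (geom n t)) (normr_ge0 (t - z%:~R)); set x := nrm _; set y := `|_|.
move: (nrm _) => w x0 y0 wy xw.
have : x * (2 * y) <= x * w by apply: ler_wpM2l.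
lra.
Qed.

(* Weyl's bound: kappa L a is of size L^2 / (r + L^2 |2 a r - A|) for a Dirichlet
   approximation A / r of 2 a, here in dyadic form. *)
Definition weyl_bound (W : R) := forall (L : nat) (a : R), (0 < L)%N ->
  exists i r (A : int), [/\ (i < L)%N, (0 < r <= 4 ^ i.+1)%N,
    `|r%:R * (2 * a) - A%:~R| * L%:R ^+ 2 <= 4 ^+ i.+1 &
    kappa L a <= W * L%:R ^+ 2 / 4 ^+ i].

(** The differences h are split by divisibility by the denominator r of 2 a. Multiples of r are
    close to integers and their sum is controlled by z; on the others A h modulo r runs through the
    nonzero residues, and the inverse squares of their distances to 0 are summable. *)
Lemma weyl_bound_exists : exists2 W, 1 <= W & weyl_bound W.
Proof.
exists 608 => [|L a L0]; first by rewrite ler1n.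
 pose t := 2 * a.
(* The bound 2 L for denominators gives z <= 1 / (2 L), hence h z <= 1 / 2 for all h <= L. *)
have [r [A [r0 rL cop hz]]] := @coprime_dirichlet_approx (2 * L) t (ltac:(lia)).
set z := `|r%:R * t - A%:~R| in hz.
have z0 : 0 <= z by exact: normr_ge0.
pose l : R := L%:R; have l0 : 0 < l by rewrite ltr0n.
have l1 : 1 <= l by rewrite ler1n.
pose q : R := r%:R; have q0 : 0 < q by rewrite ltr0n.
have q1 : 1 <= q by rewrite ler1n.
have ql : q <= 2 * l by rewrite /q /l -natrM ler_nat.
have hz' : z <= 1 / (2 * l) by rewrite /l -natrM.
have zl : z * l <= 1 / 2.
  have := ler_wpM2r (ltW l0) hz'; rewrite (_ : 1 / (2 * l) * l = 1 / 2) //; field; lra.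
pose dn h := nrm2 (geom (2 * L) (t * h%:R)).
pose u : R := 1 / (2 * l).
have u0 : 0 < u by rewrite divr_gt0 // mulr_gt0.
pose V (k : nat) : R := 4 / (u + k%:R * z) ^+ 2.
pose a0 := `|(A %% r)%Z|%N.
have a0E : (a0%:Z = (A %% r)%Z)%Z by rewrite /a0 gez0_abs // modz_ge0 // lt0n_neq0.
have cop0 : coprime r a0.
  have : coprimez r A by rewrite coprimezE.
  by rewrite /coprimez -gcdz_modr -a0E -/(coprimez _ _) coprimezE.
pose w (b : nat) : R := if b == 0%N then 0 else 4 * q ^+ 2 * (b%:R ^- 2 + (r - b)%:R ^- 2).
have w0 b : 0 <= w b.
  by rewrite /w; case: ifP => // _; rewrite !mulr_ge0 ?sqr_ge0 ?addr_ge0 ?invr_ge0 ?sqr_ge0.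
have V0 k : 0 <= V k.
  by rewrite divr_ge0 // sqr_ge0.
pose K := (L %/ r).+1.
have LK : (L <= r * K)%N by rewrite /K mulnC ltnW // ltn_ceil.
(* For h = r k the number t h lies at distance k z from the integer A k; this is combined with the
   trivial bound 1 / u = 2 L. *)
have dn_mul k : (r * k < L)%N -> dn (r * k)%N <= V k.
  move=> rk; rewrite /dn -nrm_sqr /V ler_pdivlMr; last first.
    by rewrite exprn_gt0 // ltr_wpDr // mulr_ge0.
  have kl : k%:R <= l / q.
    by rewrite ler_pdivlMr // /l /q -natrM ler_nat mulnC ltnW.
  have kz : k%:R * z <= 1 / 2.
    apply: le_trans (_ : l * z <= _); last by rewrite mulrC.
    apply: ler_wpM2r => //; apply: le_trans kl _; rewrite ler_pdivrMr // ler_peMr // ltW //.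
  have E : `|t * (r * k)%:R - (A * k)%:~R| = k%:R * z.
    rewrite /z -[k%:R in RHS]normr_nat -normrM; congr `|_|.
    by rewrite intrM natrM -pmulrn; ring.
  have h1 : nrm (geom (2 * L) (t * (r * k)%:R)) * (k%:R * z) <= 1.
    by rewrite -E; apply: geom_dist; rewrite E.
  have h2 := geom_le (2 * L) (t * (r * k)%:R).
  rewrite -exprMn -[leRHS](_ : 2 ^+ 2 = 4); last by rewrite -natrX.
  rewrite lerXn2r ?nnegrE //.
    by apply: mulr_ge0; [exact: nrm_ge0|apply: addr_ge0; [exact: ltW|exact: mulr_ge0]].
  have h3 : nrm (geom (2 * L) (t * (r * k)%:R)) * u <= 1.
    have e : (2 * L)%:R * u = 1 by rewrite natrM -/l /u mul1r mulfV // gt_eqF // mulr_gt0.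
    by have := ler_wpM2r (ltW u0) h2; rewrite e.
  rewrite mulrDr; lra.
(* Otherwise t h differs from A h / r by at most 1 / (2 r), so at least half of the distance of A h
   / r to the integers survives. *)
have dn_nmul h : (h < L)%N -> (h %% r != 0)%N -> dn h <= w ((a0 * h) %% r)%N.
  move=> hL hr; set b := ((a0 * h) %% r)%N.
  have br : (b < r)%N by rewrite ltn_mod.
  have b0 : b != 0%N.
    by apply: contra hr; rewrite -/(dvdn _ _) -/(dvdn _ _) Gauss_dvdr.
  have [n hn] := near_int (t * h%:R).
  pose T := A * h%:Z - r%:Z * n.
  have [m hm] : exists m : int, T - b%:Z = m * r%:Z.
    exists ((A %/ r)%Z * h%:Z - n + ((a0 * h) %/ r)%N%:Z).
    have := divz_eq A r; rewrite -a0E => AE.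
    have := divn_eq (a0 * h) r; rewrite -/b => /(congr1 Posz); rewrite PoszD !PoszM => bE.
    have {}bE : b%:Z = a0%:Z * h%:Z - ((a0 * h) %/ r)%N%:Z * r%:Z by rewrite bE [in RHS]addrAC subrr add0r.
    rewrite /T bE {1}AE; ring.
  have Tge := min_residue_le_absz hm br.
  have mb : (1 <= minn b (r - b))%N by rewrite leq_min lt0n b0 subn_gt0 br.
  set mm := minn b (r - b) in Tge mb.
  have dist : mm%:R / (2 * q) <= `|t * h%:R - n%:~R|.
    have E : q * (t * h%:R - n%:~R) = T%:~R + h%:R * (r%:R * t - A%:~R).
      by rewrite /T intrB !intrM -!pmulrn; rewrite /q; ring.
    have h1 : `|T%:~R| - h%:R * z <= q * `|t * h%:R - n%:~R|.
      rewrite -[q in leRHS](gtr0_norm q0) -normrM E /z -[h%:R in leLHS]normr_nat -normrM.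
      exact: lerB_normD.
    have h2 : h%:R * z <= 1 / 2.
      apply: le_trans zl; rewrite mulrC ler_wpM2l // /l ler_nat ltnW //.
    have h3 : mm%:R <= `|T%:~R| :> R.
      by rewrite -intr_norm -[ `|T|]abszE -pmulrn ler_nat.
    have h4 : 1 <= mm%:R :> R by rewrite ler1n.
    rewrite ler_pdivrMr; last by rewrite mulr_gt0.
    rewrite mulrC -mulrA; lra.
  have m0 : 0 < mm%:R :> R by rewrite ltr0n.
  have h1 := geom_dist (2 * L) hn.
  have h2 : nrm (geom (2 * L) (t * h%:R)) <= 2 * q / mm%:R.
    rewrite ler_pdivlMr //.
    have : nrm (geom (2 * L) (t * h%:R)) * (mm%:R / (2 * q)) <= 1.
      by apply: le_trans h1; apply: ler_wpM2l => //; apply: nrm_ge0.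
    by rewrite mulrA ler_pdivrMr ?mul1r // mulr_gt0.
  have h3 : dn h <= 4 * q ^+ 2 * mm%:R ^- 2.
    rewrite /dn -nrm_sqr; apply: le_trans (_ : (2 * q / mm%:R) ^+ 2 <= _).
      by rewrite lerXn2r ?nnegrE ?nrm_ge0 // divr_ge0 ?mulr_ge0 // ltW.
    by rewrite exprMn exprMn exprVn (_ : 2 ^+ 2 = 4 :> R) // -natrX.
  apply: le_trans h3 _; rewrite /w (negbTE b0) ler_wpM2l ?mulr_ge0 ?sqr_ge0 //.
  rewrite /mm; case: (leqP b (r - b)) => _.
    by rewrite lerDl invr_ge0 exprn_ge0.
  by rewrite lerDr invr_ge0 exprn_ge0.
pose H (h : nat) : R := (if (h %% r == 0)%N then V (h %/ r)%N else 0) + w ((a0 * h) %% r)%N.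
have H0 h : 0 <= H h by rewrite addr_ge0 //; case: ifP.
have dnH h : (h < L)%N -> dn h <= H h.
  move=> hL; rewrite /H; case: eqP => [hr|/eqP hr]; last by rewrite add0r dn_nmul.
  have hE : h = (r * (h %/ r))%N by rewrite {1}(divn_eq h r) hr addn0 mulnC.
  apply: le_trans (_ : V (h %/ r)%N <= _); last by rewrite lerDl.
  by rewrite {1}hE dn_mul // -hE.
have sumH : \sum_(0 <= h < r * K) H h = \sum_(0 <= k < K) V k + K%:R * \sum_(0 <= j < r) w j.
  rewrite sum_nat_blocks (eq_bigr (fun k => V k + \sum_(0 <= j < r) w j)).
    by rewrite big_split /= big_const_nat iter_addr addr0 subn0 [K%:R * _]mulr_natl.
  move=> k _; rewrite big_split /=; congr (_ + _).
    rewrite big_ltn // addn0 modnMr eqxx mulKn // big_nat_cond big1 ?addr0 // => j.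
    rewrite andbT => /andP[j1 jr].
    by rewrite mulnC modnMDl modn_small // -[j == 0%N]negbK -lt0n j1.
  rewrite -(sum_mul_mod w cop0 r0); apply: eq_bigr => j _; congr w.
  by rewrite mulnDr mulnCA mulnC modnMDl.
have sumw : \sum_(0 <= j < r) w j <= 16 * q ^+ 2.
  rewrite big_ltn // {1}/w eqxx add0r.
  have -> : \sum_(1 <= j < r) w j = 4 * q ^+ 2 * (\sum_(1 <= j < r) j%:R ^- 2 + \sum_(1 <= j < r) (r - j)%:R ^- 2).
    rewrite -big_split mulr_sumr /= big_nat_cond [RHS]big_nat_cond; apply: eq_bigr => j.
    by rewrite andbT => /andP[j1 _]; rewrite /w -[j == 0%N]leqn0 leqNgt j1.
  have e2 : \sum_(1 <= j < r) ((r - j)%:R ^- 2 : R) = \sum_(1 <= j < r) (j%:R ^- 2 : R).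
    by rewrite [RHS]big_nat_rev /=; apply: eq_bigr => j _; rewrite add1n subSS.
  have := sum_inv_sqr_le r; rewrite e2 => s2.
  have : 4 * q ^+ 2 * (\sum_(1 <= j < r) (j%:R ^- 2 : R) + \sum_(1 <= j < r) (j%:R ^- 2 : R)) <= 4 * q ^+ 2 * 4.
    by apply: ler_wpM2l; [rewrite mulr_ge0 ?sqr_ge0|lra].
  lra.
have Kq : K%:R * q <= 3 * l.
  rewrite /K /q /l -!natrM ler_nat.
  by apply: succ_div_mul_le; move: rL; rewrite mulnC.
set SV := \sum_(0 <= k < K) V k in sumH.
have SV0 : 0 <= SV by apply: sumr_ge0.
(* Two bounds for SV: each of the K terms is at most 4 / u^2 = 16 l^2, which is good for small z,
   and telescoping below is good for large z. *)
have SVr : SV * q <= 48 * l ^+ 3.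
  have : SV <= K%:R * (16 * l ^+ 2).
    rewrite mulr_natl -[X in _ *+ X]subn0 -[in leRHS](addr0 (_ *+ _)) -iter_addr -big_const_nat.
    apply: ler_sum => k _; rewrite /V ler_pdivrMr; last by rewrite exprn_gt0 // ltr_wpDr // mulr_ge0.
    apply: le_trans (_ : 16 * l ^+ 2 * u ^+ 2 <= _).
      have -> : 16 * l ^+ 2 * u ^+ 2 = 4 by rewrite /u; field; rewrite gt_eqF.
      by [].
    have uk : u <= u + k%:R * z by rewrite lerDl mulr_ge0.
    apply: ler_wpM2l; first by apply: mulr_ge0 => //; apply: sqr_ge0.
    have u0' := ltW u0; have uk0 := le_trans u0' uk.
    by rewrite lerXn2r.
  move=> h; have := ler_wpM2r (ltW q0) h.
  have := ler_wpM2r (_ : 0 <= 16 * l ^+ 2) Kq.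
  rewrite mulr_ge0 ?sqr_ge0 // => /(_ isT); lra.
have SVz : SV * z <= 16 * l.
  have [->|zn0] := eqVneq z 0; first by rewrite mulr0 mulr_ge0 // ltW.
  have zp : 0 < z by rewrite lt_def zn0.
  have tel : SV <= 16 * l ^+ 2 + 4 / z * (1 / u - 1 / (u + (L %/ r)%:R * z)).
    rewrite /SV /K big_ltn //; apply: lerD.
      by rewrite /V mul0r addr0 /u le_eqVlt; apply/orP; left; apply/eqP; field; rewrite gt_eqF.
    elim: (L %/ r)%N => [|k IH]; first by rewrite big_geq // mul0r addr0 subrr mulr0.
    rewrite big_nat_recr //=; apply: le_trans (lerD IH (lexx _)) _.
    rewrite /V (_ : k.+1%:R * z = k%:R * z + z); last by rewrite -natr1 mulrDl mul1r.
    have y0 : 0 <= k%:R * z by rewrite mulr_ge0.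
    exact: telescope_step.
  have : 4 / z * (1 / u - 1 / (u + (L %/ r)%:R * z)) <= 4 / z * (2 * l).
    rewrite ler_wpM2l ?divr_ge0 //.
    have -> : 1 / u = 2 * l by rewrite /u; field; rewrite gt_eqF.
    by rewrite gerBl; apply: divr_ge0 => //; apply: addr_ge0; [exact: ltW|exact: mulr_ge0].
  move=> h; have h2 : SV <= 16 * l ^+ 2 + 4 / z * (2 * l) by lra.
  have := ler_wpM2r z0 h2; rewrite mulrDl.
  rewrite (_ : 4 / z * (2 * l) * z = 8 * l); last by field.
  rewrite (_ : 16 * l ^+ 2 * z = 16 * l * (z * l)); last by ring.
  have l16 : 0 <= 16 * l by apply: mulr_ge0 => //; exact: ltW.
  have := ler_wpM2l l16 zl; lra.
have kap : kappa L a * l <= 2 * (SV + 48 * l * q).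
  rewrite /kappa -/l mulrAC divfK ?gt_eqF // ler_wpM2l //.
  apply: (@le_trans _ _ (\sum_(0 <= h < r * K) H h)).
    apply: (@le_trans _ _ (\sum_(0 <= h < L) H h)); last exact: ler_sum_nat_sub.
    rewrite big_nat_cond [leRHS]big_nat_cond; apply: ler_sum => h; rewrite andbT => /andP[_ hL].
    exact: dnH.
  rewrite sumH lerD2l; apply: le_trans (ler_wpM2l (ler0n _ K) sumw) _.
  rewrite (_ : K%:R * (16 * q ^+ 2) = K%:R * q * (16 * q)); last by ring.
  have q16 : 0 <= 16 * q by apply: mulr_ge0 => //; exact: ltW.
  have := ler_wpM2r q16 Kq; lra.
(* The expected denominator of [kappa]. In units of l^3 the four terms of e1 are at most 96, 32, 384
   and 96, with sum 608. *)
pose Y := q + l ^+ 2 * z.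
have kY : kappa L a * Y <= 608 * l ^+ 2.
  rewrite -(ler_pM2r l0) (_ : _ * Y * l = kappa L a * l * Y); last by ring.
  have Y0 : 0 <= Y by rewrite addr_ge0 ?mulr_ge0 ?sqr_ge0 // ltW.
  apply: le_trans (ler_wpM2r Y0 kap) _.
  have e1 : 2 * (SV + 48 * l * q) * Y = 2 * (SV * q) + 2 * l ^+ 2 * (SV * z) + 96 * l * q ^+ 2 + 96 * l ^+ 2 * q * (z * l).
    by rewrite /Y; ring.
  have b1 : 2 * l ^+ 2 * (SV * z) <= 2 * l ^+ 2 * (16 * l) by rewrite ler_wpM2l ?mulr_ge0 ?sqr_ge0.
  have b2 : q ^+ 2 <= (2 * l) ^+ 2 by apply: lerXn2r ql; rewrite nnegrE; lra.
  have b3 : 96 * l * q ^+ 2 <= 96 * l * (2 * l) ^+ 2 by apply: ler_wpM2l => //; lra.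
  have b4 : 96 * l ^+ 2 * q * (z * l) <= 96 * l ^+ 2 * (2 * l) * (1 / 2).
    have l2 : 0 <= 96 * l ^+ 2 by apply: mulr_ge0 => //; apply: sqr_ge0.
    apply: ler_pM => //; first by apply: mulr_ge0 => //; exact: ltW.
      by apply: mulr_ge0 => //; exact: ltW.
    exact: ler_wpM2l.
  have e2 : 96 * l ^+ 2 * (2 * l) * (1 / 2) = 96 * l ^+ 3 by field.
  have e3 : 96 * l * (2 * l) ^+ 2 = 384 * l ^+ 3 by ring.
  have e4 : 2 * l ^+ 2 * (16 * l) = 32 * l ^+ 3 by ring.
  have e5 : 608 * l ^+ 2 * l = 608 * l ^+ 3 by ring.
  rewrite e1 e5; lra.
(* The level is the largest i with 4^i <= Y; as Y <= 3 L < 4^L it lies below L. *)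
have YL : Y < 4 ^+ L.
  apply: (@le_lt_trans _ _ (3 * l)).
    rewrite /Y (_ : l ^+ 2 * z = l * (z * l)); last by ring.
    have := ler_wpM2l (ltW l0) zl; lra.
  by rewrite /l -natrM -natrX ltr_nat three_mul_lt_exp4.
have exY : exists n, Y < 4 ^+ n by exists L.
have [n Yn nmin] := ex_minnP exY.
have Y1 : 1 <= Y by rewrite /Y; have := mulr_ge0 (sqr_ge0 l) z0; lra.
case: n Yn nmin => [|i] Yi imin; first by rewrite expr0 in Yi; lra.
exists i, r, A; split.
- exact: imin.
- rewrite r0 /= -(ler_nat R) natrX; apply/ltW; apply: le_lt_trans Yi.
  by rewrite /Y lerDl mulr_ge0 // sqr_ge0.
- rewrite -/t -/z -/l mulrC; apply/ltW; apply: le_lt_trans Yi.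
  by rewrite /Y lerDr ltW.
- have Yi' : 4 ^+ i <= Y by rewrite leNgt; apply/negP => /imin; rewrite ltnn.
  have p0 : 0 < 4 ^+ i :> R by rewrite exprn_gt0.
  rewrite ler_pdivlMr //; apply: le_trans kY.
  by apply: ler_wpM2l => //; apply: kappa_ge0.
Qed.

End Arcs.

(** * Boxes in Z^5 and the circle method *)

Definition box (L : nat) : finType := ('I_L * 'I_L * ('I_L * 'I_L) * 'I_L)%type.

Definition dsq1 (a b : nat) : int := (b%:Z - a%:Z) ^+ 2.

Definition dsq (L : nat) (x x' : box L) : int :=
  dsq1 x.1.1.1 x'.1.1.1 + dsq1 x.1.1.2 x'.1.1.2 +
  (dsq1 x.1.2.1 x'.1.2.1 + dsq1 x.1.2.2 x'.1.2.2) + dsq1 x.2 x'.2.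

Lemma card_box L : #|box L| = (L ^ 5)%N.
Proof. by rewrite !card_prod !card_ord; ring. Qed.

(** As 2 r is invertible modulo P, the residue t of 2 r c determines c. This is the reason for a
    prime modulus. *)
Lemma prime_residue_inj (P r c c' : nat) (A A' t : int) :
  prime P -> (0 < r)%N -> (2 * r < P)%N -> (c < P)%N -> (c' < P)%N ->
  (2 * r * c)%N%:Z = A * P%:Z + t -> (2 * r * c')%N%:Z = A' * P%:Z + t -> c = c'.
Proof.
move=> prP r0 rP cP c'P; wlog le : c c' A A' cP c'P / (c <= c')%N.
  move=> H; have [le|lt] := leqP c c'; first exact: (H c c' A A').
  by move=> h h'; apply/esym; apply: (H c' c A' A) => //; exact: ltnW.
move=> h h'; have d : (P %| 2 * r * (c' - c))%N.
  have e : (2 * r * (c' - c))%N%:Z = (A' - A) * P%:Z.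
    by rewrite mulnBr -subzn ?leq_mul2l ?le ?orbT // h h'; ring.
  by have : (P%:Z %| (2 * r * (c' - c))%N%:Z)%Z; [rewrite e dvdz_mull|rewrite dvdzE].
move: d; rewrite Gauss_dvdr; last by rewrite prime_coprime // gtnNdvd //; lia.
by rewrite /dvdn modn_small ?subn_eq0 => [?|]; lia.
Qed.

Section Circle.
Variables (R : realType) (W : R).
Hypotheses (W1 : 1 <= W) (weyl : weyl_bound W).

Lemma realCM (x y : R) : (x * y)%:C%C = x%:C%C * y%:C%C.
Proof. exact: rmorphM. Qed.

Lemma realCB (x y : R) : (x - y)%:C%C = x%:C%C - y%:C%C.
Proof. exact: rmorphB. Qed.

Lemma realCV (x : R) : (x^-1)%:C%C = (x%:C%C)^-1.
Proof. exact: fmorphV. Qed.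

Lemma realC_sum (I : Type) (r : seq I) (P : pred I) (F : I -> R) :
  (\sum_(i <- r | P i) F i)%:C%C = \sum_(i <- r | P i) (F i)%:C%C.
Proof. exact: rmorph_sum. Qed.

Lemma natrC (n : nat) : (n%:R : R)%:C%C = n%:R.
Proof. by rewrite rmorph_nat. Qed.

Lemma realC_neq0 (x : R) : x != 0 -> x%:C%C != 0 :> R[i].
Proof. by apply: contra => /eqP [->]. Qed.

(** The phase is a product over the coordinates. The bracketing of [box] presents the fifth tensor
    power as two squarings and one more factor. *)
Lemma op_bound_box (L : nat) (a : R) :
  op_bound (fun x x' : box L => ee (a * (dsq x x')%:~R)) (kappa L a ^+ 5).
Proof.
have k0 := kappa_ge0 L a; have h1 := @op_bound_phase R L a.
have h2 := op_bound_tensor k0 h1 h1.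
have h4 := op_bound_tensor (mulr_ge0 k0 k0) h2 h2.
have h5 := op_bound_tensor (mulr_ge0 (mulr_ge0 k0 k0) (mulr_ge0 k0 k0)) h4 h1.
move=> b; rewrite (_ : kappa L a ^+ 5 = kappa L a * kappa L a * (kappa L a * kappa L a) * kappa L a).
  apply: le_trans (h5 b); rewrite le_eqVlt; apply/orP; left; apply/eqP.
  apply: eq_bigr => x _; congr nrm2; apply: eq_bigr => x' _; congr (_ * _).
  rewrite -!eeD; congr ee; rewrite /dsq /dsq1 !rmorphD /= !rmorphXn /= !rmorphB /= -!pmulrn; ring.
by rewrite !exprS expr0; ring.
Qed.

(** A major arc of level i: the denominator and the error scaled by L^2 are both at most 4^(i+1).
    The approximated number is 2 c / P, since differencing doubles the frequency. *)
Definition arc (L P c i : nat) : Prop := exists r (A : int),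
  (0 < r <= 4 ^ i.+1)%N /\
  `|r%:R * (2 * (c%:R / P%:R)) - A%:~R| * L%:R ^+ 2 <= 4 ^+ i.+1 :> R.

(** The square root of the operator bound: (4^i)^(5/2) = 32^i, and W^(5/2) is rounded up to W^3. *)
Lemma exists_level (L P : nat) : (0 < L)%N -> exists lev : 'I_P -> nat, forall c,
  [/\ (lev c < L)%N, arc L P c (lev c) & forall F : box L -> R, unit_valued F ->
    nrm (\sum_x \sum_x' ee (c%:R / P%:R * (dsq x x')%:~R) * (F x * F x')%:C%C) <=
      W ^+ 3 * L%:R ^+ 10 / 32 ^+ lev c].
Proof.
move=> L0; suff H (c : 'I_P) : exists i, [/\ (i < L)%N, arc L P c i &
    forall F : box L -> R, unit_valued F ->
      nrm (\sum_x \sum_x' ee (c%:R / P%:R * (dsq x x')%:~R) * (F x * F x')%:C%C) <=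
        W ^+ 3 * L%:R ^+ 10 / 32 ^+ i] by have [f hf] := choice H; exists f.
have [i [r [A [iL hr hA kap]]]] := weyl (c%:R / P%:R) L0.
exists i; split => //; first by exists r, A.
move=> F F01.
have W0 : 0 <= W by apply: le_trans W1.
have k0 := kappa_ge0 L (c%:R / P%:R : R).
have h := op_bound_quad (exprn_ge0 5 k0) (@op_bound_box L (c%:R / P%:R)) F01.
have p0 : 0 < 4 ^+ i :> R by rewrite exprn_gt0.
have p1 : 0 < 32 ^+ i :> R by rewrite exprn_gt0.
have L0' : 0 < L%:R :> R by rewrite ltr0n.
have b0 : 0 <= W ^+ 3 * L%:R ^+ 10 / 32 ^+ i :> R.
  by rewrite divr_ge0 ?mulr_ge0 ?exprn_ge0.
rewrite -(@ler_pXn2r _ 2) ?nnegrE ?nrm_ge0 //; apply: le_trans h _.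
rewrite card_box natrX.
apply: (@le_trans _ _ ((W * L%:R ^+ 2 / 4 ^+ i) ^+ 5 * (L%:R ^+ 5) ^+ 2)).
  rewrite ler_wpM2r ?sqr_ge0 // lerXn2r ?nnegrE //.
  by rewrite divr_ge0 ?mulr_ge0 ?exprn_ge0.
have e32 : (32 ^+ i) ^+ 2 = (4 ^+ i) ^+ 5 :> R.
  by rewrite -!exprM mulnC [(i * 5)%N]mulnC !exprM; congr (_ ^+ _); ring.
have -> : (W ^+ 3 * L%:R ^+ 10 / 32 ^+ i) ^+ 2 =
   W ^+ 6 * L%:R ^+ 20 / (4 ^+ i) ^+ 5 :> R.
  by rewrite -e32; field; rewrite gt_eqF.
have -> : (W * L%:R ^+ 2 / 4 ^+ i) ^+ 5 * (L%:R ^+ 5) ^+ 2 =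
   W ^+ 5 * L%:R ^+ 20 / (4 ^+ i) ^+ 5 :> R.
  by field; rewrite gt_eqF.
rewrite ler_pM2r ?invr_gt0 ?exprn_gt0 // ler_pM2r ?exprn_gt0 //.
by rewrite ler_weXn2l.
Qed.

(** A residue c on the arc is determined by r and t = 2 r c - A P. There are 4^(i+1) choices for r
    and at most 3 times 4^(i+1) P / L^2 for t. *)
Lemma arc_card (L P i : nat) (B : {set 'I_P}) : (0 < L)%N -> prime P ->
    (2 * 4 ^ i.+1 < P)%N -> (L ^ 2 <= P)%N -> (forall c, c \in B -> arc L P c i) ->
  #|B|%:R <= 3 * 16 ^+ i.+1 * P%:R / L%:R ^+ 2 :> R.
Proof.
move=> L0 prP Pbig PL HB.
have P0 : 0 < P%:R :> R by rewrite ltr0n prime_gt0.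
have l0 : 0 < L%:R ^+ 2 :> R by rewrite exprn_gt0 // ltr0n.
pose Vr : R := 4 ^+ i.+1 * P%:R / L%:R ^+ 2.
have Vr0 : 0 <= Vr by rewrite divr_ge0 ?mulr_ge0 ?exprn_ge0 // ltW.
pose V := Num.truncn Vr.
have HB' (c : 'I_P) : exists rt : nat * int, c \in B ->
    [/\ (0 < rt.1 <= 4 ^ i.+1)%N, (`|rt.2| <= V)%N & exists A : int, (2 * rt.1 * c)%N%:Z = A * P%:Z + rt.2].
  have [cB|cB] := boolP (c \in B); last by exists (0%N, 0).
  have [r [A [hr hA]]] := HB c cB.
  exists (r, (2 * r * c)%N%:Z - A * P%:Z) => _; split => //=; last by exists A; rewrite addrC subrK.
  rewrite /V truncn_ge_nat // /Vr ler_pdivlMr // pmulrn abszE intr_norm intrB intrM -!pmulrn.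
  have E : (2 * r * c)%:R - A%:~R * P%:R = (r%:R * (2 * (c%:R / P%:R)) - A%:~R) * P%:R :> R.
    by rewrite !natrM; field; rewrite gt_eqF.
  by rewrite E normrM (gtr0_norm P0) mulrAC ler_pM2r.
have [f hf] := choice HB'.
have M0 : (0 < 4 ^ i.+1)%N by rewrite expn_gt0.
pose g (c : 'I_P) : 'I_(4 ^ i.+1).-1.+1 * 'I_(2 * V).+1 :=
  (inord (f c).1.-1, inord (absz ((f c).2 + V%:Z)%R)).
have ginj : {in B &, injective g}.
  move=> c c' cB c'B [/(congr1 val) /= e1 /(congr1 val) /= e2].
  have [h1 h2 [A hA]] := hf c cB; have [h1' h2' [A' hA']] := hf c' c'B.
  move: (f c) (f c') h1 h2 hA h1' h2' hA' e1 e2 => [r t] [r' t'] /= h1 h2 hA h1' h2' hA'.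
  rewrite !inordK //; try lia; move=> e1 e2.
  have er : r = r' by lia.
  have et : t = t' by lia.
  subst r' t'.
  apply: val_inj; apply: (prime_residue_inj prP _ _ (ltn_ord c) (ltn_ord c') hA hA') => //; lia.
have le1 : (#|B| <= 4 ^ i.+1 * (2 * V).+1)%N.
  rewrite -(card_in_imset ginj); apply: leq_trans (max_card _) _.
  by rewrite card_prod !card_ord prednK.
apply: (@le_trans _ _ ((4 ^ i.+1 * (2 * V).+1)%:R)); first by rewrite ler_nat.
have Vle : V%:R <= Vr by rewrite /V truncn_le.
rewrite natrM -[(2 * V).+1%:R]natr1 [(2 * V)%:R]natrM natrX.
have one : 1 <= P%:R / L%:R ^+ 2 :> R by rewrite ler_pdivlMr // mul1r -natrX ler_nat.
have p1 : 1 <= 4 ^+ i.+1 :> R by rewrite exprn_ege1 //; lra.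
have : 1 <= Vr by rewrite /Vr -mulrA; apply: le_trans p1 _; rewrite ler_peMr //; lra.
move=> Vr1; apply: (@le_trans _ _ (4 ^+ i.+1 * (3 * Vr))).
  by rewrite ler_wpM2l; lra.
rewrite /Vr (_ : 16 = 4 * 4); last by ring.
by rewrite exprMn; lra.
Qed.

Lemma geometric_half (i0 n : nat) : \sum_(i0 <= i < n) (2 ^- i : R) <= 2 / 2 ^+ i0.
Proof.
have [ni|ini] := leqP n i0; first by rewrite big_geq // divr_ge0 ?exprn_ge0.
suff : \sum_(i0 <= i < n) (2 ^- i : R) <= 2 / 2 ^+ i0 - 2 / 2 ^+ n.
  by move=> h; apply: le_trans h _; rewrite gerBl divr_ge0 ?exprn_ge0.
elim: n ini => // n IH; rewrite ltnS leq_eqVlt => /orP[/eqP <-|lt].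
  rewrite big_nat1 exprS; set x := 2 ^+ i0.
  have x0 : 0 < x by rewrite exprn_gt0.
  by rewrite [leRHS](_ : _ = x^-1) //; field; rewrite gt_eqF.
rewrite big_nat_recr //=; last exact: ltnW.
have := IH lt; rewrite exprS; set x := 2 ^+ n; have x0 : 0 < x by rewrite exprn_gt0.
rewrite (_ : 2 / (2 * x) = x^-1); last by field; rewrite gt_eqF.
by rewrite (_ : 2 / x = x^-1 + x^-1); [lra|field; rewrite gt_eqF].
Qed.

(** By [arc_card], 16^(i+1) frequencies, up to a constant times P / L^2, against 32^-i leave a
    geometric series of ratio 1/2. The constant is 96 = 3 * 16 * 2. *)
Lemma level_tail (L P i0 : nat) (lev : 'I_P -> nat) : (0 < L)%N -> prime P ->
    (2 * 4 ^ L < P)%N -> (L ^ 2 <= P)%N ->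
    (forall c, (lev c < L)%N) -> (forall c : 'I_P, arc L P c (lev c)) ->
  \sum_(c < P | (i0 <= lev c)%N) (32 ^- lev c : R) <= 96 / 2 ^+ i0 * (P%:R / L%:R ^+ 2).
Proof.
move=> L0 prP Pbig PL levL hlev.
pose B i := [set c : 'I_P | lev c == i].
have -> : \sum_(c < P | (i0 <= lev c)%N) (32 ^- lev c : R) = \sum_(i0 <= i < L) #|B i|%:R * 32 ^- i.
  transitivity (\sum_(c < P) \sum_(i0 <= i < L) (if lev c == i then 32 ^- i : R else 0)).
    rewrite big_mkcond; apply: eq_bigr => c _; case: leqP => h.
      rewrite (bigD1_seq (lev c)) ?iota_uniq ?mem_index_iota ?h ?levL //= eqxx.
      by rewrite big1 ?addr0 // => i; rewrite eq_sym => /negbTE ->.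
    by rewrite big_nat_cond big1 // => i /andP[/andP[h1 _] _]; case: eqP => // e; rewrite e ltnNge h1 in h.
  rewrite exchange_big /=; apply: eq_bigr => i _; rewrite -big_mkcond /= sumr_const mulr_natl.
  by congr (_ *+ _); apply: eq_card => c; rewrite inE.
have l0 : 0 < L%:R ^+ 2 :> R by rewrite exprn_gt0 // ltr0n.
have Y0 : 0 <= P%:R / L%:R ^+ 2 :> R by rewrite divr_ge0 // ltW.
apply: (@le_trans _ _ (\sum_(i0 <= i < L) 48 * (P%:R / L%:R ^+ 2) * 2 ^- i)).
  rewrite big_nat_cond [leRHS]big_nat_cond; apply: ler_sum => i; rewrite andbT => /andP[_ iL].
  have p32 : 0 < 32 ^+ i :> R by rewrite exprn_gt0.
  have p2 : 0 < 2 ^+ i :> R by rewrite exprn_gt0.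
  rewrite ler_pdivrMr //.
  have -> : 48 * (P%:R / L%:R ^+ 2) / 2 ^+ i * 32 ^+ i = 3 * 16 ^+ i.+1 * P%:R / L%:R ^+ 2 :> R.
    have e : 32 ^+ i = 2 ^+ i * 16 ^+ i :> R by rewrite -exprMn; congr (_ ^+ _); ring.
    rewrite e (exprS 16 i); move: (2 ^+ i) (16 ^+ i) p2 => x y x0.
    by field; rewrite !gt_eqF // ltr0n.
  apply: arc_card => //.
    apply: leq_ltn_trans Pbig; rewrite leq_mul2l leq_exp2l //.
  by move=> c; rewrite inE => /eqP <-; apply: hlev.
rewrite -mulr_sumr; apply: le_trans (ler_wpM2l _ (geometric_half i0 L)) _.
  by rewrite mulr_ge0.
by rewrite le_eqVlt; apply/orP; left; apply/eqP; ring.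
Qed.

(** For m of order L^2 about L^10 / m pairs of the box have squared distance m, so the mass is of
    order one. *)
Definition Tker (L m : nat) (x x' : box L) : R :=
  m%:R / L%:R ^+ 10 * (dsq x x' == m%:Z)%:R.

(** The mean of the sphere indicators of m + k q over |k| <= K, with the normalisation of [Tker]. *)
Definition Mker (L m q K : nat) (x x' : box L) : R :=
  m%:R / (L%:R ^+ 10 * (2 * K).+1%:R) *
    ((q%:Z %| dsq x x' - m%:Z)%Z && (`|dsq x x' - m%:Z| <= K * q)%N)%:R.

Lemma dsq1_ge0 a b : 0 <= dsq1 a b. Proof. exact: sqr_ge0. Qed.

Lemma dsq1_le (L : nat) (a b : 'I_L) : dsq1 a b <= (L ^ 2)%N%:Z.
Proof.
rewrite /dsq1; have := ltn_ord a; have := ltn_ord b.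
move: (nat_of_ord a) (nat_of_ord b) => u v vL uL.
by rewrite -mulnn PoszM expr2; nia.
Qed.

Lemma dsq_ge0 L (x x' : box L) : 0 <= dsq x x'.
Proof. by rewrite !addr_ge0 ?dsq1_ge0. Qed.

Lemma dsq_le L (x x' : box L) : dsq x x' <= (5 * L ^ 2)%N%:Z.
Proof.
rewrite /dsq; have h1 := dsq1_le x.1.1.1 x'.1.1.1; have h2 := dsq1_le x.1.1.2 x'.1.1.2.
have h3 := dsq1_le x.1.2.1 x'.1.2.1; have h4 := dsq1_le x.1.2.2 x'.1.2.2.
have h5 := dsq1_le x.2 x'.2; lia.
Qed.

Lemma dsq_sub_le L m (x x' : box L) : (m <= L ^ 2)%N -> (`|dsq x x' - m%:Z| <= 6 * L ^ 2)%N.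
Proof. by move=> mL; have := dsq_le x x'; have := dsq_ge0 x x'; lia. Qed.

Lemma absz_sub_ltn (a b : int) (u v P : nat) :
  (`|a| <= u)%N -> (`|b| <= v)%N -> (u + v < P)%N -> (`|a - b| < P)%N.
Proof. by lia. Qed.

Lemma absz_centered_mul_le (k K q : nat) :
  (k < (2 * K).+1)%N -> (`|((k%:Z - K%:Z) * q%:Z)%R| <= K * q)%N.
Proof. by move=> h; rewrite abszM absz_nat leq_mul2r; apply/orP; right; lia. Qed.

Lemma modulus_large (L b P : nat) : (2 * 4 ^ L + 7 * L ^ 2 + b < P)%N ->
  [/\ (2 * 4 ^ L < P)%N, (L ^ 2 <= P)%N & (6 * L ^ 2 + b < P)%N].
Proof. by move=> h; split; lia. Qed.

(* Fourier inversion modulo a prime P exceeding every integer that occurs. *)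
Lemma circle_expand (L m P : nat) (a : 'I_P -> R[i]) (D : box L -> box L -> R) (F : box L -> R)
    (lev : 'I_P -> nat) :
    (forall x x', (D x x')%:C%C = (m%:R / L%:R ^+ 10 / P%:R)%:C%C *
       \sum_c a c * ee (c%:R / P%:R * (dsq x x')%:~R)) -> unit_valued F -> (0 < L)%N ->
    (forall (c : 'I_P) (F : box L -> R), unit_valued F ->
      nrm (\sum_x \sum_x' ee (c%:R / P%:R * (dsq x x')%:~R) * (F x * F x')%:C%C) <=
      W ^+ 3 * L%:R ^+ 10 / 32 ^+ lev c) ->
  `|quad D F| <= m%:R / P%:R * W ^+ 3 * \sum_c nrm (a c) * 32 ^- lev c.
Proof.
move=> DE F01 L0 hlev.
have L0' : 0 < L%:R :> R by rewrite ltr0n.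
have W0 : 0 <= W by apply: le_trans W1.
rewrite -nrm_real.
have -> : (quad D F)%:C%C = (m%:R / L%:R ^+ 10 / P%:R)%:C%C *
   \sum_c a c * (\sum_x \sum_x' ee (c%:R / P%:R * (dsq x x')%:~R) * (F x * F x')%:C%C).
  transitivity (\sum_x \sum_x' \sum_c (m%:R / L%:R ^+ 10 / P%:R)%:C%C *
      (a c * (ee (c%:R / P%:R * (dsq x x')%:~R) * (F x * F x')%:C%C))).
    rewrite /quad realC_sum; apply: eq_bigr => x _; rewrite realC_sum; apply: eq_bigr => x' _.
    rewrite (realCM (D x x')) DE mulr_sumr mulr_suml.
    by apply: eq_bigr => c _; rewrite -!mulrA.
  under eq_bigr => x _ do rewrite exchange_big.
  rewrite exchange_big mulr_sumr; apply: eq_bigr => c _ /=.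
  rewrite !mulr_sumr; apply: eq_bigr => x _; rewrite !mulr_sumr; apply: eq_bigr => x' _.
  by [].
rewrite nrmM nrm_real ger0_norm; last by rewrite !divr_ge0 ?exprn_ge0.
apply: (@le_trans _ _ (m%:R / L%:R ^+ 10 / P%:R * \sum_c nrm (a c) * (W ^+ 3 * L%:R ^+ 10 / 32 ^+ lev c))).
  rewrite ler_wpM2l ?divr_ge0 ?exprn_ge0 //; apply: le_trans (ler_nrm_sum _ _ _) _.
  by apply: ler_sum => c _; rewrite nrmM ler_wpM2l ?nrm_ge0 ?hlev.
rewrite le_eqVlt; apply/orP; left; apply/eqP.
rewrite [in RHS]mulr_sumr [in LHS]mulr_sumr; apply: eq_bigr => c _.
have [->|P0] := eqVneq (P%:R : R) 0; first by rewrite invr0 !(mulr0, mul0r).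
by field; rewrite P0 !gt_eqF // exprn_gt0.
Qed.

Lemma exists_prime_gt (n : nat) : exists2 P, prime P & (n < P)%N.
Proof. by have [P lt pr] := prime_above n; exists P. Qed.

Lemma sum_ee_delta (P : nat) (n : int) : (0 < P)%N -> (`|n| < P)%N ->
  \sum_(c < P) ee (c%:R * n%:~R / P%:R) = (P%:R * (n == 0)%:R : R[i]).
Proof.
move=> P0 nP; rewrite sum_ee_orthogonal //; case: ifP => [d|nd].
  suff -> : n = 0 by rewrite eqxx mulr1.
  by apply/eqP; rewrite -absz_eq0 -(modn_small nP); move: d; rewrite dvdzE.
by case: eqP nd => [->|_ _]; rewrite ?dvdz0 ?mulr0.
Qed.

Lemma sum_multiples (q K : nat) (n : int) : (0 < q)%N ->
  \sum_(k < (2 * K).+1) ((n == (k%:Z - K%:Z) * q%:Z)%:R : R[i]) =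
  ((q%:Z %| n)%Z && (`|n| <= K * q)%N)%:R.
Proof.
move=> q0; case: (boolP (_ && _)) => [/andP[/dvdzP[k0 nE] nK]|hn] /=.
  have k0K : (`|k0| <= K)%N by move: nK; rewrite nE abszM absz_nat leq_pmul2r.
  have kJ : (absz (k0 + K%:Z)%R < (2 * K).+1)%N by lia.
  have kE : (absz (k0 + K%:Z)%R)%:Z - K%:Z = k0 by lia.
  rewrite (bigD1 (Ordinal kJ)) //= big1 ?addr0; first by rewrite kE nE eqxx.
  move=> k /eqP kne; case: eqP => // e; case: kne; apply: val_inj => /=.
  have q0' : q%:Z != 0 by lia.
  have : k0 * q%:Z = (k%:Z - K%:Z) * q%:Z by rewrite -nE e.
  by move/(mulIf q0'); lia.
rewrite big1 // => k _; case: eqP => // e; case/negP: hn.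
by rewrite e absz_centered_mul_le ?ltn_ord // andbT dvdz_mull.
Qed.

(** Fourier coefficients of modulus 1 and the sum over all levels; m <= L^2 absorbs the factor P /
    L^2. *)
Lemma circle_mass (L m : nat) (F : box L -> R) : (0 < L)%N -> (m <= L ^ 2)%N -> unit_valued F ->
  `|quad (@Tker L m) F| <= 96 * W ^+ 3.
Proof.
move=> L0 mL F01; have W0 : 0 <= W by apply: le_trans W1.
have [P prP Pbig] := exists_prime_gt (2 * 4 ^ L + 7 * L ^ 2 + 0).
have [Pb1 Pb2 Pb3] := modulus_large Pbig; rewrite addn0 in Pb3.
have [lev hlev] := @exists_level L P L0.
have P0 : (0 < P)%N by apply: prime_gt0.
have Pr : 0 < P%:R :> R by rewrite ltr0n.
have PC : (P%:R : R[i]) != 0 by rewrite -natrC realC_neq0 // gt_eqF.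
have l0 : 0 < L%:R ^+ 2 :> R by rewrite exprn_gt0 // ltr0n.
have h := @circle_expand L m P (fun c => ee (- (c%:R * m%:R / P%:R))) (@Tker L m) F lev.
apply: le_trans (h _ F01 L0 _) _.
- move=> x x'; have := @sum_ee_delta P (dsq x x' - m%:Z) P0 (leq_ltn_trans (dsq_sub_le x x' mL) Pb3).
  rewrite subr_eq0 => e; rewrite /Tker.
  have -> : \sum_(c < P) ee (- (c%:R * m%:R / P%:R)) * ee (c%:R / P%:R * (dsq x x')%:~R) =
     P%:R * (dsq x x' == m%:Z)%:R :> R[i].
    rewrite -e; apply: eq_bigr => c _; rewrite -eeD; congr ee; rewrite intrB -pmulrn; ring.
  by rewrite !realCM !realCV !natrC -[RHS]mulrA mulKf.
- by move=> c F' F'01; have [_ _] := hlev c; apply.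
have tail := @level_tail L P 0 lev L0 prP Pb1 Pb2 (fun c => let: And3 a _ _ := hlev c in a)
  (fun c => let: And3 _ a _ := hlev c in a).
under eq_bigr => c _ do rewrite nrm_ee mul1r.
rewrite (_ : \sum_(i < P) (32 ^- lev i : R) = \sum_(c < P | (0 <= lev c)%N) (32 ^- lev c : R)) //.
apply: le_trans (ler_wpM2l _ tail) _; first by rewrite mulr_ge0 ?divr_ge0 ?exprn_ge0.
have -> : m%:R / P%:R * W ^+ 3 * (96 / 2 ^+ 0 * (P%:R / L%:R ^+ 2)) =
    96 * W ^+ 3 * (m%:R / L%:R ^+ 2) :> R.
  by rewrite expr0; field; rewrite !gt_eqF // ltr0n.
rewrite ler_piMr ?mulr_ge0 ?exprn_ge0 // ler_pdivrMr // mul1r -natrX ler_nat //.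
Qed.

(** Averaging over the shifts k q hardly changes the Fourier coefficients on arcs of low level,
    where k q c / P is close to an integer; the arcs of high level carry little in total. *)
Lemma circle_approx (eps : R) : 0 < eps -> exists eta q0, [/\ 0 < eta, (0 < q0)%N &
  forall q L m K (F : box L -> R), (q0 %| q)%N -> (0 < q)%N -> (0 < L)%N -> (m <= L ^ 2)%N ->
    (K * q)%:R <= eta * m%:R :> R -> unit_valued F ->
    `|quad (fun x x' => Tker m x x' - Mker m q K x x') F| <= eps].
Proof.
move=> eps0; have Wpos : 0 < W by apply: lt_le_trans W1.
have W0 := ltW Wpos.
pose C : R := 96 * W ^+ 3.
have C0 : 0 < C by rewrite mulr_gt0 // exprn_gt0.
(* Cut-off level: with coefficients at most 2, the levels from i0 on contribute at most 2 C / 2^i0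
   <= eps / 2. *)
have [i0 hi0] : exists i0 : nat, 4 * C / eps <= 2 ^+ i0.
  exists (Num.truncn (4 * C / eps)).+1.
  apply: le_trans (ltW (truncnS_gt _)) _.
  by rewrite -natrX ler_nat ltnW // ltn_expl.
have p20 : 0 < 2 ^+ i0 :> R by rewrite exprn_gt0.
have p40 : 0 < 4 ^+ i0 :> R by rewrite exprn_gt0.
(* Below level i0 all denominators r are at most 4^i0, so 2 r divides q; eta makes the remaining
   phases small enough for a total of eps / 2. *)
exists (eps / (16 * C * 4 ^+ i0)), (2 * (4 ^ i0)`!)%N; split.
- by rewrite divr_gt0 // !mulr_gt0.
- by rewrite muln_gt0 fact_gt0.
move=> q L m K F q0q qpos L0 mL Keta F01.
have [P prP Pbig] := exists_prime_gt (2 * 4 ^ L + 7 * L ^ 2 + K * q).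
have [Pb1 Pb2 Pb3] := modulus_large Pbig.
have [lev hlev] := @exists_level L P L0.
have P0 : (0 < P)%N by apply: prime_gt0.
have Pr : 0 < P%:R :> R by rewrite ltr0n.
have PC : (P%:R : R[i]) != 0 by rewrite -natrC realC_neq0 // gt_eqF.
have l0 : 0 < L%:R ^+ 2 :> R by rewrite exprn_gt0 // ltr0n.
pose J := (2 * K).+1.
have J0 : 0 < J%:R :> R by rewrite ltr0n.
have JC : (J%:R : R[i]) != 0 by rewrite -natrC realC_neq0 // gt_eqF.
pose sh (k : 'I_J) : int := (k%:Z - K%:Z) * q%:Z.
(* The Fourier multiplier that turns T into T - M: one minus the mean of the shifts by the multiples
   of q. *)
pose gh (c : 'I_P) : R[i] := J%:R^-1 * \sum_(k < J) (1 - ee (- (c%:R * (sh k)%:~R / P%:R))).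
pose a (c : 'I_P) := ee (- (c%:R * m%:R / P%:R)) * gh c.
have Jinv : (J%:R^-1 : R[i]) = (J%:R^-1 : R)%:C%C by rewrite realCV natrC.
have gh_le (c : 'I_P) (M : R) : (forall k, nrm (1 - ee (- (c%:R * (sh k)%:~R / P%:R))) <= M) -> nrm (gh c) <= M.
  move=> hM; rewrite /gh nrmM Jinv nrm_real ger0_norm ?invr_ge0 // mulrC ler_pdivrMr //.
  apply: le_trans (ler_nrm_sum _ _ _) _; apply: le_trans (ler_sum _ (fun k _ => hM k)) _.
  by rewrite sumr_const card_ord mulr_natr.
have h := @circle_expand L m P a (fun x x' => Tker m x x' - Mker m q K x x') F lev.
apply: le_trans (h _ F01 L0 _) _.
- move=> x x'.
  have Kk (k : 'I_J) : (`|sh k| <= K * q)%N by apply: absz_centered_mul_le.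
  have nle := dsq_sub_le x x' mL.
  have eT := @sum_ee_delta P (dsq x x' - m%:Z) P0 (leq_ltn_trans nle (leq_ltn_trans (leq_addr _ _) Pb3)).
  have eM k := @sum_ee_delta P (dsq x x' - m%:Z - sh k) P0 (absz_sub_ltn nle (Kk k) Pb3).
  have -> : \sum_(c < P) a c * ee (c%:R / P%:R * (dsq x x')%:~R) =
      P%:R * (dsq x x' == m%:Z)%:R -
      J%:R^-1 * \sum_(k < J) P%:R * (dsq x x' - m%:Z == sh k)%:R.
    transitivity (J%:R^-1 * \sum_(k < J) (P%:R * (dsq x x' == m%:Z)%:R -
        P%:R * (dsq x x' - m%:Z == sh k)%:R : R[i])); last first.
      rewrite sumrB mulrBr; congr (_ - _).
      by rewrite sumr_const card_ord -(mulr_natl (P%:R * (dsq x x' == m%:Z)%:R : R[i])) mulKf.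
    transitivity (J%:R^-1 * \sum_(k < J) \sum_(c < P) (ee (c%:R * (dsq x x' - m%:Z)%:~R / P%:R) -
       ee (c%:R * (dsq x x' - m%:Z - sh k)%:~R / P%:R) : R[i])).
      rewrite exchange_big mulr_sumr; apply: eq_bigr => c _ /=.
      rewrite /a /gh mulrAC [_ * (J%:R^-1 * _)]mulrCA; congr (_ * _).
      rewrite mulr_sumr; apply: eq_bigr => k _; rewrite mulrBr mulr1 -!eeD.
      by congr (ee _ - ee _); rewrite !intrB -pmulrn; ring.
    congr (_ * _); apply: eq_bigr => k _; rewrite sumrB eT eM.
    by rewrite !subr_eq0.
  have cnt : \sum_(k < J) ((dsq x x' - m%:Z == sh k)%:R : R[i]) =
      ((q%:Z %| dsq x x' - m%:Z)%Z && (`|dsq x x' - m%:Z| <= K * q)%N)%:R.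
    exact: sum_multiples.
  rewrite -mulr_sumr cnt realCB /Tker /Mker.
  rewrite !realCM !realCV !realCM !natrC -/J.
  have LC : (L%:R : R[i]) != 0 by rewrite -natrC realC_neq0 // pnatr_eq0 -lt0n.
  move: (P%:R : R[i]) (J%:R : R[i]) (L%:R : R[i]) PC JC LC => p j u p0 j0 u0.
  by field; rewrite u0 p0 j0.
- by move=> c F' F'01; have [_ _] := hlev c; apply.
have arcs (c : 'I_P) : arc L P c (lev c) by have [] := hlev c.
have levL (c : 'I_P) : (lev c < L)%N by have [] := hlev c.
have tail i := @level_tail L P i lev L0 prP Pb1 Pb2 levL arcs.
have na (c : 'I_P) : nrm (a c) <= 2.
  rewrite /a nrmM nrm_ee mul1r; apply: gh_le => k.
  by apply: le_trans (ler_nrmD _ _) _; rewrite nrmN nrm1 nrm_ee.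
(* With q = 2 r s the phase of the shift k q is k s times r (2 c / P), hence within K q tau of the
   integer k s A, where tau <= 4^i0 / L^2. *)
have na2 (c : 'I_P) : (lev c < i0)%N -> nrm (a c) <= eps / (2 * C).
  move=> lc; rewrite /a nrmM nrm_ee mul1r; apply: gh_le => k.
  have [r [A [/andP[r0 r4] hA]]] := arcs c.
  have r4' : (r <= 4 ^ i0)%N by apply: leq_trans r4 _; rewrite leq_exp2l.
  have /dvdnP[s qE] : (2 * r %| q)%N.
    by apply: dvdn_trans q0q; rewrite dvdn_pmul2l // dvdn_fact // r0.
  have le := nrm_1Bee_le (- (c%:R * (sh k)%:~R / P%:R) : R) (- ((k%:Z - K%:Z) * s%:Z * A)).
  apply: le_trans le _.
  have -> : - (c%:R * (sh k)%:~R / P%:R) - (- ((k%:Z - K%:Z) * s%:Z * A))%:~R =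
     - ((k%:Z - K%:Z) * s%:Z)%:~R * (r%:R * (2 * (c%:R / P%:R)) - A%:~R) :> R.
    rewrite /sh qE !PoszM mulrNz !intrM !intrB -!pmulrn; field; rewrite gt_eqF //.
  rewrite normrM normrN.
  set tau := `|_ - _|%R in hA *.
  have tau0 : 0 <= tau by exact: normr_ge0.
  have hk : `|((k%:Z - K%:Z) * s%:Z)%:~R| <= (K * q)%:R :> R.
    rewrite -intr_norm -abszE -pmulrn ler_nat.
    apply: leq_trans (absz_centered_mul_le s (ltn_ord k)) _.
    by rewrite leq_mul2l qE leq_pmulr ?orbT // muln_gt0.
  have htau : tau * L%:R ^+ 2 <= 4 ^+ i0.
    by apply: le_trans hA _; rewrite ler_weXn2l //; lra.
  have mL' : m%:R <= L%:R ^+ 2 :> R by rewrite -natrX ler_nat.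
  have e1 : `|((k%:Z - K%:Z) * s%:Z)%:~R| * tau <= eps / (16 * C * 4 ^+ i0) * L%:R ^+ 2 * tau.
    rewrite ler_wpM2r //; apply: le_trans hk _; apply: le_trans Keta _.
    by rewrite ler_wpM2l // divr_ge0 ?mulr_ge0 // ltW.
  have e2 : eps / (16 * C * 4 ^+ i0) * L%:R ^+ 2 * tau <= eps / (16 * C * 4 ^+ i0) * 4 ^+ i0.
    rewrite -mulrA [L%:R ^+ 2 * _]mulrC ler_wpM2l // divr_ge0 ?mulr_ge0 // ltW //.
  rewrite (_ : eps / (16 * C * 4 ^+ i0) * 4 ^+ i0 = eps / (16 * C)) in e2; last first.
    by field; rewrite !gt_eqF.
  have -> : eps / (2 * C) = 8 * (eps / (16 * C)) by field; rewrite gt_eqF.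
  by rewrite ler_wpM2l //; apply: le_trans e1 e2.
have sum_le : \sum_c nrm (a c) * 32 ^- lev c <=
   eps / (2 * C) * (96 / 2 ^+ 0 * (P%:R / L%:R ^+ 2)) + 2 * (96 / 2 ^+ i0 * (P%:R / L%:R ^+ 2)).
  have w0 c : 0 <= 32 ^- lev c :> R by rewrite invr_ge0 exprn_ge0.
  apply: (@le_trans _ _ (eps / (2 * C) * (\sum_(c < P | (0 <= lev c)%N) (32 ^- lev c : R)) +
     2 * (\sum_(c < P | (i0 <= lev c)%N) (32 ^- lev c : R)))); last first.
    apply: lerD; last by apply: ler_wpM2l (tail i0).
    by apply: ler_wpM2l (tail 0%N); rewrite divr_ge0 ?mulr_ge0 // ltW.
  rewrite !mulr_sumr [X in _ + X]big_mkcond -big_split /=; apply: ler_sum => c _.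
  have ec0 : 0 <= eps / (2 * C) by rewrite divr_ge0 ?mulr_ge0 // ltW.
  case: leqP => h2.
    by apply: ler_wpDl; [rewrite mulr_ge0|rewrite ler_wpM2r].
  by rewrite addr0 ler_wpM2r // na2.
have m0 : 0 <= m%:R / P%:R * W ^+ 3 :> R by rewrite mulr_ge0 ?divr_ge0 ?exprn_ge0.
apply: le_trans (ler_wpM2l m0 sum_le) _.
have -> : m%:R / P%:R * W ^+ 3 * (eps / (2 * C) * (96 / 2 ^+ 0 * (P%:R / L%:R ^+ 2)) +
   2 * (96 / 2 ^+ i0 * (P%:R / L%:R ^+ 2))) = (m%:R / L%:R ^+ 2) * (eps / 2 + 2 * C / 2 ^+ i0).
  by rewrite /C expr0; field; rewrite !gt_eqF // ltr0n.
have mL1 : m%:R / L%:R ^+ 2 <= 1 :> R by rewrite ler_pdivrMr // mul1r -natrX ler_nat.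
have e3 : 2 * C / 2 ^+ i0 <= eps / 2.
  rewrite ler_pdivrMr //; move: hi0; rewrite ler_pdivrMr //; lra.
have pos : 0 <= eps / 2 + 2 * C / 2 ^+ i0.
  by rewrite addr_ge0 ?divr_ge0 ?mulr_ge0 // ltW.
apply: le_trans (ler_wpM2r pos mL1) _; lra.
Qed.

End Circle.

(** * Gauss sums and zeros of a sum of five squares modulo 4 n *)

Lemma sum_shift_periodic (V : zmodType) (f : nat -> V) (n t : nat) :
  (forall u, f (u + n)%N = f u) -> \sum_(u < n) f (t + u)%N = \sum_(u < n) f u.
Proof.
move=> per; elim: t => [|t IH]; first by [].
rewrite -[RHS]IH.
have e : \sum_(u < n.+1) f (t + u)%N = \sum_(u < n) f (t + u)%N + f (t + n)%N by rewrite big_ord_recr.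
have := e; rewrite big_ord_recl /= per addn0 addrC => /addIr <-.
by apply: eq_bigr => u _; rewrite /bump /= add1n addnS addSn.
Qed.

Section GaussSums.
Variable R : realType.

(** The linear coefficient b is 1 for odd squares, as (2u+1)^2 = 4 (u^2 + u) + 1, and 0 for even
    ones. *)
Definition gauss (n b c : nat) : R[i] :=
  \sum_(u < n) ee ((c * (u * u + b * u))%:R / n%:R).

Lemma eq_ee_div (n a b : nat) (k : int) : (0 < n)%N ->
  a%:Z = b%:Z + k * n%:Z -> ee (a%:R / n%:R) = ee (b%:R / n%:R) :> R[i].
Proof.
move=> n0 h; rewrite -(eeDint (b%:R / n%:R) k); congr ee.
have -> : a%:R = b%:R + k%:~R * n%:R :> R.
  by rewrite (pmulrn _ a) -[1 *~ a]/(a%:Z%:~R) h intrD intrM.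
by field; rewrite pnatr_eq0 -lt0n.
Qed.

Lemma gauss_periodic n b c u : (0 < n)%N ->
  ee ((c * ((u + n) * (u + n) + b * (u + n)))%:R / n%:R) =
  ee ((c * (u * u + b * u))%:R / n%:R) :> R[i].
Proof.
move=> n0; apply: (@eq_ee_div _ _ _ (c * (2 * u + n + b))%N%:Z) => //.
by rewrite -PoszM -PoszD; congr Posz; ring.
Qed.

Lemma gauss_eq0 (n b c t : nat) : (0 < n)%N ->
  (forall u, ee ((c * ((t + u) * (t + u) + b * (t + u)))%:R / n%:R) =
     - ee ((c * (u * u + b * u))%:R / n%:R) :> R[i]) -> gauss n b c = 0.
Proof.
move=> n0 h; have e : gauss n b c = - gauss n b c.
  rewrite {1}/gauss -(sum_shift_periodic (f := fun u => ee ((c * (u * u + b * u))%:R / n%:R)) t).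
    by rewrite /gauss -sumrN; apply: eq_bigr => u _; rewrite h.
  by move=> u; apply: gauss_periodic.
have : gauss n b c *+ 2 = 0 by rewrite mulr2n {1}e addNr.
by move/eqP; rewrite mulrn_eq0 /= => /eqP.
Qed.

Lemma ee_half_shift (n a b k : nat) : (0 < n)%N -> (2 * a = 2 * b + n * (2 * k + 1))%N ->
  ee (a%:R / n%:R) = - ee (b%:R / n%:R) :> R[i].
Proof.
move=> n0 h; have n0' : n%:R != 0 :> R by rewrite pnatr_eq0 -lt0n.
have -> : a%:R / n%:R = (b%:R / n%:R + 1 / 2) + (k%:Z)%:~R :> R.
  have : (2 * a)%:R = (2 * b + n * (2 * k + 1))%:R :> R by rewrite h.
  rewrite !(natrD, natrM) -pmulrn => e; apply: (@mulIf _ (2 * n%:R)).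
    by rewrite mulf_neq0.
  rewrite (_ : a%:R / n%:R * (2 * n%:R) = 2 * a%:R); last by field.
  by rewrite e; field.
by rewrite eeDint eeD ee_half mulrN1.
Qed.

(* With n = g r and c = g a in lowest terms, the sums with 4 | r (resp. r = 2 mod 4)
   cancel under the shift u -> u + r / 2. *)
Lemma gauss_even (n g a r : nat) : (0 < n)%N -> n = (g * r)%N -> odd a -> ~~ odd r ->
  gauss n 1 (g * a) * gauss n 0 (g * a) = 0.
Proof.
move=> n0 nE oa er.
have [t rE] : exists t, r = (2 * t)%N by exists r./2; move: (odd_double_half r); rewrite (negbTE er); lia.
have [a' aE] : exists a', a = (2 * a' + 1)%N by exists a./2; move: (odd_double_half a); rewrite oa; lia.
have [ot|et] := boolP (odd t).
  have [t' tE] : exists t', t = (2 * t' + 1)%N by exists t./2; move: (odd_double_half t); rewrite ot; lia.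
  rewrite [X in _ * X](@gauss_eq0 n 0 (g * a) t n0) ?mulr0 // => u.
  apply: (@ee_half_shift _ _ _ (a * u + a * t' + a')) => //.
  by rewrite nE rE tE aE; ring.
have [t' tE] : exists t', t = (2 * t')%N by exists t./2; move: (odd_double_half t); rewrite (negbTE et); lia.
rewrite [X in X * _](@gauss_eq0 n 1 (g * a) t n0) ?mul0r // => u.
apply: (@ee_half_shift _ _ _ (a * u + a * t' + a')) => //.
by rewrite nE rE tE aE; ring.
Qed.

(** After squaring, the sum over u vanishes unless n divides 2 c h. For odd r this means that r
    divides h, which leaves g values of h. *)
Lemma gauss_odd (n g a r b : nat) : (0 < n)%N -> n = (g * r)%N -> coprime r a -> odd r ->
  nrm2 (gauss n b (g * a)) <= n%:R * g%:R.
Proof.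
move=> n0 nE cop orr; have n0' : n%:R != 0 :> R by rewrite pnatr_eq0 -lt0n.
have r0 : (0 < r)%N by rewrite odd_gt0.
set c := (g * a)%N.
pose f u : R[i] := ee ((c * (u * u + b * u))%:R / n%:R).
have E : (nrm2 (gauss n b c))%:C%C =
    \sum_(h < n) ee ((c * (h * h + b * h))%:R / n%:R) *
      \sum_(u < n) ee (u%:R * ((2 * c * h)%N%:Z)%:~R / n%:R).
  rewrite -mulJ_nrm2 {2}/gauss conjc_sum mulr_sumr.
  transitivity (\sum_(u < n) \sum_(h < n) f (u + h)%N * ee (- ((c * (u * u + b * u))%:R / n%:R))).
    apply: eq_bigr => u _; rewrite ee_conj -mulr_suml; congr (_ * _).
    by rewrite (sum_shift_periodic (f := f)) // => v; apply: gauss_periodic.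
  rewrite exchange_big; apply: eq_bigr => h _ /=; rewrite mulr_sumr; apply: eq_bigr => u _.
  by rewrite /f -!eeD; congr ee; rewrite -pmulrn !(natrM, natrD); field.
have : complex.Re (nrm2 (gauss n b c))%:C%C <= n%:R * g%:R; last by [].
rewrite E; apply: le_trans (Re_le_nrm _) _; apply: le_trans (ler_nrm_sum _ _ _) _.
apply: (@le_trans _ _ (\sum_(h < n) n%:R * (r %| h)%:R)).
  apply: ler_sum => h _; rewrite nrmM nrm_ee mul1r sum_ee_orthogonal // dvdzE /=.
  case: ifP => d; last by rewrite nrm0 mulr_ge0.
  have -> : (r %| h)%N.
    have : (g * r %| g * (2 * a * h))%N by rewrite -nE; move: d; rewrite /c; congr (_ %| _)%N; ring.
    have g0 : (0 < g)%N by move: n0; rewrite nE; case: (g).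
    rewrite dvdn_pmul2l // Gauss_dvdr // coprimeMr cop andbT.
    by rewrite coprime_sym prime_coprime // dvdn2 orr.
  by rewrite mulr1 -natrC nrm_real ger0_norm.
rewrite -mulr_sumr ler_wpM2l // -(big_mkord xpredT (fun h => (r %| h)%:R)) nE mulnC sum_nat_blocks.
rewrite (eq_bigr (fun=> 1)); first by rewrite big_const_nat iter_addr addr0 subn0.
move=> k _; rewrite big_ltn // addn0 dvdn_mulr // big_nat_cond big1 ?addr0 // => j.
rewrite andbT => /andP[j1 jr]; rewrite dvdn_addr ?dvdn_mulr //.
by rewrite gtnNdvd.
Qed.

(** Telescoping of 1 / sqrt(2 k), from the first value 1 / sqrt 2 <= 3 / 4. *)
Lemma sum_odd_le (n : nat) :
  \sum_(1 <= s < n) (((2 * s + 1)%:R * Num.sqrt (2 * s + 1)%:R)^-1 : R) <= 3 / 4.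
Proof.
pose z (k : nat) : R := Num.sqrt (2 * k)%:R.
have zpos k : (0 < k)%N -> 0 < z k by move=> k0; rewrite sqrtr_gt0 ltr0n muln_gt0.
have zsq k : z k ^+ 2 = (2 * k)%:R by rewrite sqr_sqrtr.
suff H k : \sum_(1 <= s < k.+1) (((2 * s + 1)%:R * Num.sqrt (2 * s + 1)%:R)^-1 : R) <= (z 1)^-1 - (z k.+1)^-1.
  case: n => [|n]; first by rewrite big_geq // divr_ge0.
  apply: le_trans (H n) _.
  have h1 : (z 1%N)^-1 <= 3 / 4.
    have z1 := zpos 1%N isT; rewrite -[_^-1]mul1r ler_pdivrMr //.
    rewrite -(@ler_pXn2r _ 2) ?nnegrE ?mulr_ge0 ?ltW // exprMn zsq muln1; lra.
  by have := zpos n.+1 isT; rewrite -invr_gt0; lra.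
elim: k => [|k IH]; first by rewrite big_geq // subrr.
rewrite big_nat_recr //=; apply: le_trans (lerD IH (lexx _)) _.
set x := z k.+1; set y := z k.+2; set r := (2 * k.+1 + 1)%:R.
have x0 : 0 < x by apply: zpos.
have y0 : 0 < y by apply: zpos.
have r0 : 0 < r by rewrite ltr0n addn1.
set w := Num.sqrt r; have w0 : 0 < w by rewrite sqrtr_gt0.
have ww : w ^+ 2 = r by rewrite sqr_sqrtr // ltW.
have xx : x ^+ 2 = r - 1 by rewrite zsq /r natrD addrK.
have yy : y ^+ 2 = r + 1 by rewrite zsq /r natr1; congr _%:R; lia.
have xyr : x * y <= r.
  rewrite -(@ler_pXn2r _ 2) ?nnegrE ?mulr_ge0 ?ltW // exprMn xx yy.
  by rewrite (_ : (r - 1) * (r + 1) = r ^+ 2 - 1); [lra|ring].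
have xyw : x + y <= 2 * w.
  have xy0 : 0 <= x + y by rewrite ltW // addr_gt0.
  have ww0 : 0 <= 2 * w by rewrite ltW // mulr_gt0.
  rewrite -(@ler_pXn2r _ 2) ?nnegrE // exprMn ww.
  have -> : (x + y) ^+ 2 = x ^+ 2 + y ^+ 2 + 2 * (x * y) by ring.
  rewrite xx yy (_ : 2 ^+ 2 * r = r + r + 2 * r); last by ring.
  by lra.
suff : (r * w)^-1 <= x^-1 - y^-1 by lra.
have e1 : x^-1 - y^-1 = 2 / ((x + y) * (x * y)).
  have -> : 2 = y ^+ 2 - x ^+ 2 by rewrite xx yy; ring.
  by field; rewrite !gt_eqF // addr_gt0.
rewrite e1 -[(r * w)^-1]mul1r ler_pdivrMr ?mulr_gt0 // mulrAC ler_pdivlMr ?mulr_gt0 ?addr_gt0 //.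
rewrite mul1r; have : (x + y) * (x * y) <= 2 * w * r by apply: ler_pM => //; rewrite ?addr_ge0 ?mulr_ge0 ?ltW.
by rewrite (_ : 2 * (r * w) = 2 * w * r) //; ring.
Qed.

Lemma sum_prod (A B : finType) (f : A -> R[i]) (g : B -> R[i]) :
  \sum_(p : A * B) f p.1 * g p.2 = (\sum_a f a) * (\sum_b g b).
Proof.
by rewrite -(pair_bigA _ (fun a b => f a * g b)) big_distrlr.
Qed.

(** Four times this is the sum of the squares of the four odd numbers 2 u + 1 and of one even number
    2 u. *)
Definition qform (n : nat) (u : box n) : nat :=
  (1 + ((u.1.1.1 * u.1.1.1 + 1 * u.1.1.1) + (u.1.1.2 * u.1.1.2 + 1 * u.1.1.2) +
   ((u.1.2.1 * u.1.2.1 + 1 * u.1.2.1) + (u.1.2.2 * u.1.2.2 + 1 * u.1.2.2)) +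
   (u.2 * u.2 + 0 * u.2)))%N.

(** By orthogonality c = 0 contributes n^5. A frequency of odd denominator r contributes at most n^5
    r^(-5/2), there are at most r of these, and even denominators give 0. The rest is therefore at
    most n^5 times the sum of r^(-3/2) over odd r >= 3, that is 3/4 n^5. Over all r >= 2 that sum
    would exceed 1, which is why odd squares were chosen. *)
Lemma card_qform (n : nat) : (0 < n)%N ->
  n%:R ^+ 4 / 4 <= \sum_(u : box n) ((n %| qform u)%N%:R : R).
Proof.
move=> n0; have nR : 0 < n%:R :> R by rewrite ltr0n.
have n0' : n%:R != 0 :> R by rewrite gt_eqF.
pose term (c : 'I_n) : R[i] := ee (c%:R / n%:R) *
   (gauss n 1 c * gauss n 1 c * (gauss n 1 c * gauss n 1 c) * gauss n 0 c).
have E : (n%:R * \sum_(u : box n) ((n %| qform u)%N%:R : R))%:C%C = \sum_(c < n) term c.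
  rewrite realCM realC_sum natrC mulr_sumr.
  transitivity (\sum_(u : box n) \sum_(c < n) ee (c%:R * ((qform u)%:Z)%:~R / n%:R) : R[i]).
    apply: eq_bigr => u _; rewrite sum_ee_orthogonal // dvdzE /= natrC.
    by case: ifP; rewrite ?mulr1 ?mulr0.
  rewrite exchange_big; apply: eq_bigr => c _ /=.
  rewrite /term /gauss -!sum_prod mulr_sumr; apply: eq_bigr => u _.
  by rewrite -!eeD; congr ee; rewrite -pmulrn /qform !(natrM, natrD); field.
have c0 : term (Ordinal n0) = (n%:R ^+ 5 : R)%:C%C.
  have g0 b : gauss n b 0 = (n%:R : R)%:C%C.
    rewrite /gauss (eq_bigr (fun=> 1)) ?sumr_const ?card_ord ?natrC // => u _.
    by rewrite mul0n mul0r ee0.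
  by rewrite /term /= !g0 mul0r ee0 mul1r -!realCM; congr (_%:C%C); ring.
pose ord_r (c : nat) := (n %/ gcdn c n)%N.
(* A bound for every term whose c has denominator r = n / gcd(c, n): five factors n / sqrt r, or 0
   for even r. *)
pose h (r : nat) : R := if odd r then n%:R ^+ 5 / (r%:R ^+ 2 * Num.sqrt r%:R) else 0.
have h0 r : 0 <= h r.
  by rewrite /h; case: ifP => // _; rewrite divr_ge0 ?exprn_ge0 // mulr_ge0 ?exprn_ge0 ?sqrtr_ge0.
have facts (c : nat) : (0 < c < n)%N -> exists a, [/\ c = (gcdn c n * a)%N,
     n = (gcdn c n * ord_r c)%N, coprime (ord_r c) a & (1 < ord_r c <= n)%N].
  move=> /andP[cpos cn]; have g0 : (0 < gcdn c n)%N by rewrite gcdn_gt0 cpos.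
  exists (c %/ gcdn c n)%N; have e1 : c = (gcdn c n * (c %/ gcdn c n))%N by rewrite mulnC divnK // dvdn_gcdl.
  have e2 : n = (gcdn c n * ord_r c)%N by rewrite mulnC divnK // dvdn_gcdr.
  split=> //.
    by rewrite /coprime -(eqn_pmul2l g0) muln1 muln_gcdr -e2 -e1 gcdnC.
  rewrite /ord_r leq_div andbT ltn_divRL ?dvdn_gcdr // mul1n.
  by apply: leq_ltn_trans cn; apply: dvdn_leq => //; apply: dvdn_gcdl.
have term_le (c : 'I_n) : (0 < c)%N -> nrm (term c) <= h (ord_r c).
  move=> cpos; have [a [cE nE cop /andP[r1 rn]]] := facts c (ltac:(by rewrite cpos ltn_ord)).
  set g := gcdn c n in cE nE; set r := ord_r c in nE cop r1 rn *.
  rewrite /term cE /h; case: ifPn => [orr|er].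
    have rp : 0 < r%:R :> R by rewrite ltr0n odd_gt0.
    have sr : 0 < Num.sqrt r%:R :> R by rewrite sqrtr_gt0.
    have gb b : nrm (gauss n b (g * a)) <= n%:R / Num.sqrt r%:R.
      rewrite -(@ler_pXn2r _ 2) ?nnegrE ?nrm_ge0 ?divr_ge0 ?sqrtr_ge0 // nrm_sqr.
      apply: le_trans (@gauss_odd n g a r b n0 nE cop orr) _.
      rewrite expr_div_n sqr_sqrtr // ler_pdivlMr // -mulrA -natrM -nE expr2 //.
    rewrite nrmM nrm_ee mul1r !nrmM.
    set x := nrm (gauss n 1 _); set y := nrm (gauss n 0 _).
    have x0 : 0 <= x by exact: nrm_ge0.
    have xx : x * x <= (n%:R / Num.sqrt r%:R) * (n%:R / Num.sqrt r%:R) by apply: ler_pM; rewrite ?gb.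
    have x4 : x * x * (x * x) <= (n%:R / Num.sqrt r%:R) * (n%:R / Num.sqrt r%:R) * ((n%:R / Num.sqrt r%:R) * (n%:R / Num.sqrt r%:R)).
      by apply: ler_pM => //; rewrite mulr_ge0.
    have x5 : x * x * (x * x) * y <= (n%:R / Num.sqrt r%:R) * (n%:R / Num.sqrt r%:R) * ((n%:R / Num.sqrt r%:R) * (n%:R / Num.sqrt r%:R)) * (n%:R / Num.sqrt r%:R).
      by apply: ler_pM => //; rewrite ?nrm_ge0 ?gb // !mulr_ge0.
    apply: le_trans x5 _; rewrite le_eqVlt; apply/orP; left; apply/eqP.
    have -> : r%:R ^+ 2 = Num.sqrt r%:R ^+ 4 :> R by rewrite -{1}(@sqr_sqrtr _ (r%:R : R)) // -exprM.
    by field; rewrite gt_eqF.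
  have oa : odd a.
    apply/negPn/negP => ea; move: cop; rewrite /coprime => /eqP g1.
    have : (2 %| gcdn r a)%N by rewrite dvdn_gcd !dvdn2 er ea.
    by rewrite g1.
  rewrite -[X in ee _ * X]mulrA [X in _ * (_ * X)](_ : _ = gauss n 1 (g * a) * (gauss n 1 (g * a) * gauss n 0 (g * a))) ?mulrA //.
  by rewrite -[X in nrm X]mulrA (gauss_even n0 nE oa er) mulr0 nrm0.
(* The denominator r fixes gcd(c, n), so c is determined by its reduced numerator, which is below
   r. *)
have count (r : nat) : (#|[set c : 'I_n | (0 < c)%N && (ord_r c == r)]| <= r)%N.
  set B := [set c | _]; have [r0|r0] := posnP r.
    rewrite [X in (_ <= X)%N]r0 leqn0 cards_eq0; apply/eqP/setP => c; rewrite !inE; apply/negbTE/negP => /andP[cpos /eqP e].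
    have [a [_ _ _]] := facts c (ltac:(by rewrite cpos ltn_ord)).
    by rewrite e r0.
  pose k (c : 'I_n) : 'I_r.-1.+1 := inord (c %/ gcdn c n).
  have kinj : {in B &, injective k}.
    move=> c c'; rewrite !inE => /andP[cp /eqP e] /andP[cp' /eqP e'] /(congr1 val) /=.
    have [a [cE nE cop _]] := facts c (ltac:(by rewrite cp ltn_ord)).
    have [a' [cE' nE' cop' _]] := facts c' (ltac:(by rewrite cp' ltn_ord)).
    have g0 : (0 < gcdn c n)%N by rewrite gcdn_gt0 cp.
    have g0' : (0 < gcdn c' n)%N by rewrite gcdn_gt0 cp'.
    have gg : gcdn c n = gcdn c' n.
      by apply/eqP; rewrite -(eqn_pmul2r r0) -{1}e -e' -nE -nE'.
    have lt : (c %/ gcdn c n < r)%N.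
      rewrite -(ltn_pmul2r g0) divnK ?dvdn_gcdl // -e mulnC -nE ltn_ord //.
    have lt' : (c' %/ gcdn c' n < r)%N.
      rewrite -(ltn_pmul2r g0') divnK ?dvdn_gcdl // -e' mulnC -nE' ltn_ord //.
    rewrite !inordK ?prednK // => ee; apply: val_inj => /=.
    by rewrite -(divnK (dvdn_gcdl c n)) ee gg divnK // dvdn_gcdl.
  by rewrite -(card_in_imset kinj); apply: leq_trans (max_card _) _; rewrite card_ord prednK.
have sumle : \sum_(c < n | (0 < c)%N) nrm (term c) <= n%:R ^+ 5 * (3 / 4).
  apply: (@le_trans _ _ (\sum_(c < n | (0 < c)%N) h (ord_r c))).
    by apply: ler_sum => c cpos; apply: term_le.
  have -> : \sum_(c < n | (0 < c)%N) h (ord_r c) =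
      \sum_(2 <= r < n.+1) #|[set c : 'I_n | (0 < c)%N && (ord_r c == r)]|%:R * h r.
    transitivity (\sum_(c < n | (0 < c)%N) \sum_(2 <= r < n.+1) (if ord_r c == r then h r else 0)).
      apply: eq_bigr => c cpos.
      have [a [_ _ _ rr]] := facts c (ltac:(by rewrite cpos ltn_ord)).
      rewrite (bigD1_seq (ord_r c)) ?iota_uniq ?mem_index_iota //= eqxx.
      by rewrite big1 ?addr0 // => i; rewrite eq_sym => /negbTE ->.
    rewrite exchange_big /=; apply: eq_bigr => r _.
    rewrite -big_mkcondr /= sumr_const mulr_natl; congr (_ *+ _).
    by apply: eq_card => c; rewrite inE.
  apply: (@le_trans _ _ (\sum_(2 <= r < n.+1) r%:R * h r)).
    by apply: ler_sum => r _; rewrite ler_wpM2r // ler_nat.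
  apply: (@le_trans _ _ (\sum_(2 <= r < (2 * n.+1)) r%:R * h r)).
    have le2 : (n.+1 <= 2 * n.+1)%N by rewrite leq_pmull.
    rewrite [leRHS](big_cat_nat (n := n.+1)) //=.
    by rewrite lerDl; apply: sumr_ge0 => r _; rewrite mulr_ge0.
  have -> : \sum_(2 <= r < (2 * n.+1)) r%:R * h r = \sum_(1 <= s < n.+1) (2 * s + 1)%:R * h (2 * s + 1)%N.
    pose F (r : nat) := r%:R * h r; have F0 : F 0%N = 0 by rewrite /F mul0r.
    have hh s : \sum_(0 <= j < 2) F (2 * s + j)%N = F (2 * s + 1)%N.
      rewrite big_nat_recr //= big_nat1 addn0 {1}/F {1}/h.
      by rewrite oddM /= mulr0 add0r.
    have e1 : \sum_(0 <= r < 2 * n.+1) F r = F 1%N + \sum_(2 <= r < 2 * n.+1) F r.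
      by rewrite big_ltn ?muln_gt0 // F0 add0r big_ltn //; lia.
    have e2 : \sum_(0 <= s < n.+1) F (2 * s + 1)%N = F 1%N + \sum_(1 <= s < n.+1) F (2 * s + 1)%N.
      by rewrite big_ltn.
    apply: (@addrI _ (F 1%N)); rewrite -e1 -e2 sum_nat_blocks.
    by apply: eq_bigr => s _; apply: hh.
  rewrite (eq_bigr (fun s => n%:R ^+ 5 * ((2 * s + 1)%:R * Num.sqrt (2 * s + 1)%:R)^-1)).
    by rewrite -mulr_sumr ler_wpM2l ?exprn_ge0 // sum_odd_le.
  move=> s _; rewrite /h oddD oddM /=.
  have p : 0 < (2 * s + 1)%:R :> R by rewrite ltr0n addn1.
  by field; rewrite !gt_eqF // sqrtr_gt0.
have main : n%:R ^+ 5 - n%:R ^+ 5 * (3 / 4) <= n%:R * \sum_(u : box n) ((n %| qform u)%N%:R : R).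
  have -> : n%:R * \sum_(u : box n) ((n %| qform u)%N%:R : R) =
     complex.Re (n%:R * \sum_(u : box n) ((n %| qform u)%N%:R : R))%:C%C by [].
  rewrite E (bigD1 (Ordinal n0)) //= c0.
  set z := \sum_(i < n | _) _.
  have nz : nrm z <= n%:R ^+ 5 * (3 / 4).
    apply: le_trans sumle; apply: le_trans (ler_nrm_sum _ _ _) _.
    rewrite le_eqVlt; apply/orP; left; apply/eqP; apply: eq_bigl => c.
    by rewrite lt0n; congr negb.
  have := Re_le_nrm (- z); rewrite nrmN; case: (z) nz => a b /= nz ha; lra.
rewrite -(ler_pM2l nR); apply: le_trans main; rewrite le_eqVlt; apply/orP; left; apply/eqP.
by field.
Qed.

End GaussSums.

(** * Lower bound for the pairs on a shell in a residue class *)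

Lemma four_quarters_le (a b c d m : nat) : (4 * a <= m)%N -> (4 * b <= m)%N ->
  (4 * c <= m)%N -> (4 * d <= m)%N -> (a + b + (c + d) <= m)%N.
Proof. by lia. Qed.

Section ShellCount.
Variable R : realType.

(** The image of counting measure under nA is at least w times that under nB, when tested on
    Q-periodic functions; Q = 0 imposes no periodicity. The relation is stable under products, so
    five coordinates reduce to one. *)
Definition dominates (Q : int) (A : finType) (nA : A -> int) (B : finType) (nB : B -> int) (w : R) :=
  forall Psi : int -> R, (forall n, 0 <= Psi n) -> (forall n, Psi (n + Q) = Psi n) ->
  w * \sum_b Psi (nB b) <= \sum_a Psi (nA a).

Lemma dominates_prod Q A nA B nB w A' nA' B' nB' w' : 0 <= w' ->
  @dominates Q A nA B nB w -> @dominates Q A' nA' B' nB' w' ->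
  dominates Q (fun p : A * A' => nA p.1 + nA' p.2) (fun p : B * B' => nB p.1 + nB' p.2) (w * w').
Proof.
move=> w0 h h' Psi P0 PQ.
rewrite -(pair_bigA _ (fun b b' => Psi (nB b + nB' b'))) -(pair_bigA _ (fun a a' => Psi (nA a + nA' a'))) /=.
apply: (@le_trans _ _ (\sum_a w' * \sum_b' Psi (nA a + nB' b'))).
  rewrite -mulrA [w' * _]mulr_sumr; apply: (h (fun n => w' * \sum_b' Psi (n + nB' b'))) => n.
    by rewrite mulr_ge0 // sumr_ge0.
  by congr (_ * _); apply: eq_bigr => b' _; rewrite addrAC PQ.
apply: ler_sum => a _; apply: (h' (fun n => Psi (nA a + n))) => n; first exact: P0.
by rewrite addrA PQ.
Qed.

Definition quint (A E : finType) : finType := (A * A * (A * A) * E)%type.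

Definition quint_sum (A E : finType) (nA : A -> int) (nE : E -> int) (x : quint A E) : int :=
  nA x.1.1.1 + nA x.1.1.2 + (nA x.1.2.1 + nA x.1.2.2) + nE x.2.

Definition quad_sum (A : finType) (nA : A -> int) (x : A * A * (A * A)) : int :=
  nA x.1.1 + nA x.1.2 + (nA x.2.1 + nA x.2.2).

Lemma dominates_quad Q A nA B nB w : 0 <= w -> @dominates Q A nA B nB w ->
  dominates Q (quad_sum nA) (quad_sum nB) (w ^+ 4).
Proof.
move=> w0 h Psi P0 PQ.
have h2 := dominates_prod w0 h h.
have h4 := dominates_prod (mulr_ge0 w0 w0) h2 h2.
by have := h4 Psi P0 PQ; rewrite (_ : w * w * (w * w) = w ^+ 4) //; ring.
Qed.

Lemma dominates_quint Q A nA B nB w E nE F nF v : 0 <= w -> 0 <= v ->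
  @dominates Q A nA B nB w -> @dominates Q E nE F nF v ->
  dominates Q (quint_sum nA nE) (quint_sum nB nF) (w ^+ 4 * v).
Proof. by move=> w0 v0 h hE; apply: dominates_prod v0 (dominates_quad w0 h) hE. Qed.

Definition sqi (n : nat) (a : 'I_n) : int := (a * a)%N%:Z.

(** Only the pairs (s, s + b) with s < H and b < H are kept. *)
Lemma dominates_pairs (L H : nat) : (2 * H <= L)%N ->
  dominates 0 (fun p : 'I_L * 'I_L => dsq1 p.1 p.2) (@sqi H) H%:R.
Proof.
move=> HL Psi P0 _.
rewrite -(pair_bigA _ (fun s s' : 'I_L => Psi (dsq1 s s'))) /=.
rewrite -(big_mkord xpredT (fun s : nat => \sum_(s' < L) Psi (dsq1 s s'))).
apply: (@le_trans _ _ (\sum_(0 <= s < H) \sum_(s' < L) Psi (dsq1 s s'))); last first.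
  by apply: ler_sum_nat_sub => [s|]; [exact: sumr_ge0|lia].
rewrite mulr_natl -[H in _ *+ H]subn0 -[leLHS]addr0 -iter_addr -big_const_nat.
rewrite big_nat_cond [leRHS]big_nat_cond; apply: ler_sum => s /andP[/andP[_ sH] _].
rewrite -(big_mkord xpredT (fun s' : nat => Psi (dsq1 s s'))).
rewrite -(big_mkord xpredT (fun b : nat => Psi (b * b)%N%:Z)).
apply: (@le_trans _ _ (\sum_(0 + s <= s' < H + s) Psi (dsq1 s s'))); last first.
  by apply: ler_sum_nat_sub => [//|]; lia.
rewrite big_addn addnK; apply: ler_sum => b _.
by rewrite /dsq1 PoszD addrK PoszM expr2.
Qed.

Lemma dominates_widen (H G : nat) : (G <= H)%N -> dominates 0 (@sqi H) (@sqi G) 1.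
Proof.
move=> GH Psi P0 _; rewrite mul1r.
rewrite -(big_mkord xpredT (fun b : nat => Psi (b * b)%N%:Z)).
rewrite -(big_mkord xpredT (fun b : nat => Psi (b * b)%N%:Z)).
exact: ler_sum_nat_sub.
Qed.

Lemma periodic_mul (Q : int) (Psi : int -> R) : (forall n, Psi (n + Q) = Psi n) ->
  forall n (k : nat), Psi (n + k%:Z * Q) = Psi n.
Proof.
move=> PQ n; elim=> [|k IH]; first by rewrite mul0r addr0.
by rewrite -[k.+1]addn1 PoszD mulrDl mul1r addrA PQ IH.
Qed.

Lemma dominates_periodic (q w : nat) : dominates q%:Z (@sqi (q * w)) (@sqi q) w%:R.
Proof.
move=> Psi P0 PQ.
rewrite -!(big_mkord xpredT (fun b : nat => Psi (b * b)%N%:Z)) sum_nat_blocks.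
rewrite mulr_natl -[w in _ *+ w]subn0 -[leLHS]addr0 -iter_addr -big_const_nat.
rewrite le_eqVlt; apply/orP; left; apply/eqP; apply: eq_bigr => k _; apply: eq_bigr => j _.
rewrite -[LHS](periodic_mul PQ _ (q * k * k + 2 * k * j)); congr Psi.
by rewrite -PoszM -PoszD; congr Posz; ring.
Qed.

Lemma dominates_odd (n : nat) :
  dominates 0 (@sqi (4 * n)) (fun u : 'I_n => ((2 * u + 1) * (2 * u + 1))%N%:Z) 1.
Proof.
move=> Psi P0 _; rewrite mul1r.
have lt (u : 'I_n) : (2 * u + 1 < 4 * n)%N by have := ltn_ord u; lia.
pose f (u : 'I_n) := Ordinal (lt u).
have finj : injective f by move=> u v /(congr1 val) /= e; apply: val_inj => /=; lia.
rewrite (eq_bigr (fun u => Psi (sqi (f u)))) // -(big_imset (fun a => Psi (sqi a)) (in2W finj)).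
by rewrite [leLHS]big_mkcond; apply: ler_sum => a _; case: ifP.
Qed.

Lemma dominates_even (n : nat) : (0 < n)%N ->
  dominates 0 (@sqi (4 * n)) (fun u : 'I_n => ((2 * u) * (2 * u))%N%:Z) 1.
Proof.
move=> n0 Psi P0 _; rewrite mul1r.
have lt (u : 'I_n) : (2 * u < 4 * n)%N by have := ltn_ord u; lia.
pose f (u : 'I_n) := Ordinal (lt u).
have finj : injective f by move=> u v /(congr1 val) /= e; apply: val_inj => /=; lia.
rewrite (eq_bigr (fun u => Psi (sqi (f u)))) // -(big_imset (fun a => Psi (sqi a)) (in2W finj)).
by rewrite [leLHS]big_mkcond; apply: ler_sum => a _; case: ifP.
Qed.

Definition nsq (n : nat) (x : box n) : int := @quint_sum 'I_n 'I_n (@sqi n) (@sqi n) x.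

(** Restriction to four odd coordinates and one even coordinate; their sum of squares is 4
    [qform]. *)
Lemma card_isotropic (n : nat) : (0 < n)%N ->
  n%:R ^+ 4 / 4 <= \sum_(r : box (4 * n)) (((4 * n)%N%:Z %| nsq r)%Z%:R : R).
Proof.
move=> n0; apply: le_trans (card_qform R n0) _.
have := dominates_quint ler01 ler01 (@dominates_odd n) (dominates_even n0).
move=> /(_ (fun k => ((4 * n)%N%:Z %| k)%Z%:R)); rewrite expr1n !mul1r => H.
apply: le_trans (H _ _) => [|k|k]; rewrite ?addr0 //.
rewrite le_eqVlt; apply/orP; left; apply/eqP; apply: eq_bigr => u _; congr (nat_of_bool _)%:R.
rewrite /quint_sum -!PoszD dvdzE /= -[LHS](@dvdn_pmul2l 4) //; congr (_ %| _)%N.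
by rewrite /qform; ring.
Qed.

Lemma sum_quint_pairs (L : nat) (Psi : int -> R) :
  \sum_(x : box L) \sum_(x' : box L) Psi (dsq x x') =
  \sum_(z : quint ('I_L * 'I_L)%type ('I_L * 'I_L)%type)
    Psi (quint_sum (fun p : 'I_L * 'I_L => dsq1 p.1 p.2) (fun p : 'I_L * 'I_L => dsq1 p.1 p.2) z).
Proof.
rewrite pair_bigA /=.
pose h (z : quint ('I_L * 'I_L)%type ('I_L * 'I_L)%type) : box L * box L :=
  ((z.1.1.1.1, z.1.1.2.1, (z.1.2.1.1, z.1.2.2.1), z.2.1),
   (z.1.1.1.2, z.1.1.2.2, (z.1.2.1.2, z.1.2.2.2), z.2.2)).
pose k (p : box L * box L) : quint ('I_L * 'I_L)%type ('I_L * 'I_L)%type :=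
  (((p.1.1.1.1, p.2.1.1.1), (p.1.1.1.2, p.2.1.1.2)),
   ((p.1.1.2.1, p.2.1.2.1), (p.1.1.2.2, p.2.1.2.2)), (p.1.2, p.2.2)).
rewrite (reindex h) //; exists k => z _.
  by move: z => [[[[a a'] [b b']] [[c c'] [d d']]] [e e']].
by move: z => [[[[a b] [c d]] e] [[[a' b'] [c' d']] e']].
Qed.

Lemma isqrt_exists (n : nat) : exists s, (s * s <= n < s.+1 * s.+1)%N.
Proof.
elim: n => [|n [s /andP[h1 h2]]]; first by exists 0%N.
have [lt|ge] := ltnP n.+1 (s.+1 * s.+1); first by exists s; rewrite lt (leq_trans h1).
by exists s.+1; rewrite ge; lia.
Qed.

(** With s the integer root of m - t, the error of (s + y)^2 is at most 2 N downwards and 3 N b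
    upwards; 96 and 32 make both at most K1 / 4. *)
Lemma shell_estimate (m N t s y b K1 : nat) : (t <= m)%N -> (N * N <= m)%N -> (m < N.+1 * N.+1)%N ->
  (s * s <= m - t < s.+1 * s.+1)%N -> (y <= b)%N -> (b <= N)%N -> (32 * N * b <= K1)%N ->
  (96 * N <= K1)%N -> (0 < N)%N ->
  [/\ (s <= N)%N & (4 * absz (t%:Z + ((s + y) * (s + y))%N%:Z - m%:Z)%R <= K1)%N].
Proof.
move=> tm Nm mN /andP[s1 s2] yb bN Kb KN N0.
have sN : (s <= N)%N.
  rewrite -ltnS ltnNge; apply/negP => h; have := leq_mul h h; lia.
split=> //.
have sy : (s * y <= N * b)%N by apply: leq_mul.
have yy : (y * y <= N * b)%N by apply: leq_mul => //; apply: leq_trans bN.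
have e1 : ((s + y) * (s + y) = s * s + 2 * (s * y) + y * y)%N by ring.
have e2 : (s.+1 * s.+1 = s * s + 2 * s + 1)%N by ring.
rewrite e1; rewrite e2 in s2.
have e3 : (32 * N * b = 32 * (N * b))%N by ring.
rewrite e3 in Kb.
move: (s * s)%N (s * y)%N (y * y)%N (N * b)%N s1 s2 sy yy Kb => A B C D; lia.
Qed.

(** Four coordinates of the difference are taken below N / 2, so their squares sum to at most m, and
    the fifth in a window of length q B just above the root of what is missing. The window consists
    of full periods modulo q, which reduces the congruence to [card_isotropic]. The factor 4 inside
    the shell condition leaves room for rounding points to cells. *)
Lemma shell_pairs (n m N L K w1 B : nat) (q := (4 * n)%N) : (0 < n)%N ->
    (N * N <= m)%N -> (m < N.+1 * N.+1)%N -> (6 * N <= L)%N -> (q %| m)%N ->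
    (2 * (q * w1) <= N)%N -> (32 * N * B <= K)%N -> (96 * N <= K)%N -> (q * B <= N)%N -> (0 < N)%N ->
  (3 * N)%:R ^+ 5 * (w1%:R ^+ 4 * (B%:R * (n%:R ^+ 4 / 4))) <=
  \sum_(x : box L) \sum_(x' : box L)
    (((q%:Z %| dsq x x' - m%:Z)%Z && (4 * `|dsq x x' - m%:Z| <= K * q)%N)%:R : R).
Proof.
move=> n0 Nm mN NL qm qw KB KN qB N0.
have q0 : (0 < q)%N by rewrite muln_gt0.
pose phi (k : int) : R := ((q%:Z %| k - m%:Z)%Z && (4 * `|k - m%:Z| <= K * q)%N)%:R.
have phi0 k : 0 <= phi k by rewrite /phi ler0n.
have qmZ : (q%:Z %| m%:Z)%Z by rewrite dvdzE.
have dP := @dominates_pairs L (3 * N) (ltac:(by rewrite mulnA)).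
have H1 := dominates_quint (ler0n R (3 * N)) (ler0n R (3 * N)) dP dP phi0 (fun n => congr1 phi (addr0 n)).
rewrite (sum_quint_pairs L phi); apply: le_trans H1.
rewrite -exprSr ler_wpM2l ?exprn_ge0 //.
pose H := (3 * N)%N.
rewrite -(pair_bigA _ (fun v4 v5 => phi (@quad_sum 'I_H (@sqi H) v4 + @sqi H v5))) /=.
pose Psi0 (k : int) : R := \sum_(v5 < H) phi (k + sqi v5).
have Psi00 k : 0 <= Psi0 k by rewrite sumr_ge0.
have GH : (q * w1 <= H)%N by rewrite /H; lia.
have H2 := dominates_quad ler01 (@dominates_widen H (q * w1) GH) Psi00 (fun n => congr1 Psi0 (addr0 n)).
apply: le_trans H2; rewrite expr1n mul1r.
pose psi (k : int) : R := (q%:Z %| k)%Z%:R.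
have psi0 k : 0 <= psi k by rewrite ler0n.
have psiq k : psi (k + q%:Z) = psi k by rewrite /psi rpredDr ?dvdzz.
pose Psi1 (k : int) : R := B%:R * \sum_(r < q) psi (k + sqi r).
have Psi10 k : 0 <= Psi1 k by rewrite mulr_ge0 // sumr_ge0.
have Psi1q k : Psi1 (k + q%:Z) = Psi1 k.
  by congr (_ * _); apply: eq_bigr => r _; rewrite addrAC psiq.
(* The fifth coordinate: B periods modulo q, starting at the integer root s of m - t; by periodicity
   each has the same sum as a period starting at 0. *)
have inner (t : nat) : (t <= m)%N -> Psi1 t%:Z <= Psi0 t%:Z.
  move=> tm; have [s hs] := isqrt_exists (m - t).
  have est y : (y < q * B)%N -> (s <= N)%N /\
     (4 * absz (t%:Z + ((s + y) * (s + y))%N%:Z - m%:Z)%R <= K * q)%N.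
    move=> yb; have [] := @shell_estimate m N t s y (q * B) (K * q) tm Nm mN hs (ltnW yb) qB _ _ N0 => //.
      by rewrite [(K * q)%N]mulnC mulnCA leq_mul2l KB orbT.
    by apply: leq_trans KN _; rewrite leq_pmulr.
  rewrite /Psi0 -(big_mkord xpredT (fun v5 : nat => phi (t%:Z + (v5 * v5)%N%:Z))).
  have [B0|Bpos] := posnP B; first by rewrite /Psi1 B0 mul0r sumr_ge0.
  have [sN _] := est 0%N (ltac:(by rewrite muln_gt0 q0)).
  apply: (@le_trans _ _ (\sum_(0 + s <= v5 < q * B + s) phi (t%:Z + (v5 * v5)%N%:Z))); last first.
    by apply: ler_sum_nat_sub => //; rewrite /H; lia.
  rewrite big_addn addnK.
  apply: (@le_trans _ _ (\sum_(0 <= y < q * B) psi (t%:Z + ((s + y) * (s + y))%N%:Z))); last first.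
    rewrite [leLHS]big_nat_cond [leRHS]big_nat_cond; apply: ler_sum => y; rewrite andbT => /andP[_ yb].
    have [_ e] := est y yb; rewrite /phi [(y + s)%N]addnC e andbT /psi.
    by rewrite rpredBr.
  rewrite sum_nat_blocks.
  have per k j : psi (t%:Z + ((s + (q * k + j)) * (s + (q * k + j)))%N%:Z) = psi (t%:Z + ((s + j) * (s + j))%N%:Z).
    rewrite -[RHS](periodic_mul psiq _ (q * k * k + 2 * k * (s + j))); congr psi.
    by rewrite -addrA; congr (_ + _); rewrite -PoszM -PoszD; congr Posz; ring.
  have per1 u : psi (t%:Z + ((u + q) * (u + q))%N%:Z) = psi (t%:Z + (u * u)%N%:Z).
    rewrite -[RHS](periodic_mul psiq _ (q + 2 * u)); congr psi.
    by rewrite -addrA; congr (_ + _); rewrite -PoszM -PoszD; congr Posz; ring.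
  rewrite (eq_bigr (fun=> \sum_(r < q) psi (t%:Z + sqi r))); last first.
    move=> k _; transitivity (\sum_(u < q) psi (t%:Z + ((s + u) * (s + u))%N%:Z)).
      by rewrite big_mkord; apply: eq_bigr => j _; exact: per.
    by have := @sum_shift_periodic R (fun u => psi (t%:Z + (u * u)%N%:Z)) q s per1.
  by rewrite big_const_nat iter_addr addr0 subn0 /Psi1 mulr_natl.
apply: (@le_trans _ _ (\sum_v Psi1 (@quad_sum 'I_(q * w1) (@sqi (q * w1)) v))); last first.
  apply: ler_sum => v _; rewrite /quad_sum /sqi -!PoszD; apply: inner.
  have sm (a : 'I_(q * w1)) : (4 * (a * a) <= m)%N.
    by apply: leq_trans Nm; have := ltn_ord a => h; have := @leq_mul (2 * a) (2 * a) N N; rewrite mulnACA; apply; lia.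
  by apply: four_quarters_le; apply: sm.
have H3 := dominates_quad (ler0n R w1) (@dominates_periodic q w1) Psi10 Psi1q.
apply: le_trans H3; rewrite ler_wpM2l ?exprn_ge0 // -mulr_sumr ler_wpM2l //.
apply: le_trans (card_isotropic n0) _.
rewrite -(pair_bigA _ (fun v4 v5 => psi (@quad_sum 'I_q (@sqi q) v4 + @sqi q v5))) /=.
by rewrite pair_bigA /=.
Qed.

End ShellCount.

(** * Averages over cells *)

Lemma sqr_sum (R : comPzRingType) (Z : finType) (F : Z -> R) :
  (\sum_z F z) ^+ 2 = \sum_z \sum_z' F z * F z'.
Proof. by rewrite expr2 big_distrlr. Qed.

Section Cells.
Variables (R : realFieldType) (X I Y : finType) (cell : X -> I) (pos : X -> Y) (phi : I -> Y -> X).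
Hypotheses (phiK : forall x, phi (cell x) (pos x) = x)
  (cell_phi : forall i y, cell (phi i y) = i) (pos_phi : forall i y, pos (phi i y) = y).
Hypotheses (I0 : (0 < #|I|)%N) (Y0 : (0 < #|Y|)%N).

Definition flat_kernel (Z : finType) (_ _ : Z) : R := (#|Z|%:R ^+ 2)^-1.

Definition cell_kernel (x x' : X) : R := (cell x == cell x')%:R / (#|I|%:R * #|Y|%:R ^+ 2).

Lemma sum_cells (G : X -> R) : \sum_x G x = \sum_i \sum_y G (phi i y).
Proof.
rewrite pair_bigA /= (reindex (fun p : I * Y => phi p.1 p.2)) //.
by exists (fun x => (cell x, pos x)) => [[i y] _|x _] /=; rewrite ?cell_phi ?pos_phi ?phiK.
Qed.

Lemma card_cells : #|X| = (#|I| * #|Y|)%N.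
Proof.
rewrite -card_prod; apply/esym; apply: (@bij_eq_card _ _ (fun p : I * Y => phi p.1 p.2)).
by exists (fun x => (cell x, pos x)) => [[i y]|x] /=; rewrite ?cell_phi ?pos_phi ?phiK.
Qed.

Let i0 : #|I|%:R != 0 :> R. Proof. by rewrite pnatr_eq0 -lt0n. Qed.
Let y0 : #|Y|%:R != 0 :> R. Proof. by rewrite pnatr_eq0 -lt0n. Qed.
Let ipos : 0 < #|I|%:R :> R. Proof. by rewrite ltr0n. Qed.
Let ypos : 0 < #|Y|%:R :> R. Proof. by rewrite ltr0n. Qed.

Lemma sum_cell_kernel (G : X -> X -> R) :
  \sum_x \sum_x' cell_kernel x x' * G x x' =
  #|I|%:R^-1 * \sum_i \sum_y \sum_y' flat_kernel y y' * G (phi i y) (phi i y').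
Proof.
rewrite sum_cells mulr_sumr; apply: eq_bigr => i _; rewrite mulr_sumr; apply: eq_bigr => y _.
rewrite sum_cells (bigD1 i) //= [X in _ + X]big1 ?addr0.
  rewrite mulr_sumr; apply: eq_bigr => y' _.
  by rewrite /cell_kernel /flat_kernel !cell_phi eqxx mul1r invfM mulrA.
by move=> j ji; apply: big1 => y' _; rewrite /cell_kernel !cell_phi eq_sym (negbTE ji) !mul0r.
Qed.

Definition cell_avg (F : X -> R) (i : I) : R := (\sum_y F (phi i y)) / #|Y|%:R.

Definition avg (F : X -> R) : R := (\sum_x F x) / #|X|%:R.

Lemma quad_flat (F : X -> R) : quad (@flat_kernel X) F = avg F ^+ 2.
Proof.
rewrite /quad /avg exprMn exprVn mulrC sqr_sum mulr_sumr /=.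
by apply: eq_bigr => x _; rewrite mulr_sumr.
Qed.

Lemma avg_cell_avg (F : X -> R) : avg F = #|I|%:R^-1 * \sum_i cell_avg F i.
Proof.
rewrite /avg card_cells natrM sum_cells invfM mulrC -mulrA; congr (_ * _).
by rewrite mulr_sumr; apply: eq_bigr => i _; rewrite mulrC.
Qed.

Lemma quad_cell (F : X -> R) : quad cell_kernel F = #|I|%:R^-1 * \sum_i cell_avg F i ^+ 2.
Proof.
rewrite /quad sum_cell_kernel; congr (_ * _); apply: eq_bigr => i _.
rewrite /cell_avg exprMn exprVn mulrC sqr_sum mulr_sumr /=.
by apply: eq_bigr => y _; rewrite mulr_sumr.
Qed.

(** What the refinement to cells gains is the variance of the cell averages; this gain is what pays
    for their deviation from the mean in [quad_cell_lower]. *)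
Lemma variance (F : X -> R) : quad cell_kernel F - quad (@flat_kernel X) F =
  #|I|%:R^-1 * \sum_i (cell_avg F i - avg F) ^+ 2.
Proof.
have e : \sum_i cell_avg F i = #|I|%:R * avg F by rewrite avg_cell_avg mulVKf.
rewrite quad_cell quad_flat.
have -> : \sum_i (cell_avg F i - avg F) ^+ 2 =
    \sum_i cell_avg F i ^+ 2 - 2 * avg F * \sum_i cell_avg F i + #|I|%:R * avg F ^+ 2.
  transitivity (\sum_i (cell_avg F i ^+ 2 - 2 * avg F * cell_avg F i + avg F ^+ 2)).
    by apply: eq_bigr => i _; ring.
  by rewrite big_split sumrB /= -mulr_sumr sumr_const -(mulr_natl (avg F ^+ 2)).
by rewrite e; field.
Qed.

Lemma quad_flat_le_cell (F : X -> R) : quad (@flat_kernel X) F <= quad cell_kernel F.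
Proof.
rewrite -subr_ge0 variance mulr_ge0 ?invr_ge0 //.
by apply: sumr_ge0 => i _; apply: sqr_ge0.
Qed.

Lemma avg1 : avg (fun=> 1) = 1.
Proof.
rewrite /avg sumr_const divff // card_cells pnatr_eq0 muln_eq0 negb_or.
by rewrite -!lt0n I0.
Qed.

Lemma mass_flat : mass (@flat_kernel X) = 1.
Proof. by rewrite massE_quad quad_flat avg1 expr1n. Qed.

Lemma mass_cell : mass cell_kernel = 1.
Proof.
rewrite massE_quad quad_cell (eq_bigr (fun=> 1)) ?sumr_const ?mulVf // => i _.
by rewrite /cell_avg sumr_const divff // expr1n.
Qed.

Lemma flat_kernel_ge0 (Z : finType) (z z' : Z) : 0 <= flat_kernel z z'.
Proof. by rewrite invr_ge0 exprn_ge0. Qed.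

Lemma cell_kernel_ge0 x x' : 0 <= cell_kernel x x'.
Proof. by rewrite divr_ge0 ?mulr_ge0 ?exprn_ge0. Qed.

Lemma cell_avg01 (F : X -> R) i : unit_valued F -> 0 <= cell_avg F i <= 1.
Proof.
move=> F01; rewrite /cell_avg divr_ge0 ?sumr_ge0 //=; last by move=> y _; case/andP: (F01 (phi i y)).
rewrite ler_pdivrMr // mul1r -[leRHS]/(1 *+ #|Y|) -sumr_const; apply: ler_sum => y _.
by case/andP: (F01 (phi i y)).
Qed.

(* A kernel that dominates a cell-constant kernel M0 almost only sees the cell averages. *)
Lemma quad_cell_lower (M : X -> X -> R) (M0 : I -> I -> R) (c C2 eps : R) (F : X -> R) :
    0 < eps -> 0 < C2 -> unit_valued F ->
    (forall i j, 0 <= M0 i j <= C2 / #|X|%:R ^+ 2) ->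
    (forall x x', M0 (cell x) (cell x') <= M x x') ->
    c <= \sum_x \sum_x' M0 (cell x) (cell x') ->
  - eps <= quad M F - c * quad (@flat_kernel X) F +
    C2 ^+ 2 / eps * (quad cell_kernel F - quad (@flat_kernel X) F).
Proof.
move=> eps0 C20 F01 M01 MM cle.
set g := cell_avg F; set a := avg F.
have g01 i : 0 <= g i <= 1 by apply: cell_avg01.
have a01 : 0 <= a <= 1.
  rewrite /a avg_cell_avg mulr_ge0 ?invr_ge0 ?sumr_ge0 //=; last by move=> i _; case/andP: (g01 i).
  rewrite ler_pdivrMl // mulr1 -[leRHS]/(1 *+ #|I|) -sumr_const; apply: ler_sum => i _.
  by case/andP: (g01 i).
pose Wt i j := M0 i j * #|Y|%:R ^+ 2.
have F0 x : 0 <= F x by case/andP: (F01 x).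
have e1 : \sum_i \sum_j Wt i j * (g i * g j) <= quad M F.
  apply: (@le_trans _ _ (\sum_x \sum_x' M0 (cell x) (cell x') * (F x * F x'))); last first.
    by apply: ler_sum => x _; apply: ler_sum => x' _; rewrite ler_wpM2r ?mulr_ge0.
  rewrite le_eqVlt; apply/orP; left; apply/eqP; rewrite sum_cells; apply: eq_bigr => i _.
  transitivity (\sum_y \sum_j \sum_y' M0 i j * (F (phi i y) * F (phi j y'))).
    rewrite exchange_big /=; apply: eq_bigr => j _.
    have -> : Wt i j * (g i * g j) = M0 i j * ((\sum_y F (phi i y)) * (\sum_y F (phi j y))).
      by rewrite /Wt /g /cell_avg; field.
    rewrite big_distrlr mulr_sumr /=.
    by apply: eq_bigr => y _; rewrite mulr_sumr.
  apply: eq_bigr => y _; rewrite sum_cells; apply: eq_bigr => j _; apply: eq_bigr => y' _.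
  by rewrite !cell_phi.
have e2 : c <= \sum_i \sum_j Wt i j.
  apply: le_trans cle _; rewrite le_eqVlt; apply/orP; left; apply/eqP.
  rewrite sum_cells; apply: eq_bigr => i _.
  transitivity (\sum_(y : Y) \sum_j M0 i j * #|Y|%:R).
    apply: eq_bigr => y _; rewrite sum_cells; apply: eq_bigr => j _.
    rewrite (eq_bigr (fun=> M0 i j)) => [|y' _]; last by rewrite !cell_phi.
    by rewrite sumr_const mulr_natr.
  rewrite sumr_const -(mulr_natr (\sum_j M0 i j * #|Y|%:R)) mulr_suml; apply: eq_bigr => j _.
  by rewrite /Wt -mulrA -expr2.
have W0 i j : 0 <= Wt i j by rewrite mulr_ge0 ?exprn_ge0 //; case/andP: (M01 i j).
have Wle i j : Wt i j <= C2 / #|I|%:R ^+ 2.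
  rewrite /Wt -ler_pdivlMr ?exprn_gt0 //; case/andP: (M01 i j) => _ h; apply: le_trans h _.
  by rewrite card_cells natrM exprMn invfM mulrA.
pose D i := `|g i - a|.
have D0 i : 0 <= D i by exact: normr_ge0.
have e3 i j : a ^+ 2 - (D i + D j) <= g i * g j.
  have /andP[gi0 gi1] := g01 i; have /andP[gj0 gj1] := g01 j; have /andP[a0 a1] := a01.
  have -> : g i * g j = a ^+ 2 + (g i - a) * g j + a * (g j - a) by ring.
  have h1 : - D i <= (g i - a) * g j.
    apply: (@le_trans _ _ (- `|(g i - a) * g j|)); last by have := ler_norm (- ((g i - a) * g j)); rewrite normrN; lra.
    by rewrite lerN2 normrM (ger0_norm gj0) ler_piMr.
  have h2 : - D j <= a * (g j - a).
    apply: (@le_trans _ _ (- `|a * (g j - a)|)); last by have := ler_norm (- (a * (g j - a))); rewrite normrN; lra.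
    by rewrite lerN2 normrM (ger0_norm a0) ler_piMl.
  lra.
pose V := #|I|%:R^-1 * \sum_i D i ^+ 2.
have VE : quad cell_kernel F - quad (@flat_kernel X) F = V.
  by rewrite variance; congr (_ * _); apply: eq_bigr => i _; rewrite real_normK ?num_real.
have e4 : a ^+ 2 * (\sum_i \sum_j Wt i j) - \sum_i \sum_j Wt i j * (D i + D j) <= \sum_i \sum_j Wt i j * (g i * g j).
  rewrite mulr_sumr -sumrB; apply: ler_sum => i _; rewrite mulr_sumr -sumrB; apply: ler_sum => j _.
  by rewrite mulrC -mulrBr ler_wpM2l.
have e5 : \sum_i \sum_j Wt i j * (D i + D j) <= 2 * C2 * (#|I|%:R^-1 * \sum_i D i).
  apply: (@le_trans _ _ (\sum_i \sum_j C2 / #|I|%:R ^+ 2 * (D i + D j))).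
    by apply: ler_sum => i _; apply: ler_sum => j _; rewrite ler_wpM2r // addr_ge0.
  rewrite le_eqVlt; apply/orP; left; apply/eqP.
  under eq_bigr => i _ do rewrite -mulr_sumr big_split /= sumr_const.
  rewrite -mulr_sumr big_split /= sumr_const sumrMnl -(mulr_natl (\sum_i D i)).
  by field.
(* AM-GM, weighted so that multiplication by 2 C2 gives exactly eps + C2^2 / eps times the
   variance. *)
have e6 : #|I|%:R^-1 * \sum_i D i <= eps / (2 * C2) + C2 / (2 * eps) * V.
  have pt i : D i <= eps / (2 * C2) + C2 / (2 * eps) * D i ^+ 2.
    have := sqr_ge0 (eps - C2 * D i) => h.
    have -> : eps / (2 * C2) + C2 / (2 * eps) * D i ^+ 2 = D i + (eps - C2 * D i) ^+ 2 / (2 * C2 * eps).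
      by field; rewrite !gt_eqF.
    by rewrite lerDl divr_ge0 // !mulr_ge0 // ltW.
  apply: (@le_trans _ _ (#|I|%:R^-1 * \sum_i (eps / (2 * C2) + C2 / (2 * eps) * D i ^+ 2))).
    by rewrite ler_wpM2l ?invr_ge0 //; apply: ler_sum.
  rewrite big_split /= sumr_const -mulr_sumr -(mulr_natl (eps / (2 * C2))) mulrDr mulKf //.
  by rewrite mulrCA.
have e7 : 2 * C2 * (#|I|%:R^-1 * \sum_i D i) <= eps + C2 ^+ 2 / eps * V.
  have -> : eps + C2 ^+ 2 / eps * V = 2 * C2 * (eps / (2 * C2) + C2 / (2 * eps) * V).
    by field; rewrite !gt_eqF.
  by rewrite ler_wpM2l // mulr_ge0 // ltW.
rewrite VE quad_flat -/a.
have e8 : c * a ^+ 2 <= a ^+ 2 * (\sum_i \sum_j Wt i j) by rewrite mulrC ler_wpM2l ?sqr_ge0.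
lra.
Qed.

Fixpoint assemble (ii : seq I) (ys : seq Y) : seq X :=
  match ii, ys with i :: ii', y :: ys' => phi i y :: assemble ii' ys' | _, _ => [::] end.

Fixpoint iavg (d : nat) (G : seq I -> R) : R :=
  if d is d'.+1 then #|I|%:R^-1 * \sum_i iavg d' (fun ii => G (i :: ii)) else G [::].

Lemma eq_iavg d G H : G =1 H -> iavg d G = iavg d H.
Proof.
elim: d G H => [|d IH] G H GH /=; first exact: GH.
by congr (_ * _); apply: eq_bigr => i _; apply: IH => ii; apply: GH.
Qed.

Lemma iavg_sum (Z : finType) d (w : Z -> R) (G : Z -> seq I -> R) :
  iavg d (fun ii => \sum_z w z * G z ii) = \sum_z w z * iavg d (G z).
Proof.
elim: d G => [|d IH] G //=.
under eq_bigr => i _ do rewrite IH.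
rewrite exchange_big mulr_sumr /=; apply: eq_bigr => z _.
by rewrite -mulr_sumr mulrCA.
Qed.

Lemma iavg_le d G b : (forall ii, size ii = d -> G ii <= b) -> iavg d G <= b.
Proof.
elim: d G => [|d IH] G H /=; first exact: H.
rewrite ler_pdivrMl // mulrC mulr_natr -sumr_const; apply: ler_sum => i _.
by apply: IH => ii sz; apply: H; rewrite /= sz.
Qed.

(** Both entries of each pair lie in one cell, so the form splits into an average over d-tuples of
    cells; a bound valid on every product of cells therefore passes to the whole. *)
Lemma bform_cell d (f : seq X -> R) :
  bform (fun=> cell_kernel) d f =
  iavg d (fun ii => bform (fun=> @flat_kernel Y) d (fun ys => f (assemble ii ys))).
Proof.
elim: d f => [|d IH] f //=.
under eq_bigr => x _ do under eq_bigr => x' _ do rewrite IH.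
rewrite sum_cell_kernel; congr (_ * _); apply: eq_bigr => i _.
pose G (z : Y * Y) ii := bform (fun=> @flat_kernel Y) d
  (fun ys => f (phi i z.1 :: assemble ii ys) * f (phi i z.2 :: assemble ii ys)).
rewrite pair_bigA /=.
rewrite -(iavg_sum d (fun z : Y * Y => flat_kernel z.1 z.2) G).
by apply: eq_iavg => ii; rewrite pair_bigA.
Qed.

Lemma bform_cell_le d (f : seq X -> R) b :
  (forall ii, size ii = d -> bform (fun=> @flat_kernel Y) d (fun ys => f (assemble ii ys)) <= b) ->
  bform (fun=> cell_kernel) d f <= b.
Proof. by move=> H; rewrite bform_cell; apply: iavg_le. Qed.

End Cells.

(** * Cells made of a residue class inside a cube *)

(* A coordinate x < q * l * w is written x = r + q * (l * c + y) with r < q, c < w and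
   y < l; its cell is the pair (r, c), encoded as i = r + q * c, and its position is y. *)
Definition cell1 (q l x : nat) : nat := (x %% q + q * (x %/ q %/ l))%N.
Definition pos1 (q l x : nat) : nat := (x %/ q %% l)%N.
Definition join1 (q l i y : nat) : nat := (i %% q + q * (l * (i %/ q) + y))%N.

Lemma modnD_mul (q r z : nat) : (r < q)%N -> ((r + q * z) %% q = r)%N.
Proof. by move=> rq; rewrite addnC mulnC modnMDl modn_small. Qed.

Lemma divnD_mul (q r z : nat) : (r < q)%N -> ((r + q * z) %/ q = z)%N.
Proof.
move=> rq; have q0 : (0 < q)%N by apply: leq_ltn_trans rq.
by rewrite addnC mulnC divnMDl // divn_small // addn0.
Qed.

Lemma join1_cell1 q l x : (0 < q)%N -> join1 q l (cell1 q l x) (pos1 q l x) = x.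
Proof.
move=> q0; rewrite /join1 /cell1 /pos1 modnD_mul ?ltn_mod // divnD_mul ?ltn_mod //.
by rewrite [(l * _)%N]mulnC -divn_eq addnC mulnC -divn_eq.
Qed.

Lemma cell1_join1 q l i y : (0 < q)%N -> (y < l)%N -> cell1 q l (join1 q l i y) = i.
Proof.
move=> q0 yl; rewrite /join1 /cell1 modnD_mul ?ltn_mod // divnD_mul ?ltn_mod //.
by rewrite addnC [(l * _ + _)%N]addnC divnD_mul // mulnC -divn_eq.
Qed.

Lemma pos1_join1 q l i y : (0 < q)%N -> (y < l)%N -> pos1 q l (join1 q l i y) = y.
Proof.
move=> q0 yl; rewrite /join1 /pos1 divnD_mul ?ltn_mod //.
by rewrite [(l * _ + _)%N]addnC modnD_mul.
Qed.

Lemma cell1_lt q l w x : (0 < q)%N -> (x < q * l * w)%N -> (cell1 q l x < q * w)%N.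
Proof.
move=> q0 h; have r := ltn_pmod x q0; have l0 : (0 < l)%N by case: l h => //; rewrite muln0.
have c : (x %/ q %/ l < w)%N by rewrite !ltn_divLR // (_ : (w * l * q = q * l * w)%N) //; ring.
have : (q * (x %/ q %/ l) + q <= q * w)%N by rewrite -mulnSr leq_mul2l c orbT.
by rewrite /cell1; lia.
Qed.

Lemma join1_lt q l w i y : (0 < q)%N -> (i < q * w)%N -> (y < l)%N -> (join1 q l i y < q * l * w)%N.
Proof.
move=> q0 iw yl; have r := ltn_pmod i q0.
have c : (i %/ q < w)%N by rewrite ltn_divLR // mulnC.
have h1 : (l * (i %/ q) + l <= l * w)%N by rewrite -mulnSr leq_mul2l c orbT.
have : (q * (l * (i %/ q) + y) + q <= q * (l * w))%N by rewrite -mulnSr leq_mul2l; apply/orP; right; lia.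
by rewrite /join1 mulnA; lia.
Qed.

Lemma join1E q l i y : join1 q l i y = (join1 q l i 0 + q * y)%N.
Proof. by rewrite /join1; ring. Qed.

Section BoxCells.
Variables (q l w : nat).
Hypotheses (q0 : (0 < q)%N) (l0 : (0 < l)%N).

Definition cell_ord (x : 'I_(q * l * w)) : 'I_(q * w) := Ordinal (cell1_lt q0 (ltn_ord x)).
Lemma pos1_lt x : (pos1 q l x < l)%N. Proof. by rewrite ltn_mod. Qed.
Definition pos_ord (x : 'I_(q * l * w)) : 'I_l := Ordinal (pos1_lt x).
Definition join_ord (i : 'I_(q * w)) (y : 'I_l) : 'I_(q * l * w) :=
  Ordinal (join1_lt q0 (ltn_ord i) (ltn_ord y)).

Definition box_cell (x : box (q * l * w)) : box (q * w) :=
  (cell_ord x.1.1.1, cell_ord x.1.1.2, (cell_ord x.1.2.1, cell_ord x.1.2.2), cell_ord x.2).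
Definition box_pos (x : box (q * l * w)) : box l :=
  (pos_ord x.1.1.1, pos_ord x.1.1.2, (pos_ord x.1.2.1, pos_ord x.1.2.2), pos_ord x.2).
Definition box_join (i : box (q * w)) (y : box l) : box (q * l * w) :=
  (join_ord i.1.1.1 y.1.1.1, join_ord i.1.1.2 y.1.1.2,
   (join_ord i.1.2.1 y.1.2.1, join_ord i.1.2.2 y.1.2.2), join_ord i.2 y.2).

Lemma box_joinK x : box_join (box_cell x) (box_pos x) = x.
Proof.
case: x => [[[a b] [c d]] e]; rewrite /box_join /=.
by congr (_, _, (_, _), _); apply: val_inj; rewrite /= join1_cell1.
Qed.

Lemma box_cell_join i y : box_cell (box_join i y) = i.
Proof.
case: i y => [[[a b] [c d]] e] [[[a' b'] [c' d']] e']; rewrite /box_cell /=.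
by congr (_, _, (_, _), _); apply: val_inj; rewrite /= cell1_join1.
Qed.

Lemma box_pos_join i y : box_pos (box_join i y) = y.
Proof.
case: i y => [[[a b] [c d]] e] [[[a' b'] [c' d']] e']; rewrite /box_pos /=.
by congr (_, _, (_, _), _); apply: val_inj; rewrite /= pos1_join1.
Qed.

Definition corner (i : nat) : nat := join1 q l i 0.

Definition dsq_corner (i j : box (q * w)) : int :=
  dsq1 (corner i.1.1.1) (corner j.1.1.1) + dsq1 (corner i.1.1.2) (corner j.1.1.2) +
  (dsq1 (corner i.1.2.1) (corner j.1.2.1) + dsq1 (corner i.1.2.2) (corner j.1.2.2)) +
  dsq1 (corner i.2) (corner j.2).

(** Within a cell, points move by multiples of q. Rounding to corners therefore keeps the residue of
    the squared distance modulo q and changes its size only by order q l L. *)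
Lemma dsq1_corner (a b : 'I_(q * l * w)) : exists e : int,
  dsq1 a b = dsq1 (corner (cell_ord a)) (corner (cell_ord b)) + q%:Z * e /\
  (`|e| <= 2 * (l * (q * l * w)))%N.
Proof.
have aE : a = (corner (cell_ord a) + q * pos_ord a)%N :> nat by rewrite -join1E /= join1_cell1.
have bE : b = (corner (cell_ord b) + q * pos_ord b)%N :> nat by rewrite -join1E /= join1_cell1.
have := ltn_ord a; have := ltn_ord b; have := ltn_ord (pos_ord a); have := ltn_ord (pos_ord b).
rewrite /dsq1; move: (corner (cell_ord a)) (corner (cell_ord b)) (nat_of_ord (pos_ord a)) (nat_of_ord (pos_ord b)) aE bE.
move=> ra rb y z; move: (nat_of_ord a) (nat_of_ord b) => A B; move: (q * l * w)%N => L -> -> zl yl bL aL.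
exists ((z%:Z - y%:Z) * ((rb + q * z)%N%:Z - (ra + q * y)%N%:Z + (rb%:Z - ra%:Z))); split.
  by rewrite !PoszD !PoszM; ring.
rewrite abszM mulnCA leq_mul //; first by lia.
have : (ra <= ra + q * y)%N by apply: leq_addr.
have : (rb <= rb + q * z)%N by apply: leq_addr.
by move: (ra + q * y)%N (rb + q * z)%N bL aL => A' B'; lia.
Qed.

Lemma dsq_cell (x x' : box (q * l * w)) : exists e : int,
  dsq x x' = dsq_corner (box_cell x) (box_cell x') + q%:Z * e /\
  (`|e| <= 10 * (l * (q * l * w)))%N.
Proof.
have [e1 [h1 k1]] := dsq1_corner x.1.1.1 x'.1.1.1; have [e2 [h2 k2]] := dsq1_corner x.1.1.2 x'.1.1.2.
have [e3 [h3 k3]] := dsq1_corner x.1.2.1 x'.1.2.1; have [e4 [h4 k4]] := dsq1_corner x.1.2.2 x'.1.2.2.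
have [e5 [h5 k5]] := dsq1_corner x.2 x'.2.
exists (e1 + e2 + (e3 + e4) + e5); split.
  by rewrite /dsq h1 h2 h3 h4 h5 /dsq_corner /box_cell /=; ring.
by move: (l * _)%N k1 k2 k3 k4 k5 {h1 h2 h3 h4 h5} => Z; lia.
Qed.

End BoxCells.

(** Three nested shells: a quarter shell for points lies in a half shell for corners, which lies in
    the full shell for points. *)
Lemma absz_near (n n0 e : int) (q E K : nat) : n = n0 + q%:Z * e -> (`|e| <= E)%N -> (40 * E <= 10 * K)%N ->
  ((2 * `|n0| <= K * q)%N -> (`|n| <= K * q)%N) /\ ((4 * `|n| <= K * q)%N -> (2 * `|n0| <= K * q)%N).
Proof.
move=> -> he hE.
have h : (`|(q%:Z * e)%R| <= q * E)%N by rewrite abszM absz_nat leq_mul2l he orbT.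
have h2 : (4 * (q * E) <= K * q)%N.
  have -> : (4 * (q * E) = (4 * E) * q)%N by ring.
  by rewrite leq_mul2r; apply/orP; right; lia.
by move: (q%:Z * e) (K * q)%N (q * E)%N h h2 => u v z; split; lia.
Qed.

(** * Parameters and the majorised kernel *)

Lemma leq_of_sqr (a m N : nat) : (a * a <= m)%N -> (m < N.+1 * N.+1)%N -> (a <= N)%N.
Proof.
move=> h1 h2; rewrite -ltnS ltnNge; apply/negP => h; have := leq_mul h h.
by rewrite leqNgt (leq_ltn_trans h1 h2).
Qed.

Lemma leq_of_sqr_mul (L rho m N : nat) : (0 < rho)%N -> (0 < N)%N -> (L * L <= rho * m)%N ->
  (m < N.+1 * N.+1)%N -> (L <= 2 * rho * N)%N.
Proof.
move=> r0 N0 h1 h2; rewrite leqNgt; apply/negP => h.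
have h3 : (2 * rho * N * (2 * rho * N) < L * L)%N by apply: ltn_mul.
have h4 : (N.+1 * N.+1 <= (2 * N) * (2 * N))%N by apply: leq_mul; lia.
have h5 : (rho * m < rho * ((2 * N) * (2 * N)))%N by rewrite ltn_pmul2l // (leq_trans h2).
have h6 : (rho * ((2 * N) * (2 * N)) <= rho * (rho * ((2 * N) * (2 * N))))%N by rewrite leq_mul2l leq_pmull ?orbT.
have h7 : (2 * rho * N * (2 * rho * N) = rho * (rho * ((2 * N) * (2 * N))))%N by ring.
by rewrite h7 in h3; lia.
Qed.

Lemma six_mul_leq (L m N : nat) : (36 * m <= L * L)%N -> (N * N <= m)%N -> (6 * N <= L)%N.
Proof.
move=> h1 h2; rewrite leqNgt; apply/negP => h.
have h3 : (L * L < 6 * N * (6 * N))%N by apply: ltn_mul.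
have h4 : (6 * N * (6 * N) = 36 * (N * N))%N by ring.
by rewrite h4 in h3; lia.
Qed.

Lemma leq_of_mul_sqr (X m N : nat) : (0 < N)%N -> (32 * N * X <= m)%N -> (m < N.+1 * N.+1)%N -> (X <= N)%N.
Proof.
move=> N0 h1 h2; rewrite leqNgt; apply/negP => h.
have h3 : (32 * N * N.+1 <= 32 * N * X)%N by rewrite leq_mul2l h orbT.
have h4 : (N.+1 * N.+1 <= 32 * N * N.+1)%N by rewrite leq_mul2r; apply/orP; right; lia.
by have := leq_ltn_trans (leq_trans h4 (leq_trans h3 h1)) h2; rewrite ltnn.
Qed.

Lemma large_modulus_bounds (u v N K : nat) : (0 < N)%N -> ((97 + 80 * u) * N <= K.+1)%N ->
  (v <= 2 * u * N)%N -> [/\ (96 * N <= K)%N, (40 * (10 * v) <= 10 * K)%N & (0 < K)%N].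
Proof.
move=> N0; rewrite mulnDl -!mulnA; move: (u * N)%N => z h1 h2; split; lia.
Qed.

Lemma quotient_bound (N q w : nat) : (1 <= w)%N -> (N < w.+1 * q)%N -> (N <= 2 * q * w)%N.
Proof.
case: w => // w _ h; apply: ltnW; apply: leq_trans h _.
have -> : (2 * q * w.+1 = (2 * w.+1) * q)%N by ring.
by rewrite leq_mul2r; apply/orP; right; lia.
Qed.

Section Package.
Variable R : realType.

(** Up to constants and rho the product is m / (L^10 K) times N^5 (N/q)^4 (K/N) q^4, with m of order
    N^2 and L^2 at most rho m. Both q and K cancel, so the bound rests on rho alone. *)
Lemma mass_lower : exists E : R, 0 < E /\ forall rho N m L K q w1 B : nat,
  (0 < rho)%N -> (0 < N)%N -> (N * N <= m)%N ->
  (m < N.+1 * N.+1)%N -> (L * L <= rho * m)%N -> (0 < L)%N -> (0 < q)%N -> (0 < K)%N ->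
  (N <= 16 * q * w1)%N -> (K <= 64 * N * B)%N ->
  (E * rho%:R ^+ 5)^-1 <= m%:R / (L%:R ^+ 10 * (2 * K).+1%:R) *
    ((3 * N)%:R ^+ 5 * (w1%:R ^+ 4 * (B%:R * (q%:R ^+ 4 / 4)))) :> R.
Proof.
have [D DE] : exists D : R, D = 4 * 64 * 16 ^+ 4 by eexists.
have D0 : 0 < D by rewrite DE !mulr_gt0 // exprn_gt0.
have [E EE] : exists E : R, E = 3 * 4 ^+ 5 * D by eexists.
have E0 : 0 < E by rewrite EE !mulr_gt0 // exprn_gt0.
exists E; split=> // rho N m L K q w1 B r0 N0 Nm mN LL L0 q0 K0 hw hB.
have mR : N%:R ^+ 2 <= m%:R :> R by rewrite -natrX ler_nat -mulnn.
have m4 : m%:R <= 4 * N%:R ^+ 2 :> R.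
  by rewrite -natrX -natrM ler_nat -mulnn; nia.
have Lm : L%:R ^+ 2 <= rho%:R * m%:R :> R by rewrite -natrX -natrM ler_nat -mulnn.
have NqR : N%:R <= 16 * q%:R * w1%:R :> R by rewrite -!natrM ler_nat.
have KB : K%:R <= 64 * N%:R * B%:R :> R by rewrite -!natrM ler_nat.
have K3 : (2 * K).+1%:R <= 3 * K%:R :> R by rewrite -natrM ler_nat; lia.
have J0 : 0 < (2 * K).+1%:R :> R by rewrite ltr0n.
have N3 : N%:R <= (3 * N)%:R :> R by rewrite ler_nat leq_pmull.
have rR : 0 < rho%:R :> R by rewrite ltr0n.
have NR : 0 < N%:R :> R by rewrite ltr0n.
have LR : 0 < L%:R :> R by rewrite ltr0n.
have KR : 0 < K%:R :> R by rewrite ltr0n.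
have B0 : 0 <= B%:R :> R by [].
have w0 : 0 <= w1%:R :> R by [].
have qR : 0 <= q%:R :> R by [].
have m0 : 0 <= m%:R :> R by [].
move: (rho%:R : R) (N%:R : R) (m%:R : R) (L%:R : R) (q%:R : R) (w1%:R : R) (B%:R : R) ((3 * N)%:R : R)
  ((2 * K).+1%:R : R) (K%:R : R) mR m4 Lm NqR KB K3 J0 N3 rR NR LR KR B0 w0 qR m0.
clear - DE D0 EE E0; move=> r n m l q w b n3 j k mR m4 Lm NqR KB K3 J0 N3 rR NR LR KR B0 w0 qR m0.
have L2 : l ^+ 2 <= r * (4 * n ^+ 2) by apply: le_trans Lm _; apply: ler_wpM2l => //; exact: ltW.
have n20 : 0 <= 4 * n ^+ 2 by apply: mulr_ge0 => //; apply: sqr_ge0.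
have L10 : l ^+ 10 <= (r * (4 * n ^+ 2)) ^+ 5.
  rewrite (exprM l 2 5); apply: lerXn2r L2; rewrite nnegrE ?sqr_ge0 //.
  by apply: mulr_ge0 => //; exact: ltW.
have w4 : n ^+ 4 <= (16 * q * w) ^+ 4.
  by apply: lerXn2r NqR; rewrite nnegrE ?(ltW NR) // !mulr_ge0.
pose Z := w ^+ 4 * (b * (q ^+ 4 / 4)).
have Z0 : 0 <= Z by rewrite /Z !mulr_ge0 ?exprn_ge0 // invr_ge0.
have ZE : n ^+ 3 * k <= D * Z.
  rewrite -(ler_pM2l NR) mulrA -exprS.
  apply: (@le_trans _ _ ((16 * q * w) ^+ 4 * (64 * n * b))).
    by apply: ler_pM => //; [apply: exprn_ge0; exact: ltW|exact: ltW].
  by rewrite le_eqVlt; apply/orP; left; apply/eqP; rewrite DE /Z; field.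
rewrite -/Z [leRHS]mulrAC ler_pdivlMr; last by rewrite mulr_gt0 ?exprn_gt0.
rewrite [leLHS]mulrC ler_pdivrMr; last by rewrite mulr_gt0 ?exprn_gt0.
apply: (@le_trans _ _ ((r * (4 * n ^+ 2)) ^+ 5 * (3 * k))).
  by apply: ler_pM => //; [apply: exprn_ge0; exact: ltW|exact: ltW].
have -> : (r * (4 * n ^+ 2)) ^+ 5 * (3 * k) = 3 * 4 ^+ 5 * r ^+ 5 * n ^+ 7 * (n ^+ 3 * k) by ring.
have c0 : 0 <= 3 * 4 ^+ 5 * r ^+ 5 * n ^+ 7.
  by rewrite !mulr_ge0 ?exprn_ge0 // ltW.
apply: (@le_trans _ _ (3 * 4 ^+ 5 * r ^+ 5 * n ^+ 7 * (D * Z))); first exact: ler_wpM2l.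
have -> : 3 * 4 ^+ 5 * r ^+ 5 * n ^+ 7 * (D * Z) = (n ^+ 2 * (n ^+ 5 * Z)) * (E * r ^+ 5).
  by rewrite EE; ring.
apply: ler_wpM2r; first by rewrite mulr_ge0 ?exprn_ge0 // ltW.
have n0 := ltW NR; have n30 := le_trans n0 N3.
apply: ler_pM => //; first exact: sqr_ge0.
  by apply: mulr_ge0 => //; apply: exprn_ge0.
by apply: ler_wpM2r => //; apply: lerXn2r N3.
Qed.

End Package.

(** The quantifiers carry the content: c and C1 depend on rho only, q and C2 also on eps, and the
    side l of the cells is arbitrary, provided that m is large in terms of it. *)
Lemma analytic_package (R : realType) (rho : nat) : (0 < rho)%N -> exists c C1 : R, [/\ 0 < c, 1 <= C1 &
  forall eps : R, 0 < eps -> exists q (C2 : R), exists q0 : (0 < q)%N, 0 < C2 /\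
  forall (l : nat) (l0 : (0 < l)%N), exists m0 : nat, forall w m (L := (q * l * w)%N),
    (m0 <= m)%N -> (q %| m)%N -> (36 * m <= L * L)%N -> (L * L <= rho * m)%N ->
  exists M : box L -> box L -> R,
    [/\ mass (@Tker R L m) <= C1, mass M <= C1 + eps,
      forall F, unit_valued F -> - eps <= quad (fun x x' => Tker R m x x' - M x x') F,
      forall x x', 0 <= M x x' <= C2 * flat_kernel R x x' &
      forall F, unit_valued F -> - eps <= quad M F - c * quad (@flat_kernel R (box L)) F +
        C2 ^+ 2 / eps * (quad (@cell_kernel R (box L) (box (q * w)) (box l) (@box_cell q l w q0)) F -
          quad (@flat_kernel R (box L)) F)]].
Proof.
move=> r0; have [W W1 weyl] := weyl_bound_exists R.
have [E [E0 massE]] := mass_lower R.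
exists (E * rho%:R ^+ 5)^-1, (96 * W ^+ 3); split.
- by rewrite invr_gt0 mulr_gt0 ?exprn_gt0 // ltr0n.
- have : 1 <= W ^+ 3 by rewrite exprn_ege1.
  lra.
move=> eps eps0; have [eta' [q' [eta0' q'0 approx]]] := circle_approx W1 weyl eps0.
(* The cap at 1 gives K q <= m. Below, the factor 4 of q is that of [card_isotropic], and C2 = q /
   eta comes from K + 1 > eta m / q. *)
pose eta := Num.min eta' 1; have eta0 : 0 < eta by rewrite lt_min eta0' /=.
have eta1 : eta <= 1 by rewrite ge_min lexx orbT.
have etale : eta <= eta' by rewrite ge_min lexx.
pose q := (4 * q')%N; have q0 : (0 < q)%N by rewrite muln_gt0.
pose C2 : R := q%:R / eta.
have qR : 0 < q%:R :> R by rewrite ltr0n.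
exists q, C2, q0; split; first by rewrite divr_gt0.
move=> l l0.
(* The lower bound on m makes K (about eta m / q) exceed all the O(sqrt m) quantities. *)
pose T0 : nat := (Num.truncn eta^-1).+1.
pose n0 : nat := (2 * q + (97 + 80 * (l * rho)) * (2 * q * T0))%N.
exists (n0 * n0)%N => w m L mbig qm Lge Lle.
have [N /andP[Nm mN]] := isqrt_exists m.
have nN : (n0 <= N)%N by apply: leq_of_sqr mbig mN.
pose K := Num.truncn (eta * m%:R / q%:R).
have x0 : 0 <= eta * m%:R / q%:R by rewrite divr_ge0 ?mulr_ge0 // ltW.
have /andP[K1 K2] := truncn_itv x0; rewrite -/K in K1 K2.
have T0pos : (0 < T0)%N by [].
have n0pos : (0 < n0)%N by rewrite /n0 addn_gt0 muln_gt0 q0.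
have N0 : (0 < N)%N by apply: leq_trans nN.
have mpos : (0 < m)%N by apply: leq_trans Nm; rewrite muln_gt0 N0.
have L0 : (0 < L)%N.
  by rewrite lt0n; apply/eqP => e; move: Lge; rewrite e muln0 leqn0 muln_eq0 /= -leqn0 leqNgt mpos.
have Kbig : ((97 + 80 * (l * rho)) * N <= K.+1)%N.
  have T1 : eta^-1 <= T0%:R by apply/ltW/truncnS_gt.
  rewrite -(ler_nat R); apply: le_trans (ltW K2).
  rewrite ler_pdivlMr // -[eta * _]mulrC -ler_pdivrMr // -natrM.
  apply: (@le_trans _ _ (((97 + 80 * (l * rho)) * N * q)%:R * T0%:R)).
    by rewrite ler_wpM2l.
  rewrite -natrM ler_nat; apply: leq_trans Nm; rewrite /n0 in nN.
  have -> : ((97 + 80 * (l * rho)) * N * q * T0 = ((97 + 80 * (l * rho)) * (q * T0)) * N)%N by ring.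
  rewrite leq_mul2r; apply/orP; right; apply: leq_trans nN.
  by apply: leq_trans (leq_addl _ _); rewrite leq_mul2l -mulnA leq_pmull ?orbT.
have LN : (L <= 2 * rho * N)%N by apply: leq_of_sqr_mul Lle mN.
have lL : (l * L <= 2 * (l * rho) * N)%N.
  by apply: leq_trans (leq_mul (leqnn l) LN) _; apply: eq_leq; ring.
have [K96 K40 K0] := large_modulus_bounds N0 Kbig lL.
have Kq : (K * q)%:R <= eta * m%:R :> R by rewrite natrM -ler_pdivlMr.
have Kqm : (K * q <= m)%N by rewrite -(ler_nat R); apply: le_trans Kq _; rewrite ler_piMl.
have Kq' : (K * q)%:R <= eta' * m%:R :> R by apply: le_trans Kq _; rewrite ler_wpM2r.
have mL : (m <= L ^ 2)%N by rewrite -mulnn; apply: leq_trans Lge; rewrite leq_pmull.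
have LR : 0 < L%:R :> R by rewrite ltr0n.
have JR : 0 < (2 * K).+1%:R :> R by rewrite ltr0n.
pose V : R := m%:R / (L%:R ^+ 10 * (2 * K).+1%:R).
have V0 : 0 <= V by rewrite divr_ge0 // mulr_ge0 // exprn_ge0 // ltW.
have cardR : #|box L|%:R ^+ 2 = L%:R ^+ 10 :> R by rewrite card_box natrX -exprM.
have C20 : 0 < C2 by rewrite divr_gt0.
have VC : V <= C2 / L%:R ^+ 10.
  have mJ : m%:R <= C2 * (2 * K).+1%:R.
    have -> : m%:R = C2 * (eta * m%:R / q%:R) by rewrite /C2; field; rewrite !gt_eqF.
    apply: ler_wpM2l; first exact: ltW.
    by apply: le_trans (ltW K2) _; rewrite ler_nat ltnS leq_pmull.
  have L10 : 0 < L%:R ^+ 10 :> R by rewrite exprn_gt0.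
  rewrite /V ler_pdivrMr; last exact: mulr_gt0.
  by rewrite mulrA divfK // gt_eqF.
have one01 : unit_valued (fun _ : box L => 1 : R) by move=> x; rewrite ler01 lexx.
have T01 := circle_mass W1 weyl L0 mL one01.
have q'q : (q' %| q)%N by rewrite dvdn_mull.
have app (F : box L -> R) : unit_valued F -> `|quad (fun x x' => Tker R m x x' - Mker R m q K x x') F| <= eps.
  exact: (@approx q L m K F q'q q0 L0 mL Kq').
(* The model at cell corners on a shell of half the width: constant on cells, below M, and still
   large enough for the pairs counted by [shell_pairs]. *)
pose M0 (i j : box (q * w)) : R := V *
  ((q%:Z %| dsq_corner l i j - m%:Z)%Z && (2 * `|dsq_corner l i j - m%:Z| <= K * q)%N)%:R.
have near (x x' : box L) :
   let n := dsq x x' - m%:Z in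
   let n1 := dsq_corner l (box_cell q0 x) (box_cell q0 x') - m%:Z in
   [/\ (q%:Z %| n)%Z = (q%:Z %| n1)%Z, (2 * `|n1| <= K * q)%N -> (`|n| <= K * q)%N &
     (4 * `|n| <= K * q)%N -> (2 * `|n1| <= K * q)%N].
  move=> n n1; have [e [he1 he2]] := dsq_cell q0 l0 x x'.
  have nE : n = n1 + q%:Z * e by rewrite /n he1 addrAC.
  have [h1 h2] := absz_near nE he2 K40; split => //.
  by rewrite nE rpredDr // dvdz_mulr.
exists (Mker R m q K); split.
- by rewrite massE_quad; apply: le_trans (ler_norm _) T01.
- have := app _ one01; rewrite quad_sub -!massE_quad ler_norml => /andP[h2 _].
  have : mass (@Tker R L m) <= 96 * W ^+ 3 by rewrite massE_quad; apply: le_trans (ler_norm _) T01.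
  lra.
- by move=> F F01; have := app F F01; rewrite ler_norml => /andP[].
- move=> x x'; rewrite /Mker -/V mulr_ge0 //= /flat_kernel cardR.
  by apply: le_trans VC; rewrite ler_piMr // lern1; case: (_ && _).
move=> F F01.
apply: (@quad_cell_lower R (box L) (box (q * w)) (box l) (box_cell q0) (@box_pos q l w l0)
   (box_join q0 (l := l)) (box_joinK q0 l0) (box_cell_join q0 (l := l)) (box_pos_join q0 l0) _ _ _ M0) => //.
- rewrite card_box expn_gt0 muln_gt0 q0; apply/orP; left.
  by move: L0; rewrite /L muln_gt0 => /andP[].
- by rewrite card_box expn_gt0 l0.
- move=> i j; rewrite /M0 mulr_ge0 //= cardR.
  by apply: le_trans VC; rewrite ler_piMr // lern1; case: (_ && _).
- move=> x x'; rewrite /M0 /Mker -/V ler_wpM2l //.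
  have [e1 h1 _] := near x x'; rewrite /= in e1 h1; rewrite e1.
  by case: (_ %| _)%Z => //=; case: leqP => //= h; rewrite h1.
(* Both quotients are at least 1, so rounding down loses at most a factor 2; this gives the 16 and
   64 of [mass_lower]. *)
pose w1 := (N %/ (2 * q))%N; pose B := (K %/ (32 * N))%N.
have w1a : (2 * (q * w1) <= N)%N by rewrite mulnA mulnC leq_divM.
have w1b : (N <= 16 * q' * w1)%N.
  have h1 : (1 <= w1)%N by rewrite divn_gt0 ?muln_gt0 //; apply: leq_trans nN; rewrite /n0 leq_addr.
  have h2 : (N < w1.+1 * (2 * q))%N by rewrite ltn_ceil // muln_gt0.
  by apply: leq_trans (quotient_bound h1 h2) _; apply: eq_leq; rewrite /q; ring.
have Ba : (32 * N * B <= K)%N by rewrite mulnC leq_divM.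
have Bb : (K <= 64 * N * B)%N.
  have h1 : (1 <= B)%N by rewrite divn_gt0 ?muln_gt0 //; apply: leq_trans K96; rewrite leq_mul2r orbT.
  have h2 : (K < B.+1 * (32 * N))%N by rewrite ltn_ceil // muln_gt0.
  by apply: leq_trans (quotient_bound h1 h2) _; apply: eq_leq; ring.
have qB : (q * B <= N)%N.
  have h1 : (32 * N * (q * B) <= m)%N.
    by apply: leq_trans Kqm; rewrite mulnCA mulnC leq_mul2r Ba orbT.
  exact: leq_of_mul_sqr N0 h1 mN.
have NL : (6 * N <= L)%N by apply: six_mul_leq Lge Nm.
have sp := @shell_pairs R q' m N L K w1 B q'0 Nm mN NL qm w1a Ba K96 qB N0.
apply: le_trans (massE _ _ _ _ _ _ _ _ r0 N0 Nm mN Lle L0 q'0 K0 w1b Bb) _.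
rewrite -/V; apply: le_trans (ler_wpM2l V0 sp) _.
rewrite mulr_sumr; apply: ler_sum => x _; rewrite mulr_sumr; apply: ler_sum => x' _.
rewrite /M0 ler_wpM2l //; have [e1 _ h1] := near x x'; rewrite /= in e1 h1.
rewrite -/q e1; case: (_ %| _)%Z => //=; case: leqP => //= h; by rewrite h1.
Qed.

(** * Configurations of points and their dilates *)

Definition Z5 : zmodType := (int * int * (int * int) * int)%type.

Definition norm5 (p : Z5) : int :=
  p.1.1.1 ^+ 2 + p.1.1.2 ^+ 2 + (p.1.2.1 ^+ 2 + p.1.2.2 ^+ 2) + p.2 ^+ 2.

Definition pt (L : nat) (x : box L) : Z5 :=
  (Posz x.1.1.1, Posz x.1.1.2, (Posz x.1.2.1, Posz x.1.2.2), Posz x.2).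

Lemma dsq_pt L (x x' : box L) : dsq x x' = norm5 (pt x' - pt x).
Proof. by []. Qed.

(* The first pair of a configuration corresponds to the last index d - 1. *)
Fixpoint config (N : nat -> nat) (d : nat) (A : seq Z5 -> bool) : Prop :=
  if d is d'.+1 then
    exists p p' : Z5, norm5 (p' - p) = (N d')%:Z /\ config N d' (fun s => A (p :: s) && A (p' :: s))
  else A [::].

(** Puts a tuple into a product of cells: one corner for each coordinate, common step q. *)
Fixpoint dilate (q : nat) (a : seq Z5) (s : seq Z5) : seq Z5 :=
  match a, s with b :: a', p :: s' => (b + p *+ q) :: dilate q a' s' | _, _ => [::] end.

Lemma eq_config_dist N N' d A : (forall k, (k < d)%N -> N k = N' k) -> config N d A -> config N' d A.
Proof.
elim: d A => [|d IH] A NN' //= [p [p' [h c]]]; exists p, p'; split; first by rewrite h NN'.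
by apply: IH c => k kd; apply: NN'; apply: ltnW.
Qed.

Lemma norm5_dilate (b p p' : Z5) q : norm5 (b + p' *+ q - (b + p *+ q)) = (q ^ 2)%N%:Z * norm5 (p' - p).
Proof.
have -> : b + p' *+ q - (b + p *+ q) = (p' - p) *+ q by rewrite opprD addrACA subrr add0r mulrnBl.
case: (p' - p) => [[[a1 a2] [a3 a4]] a5].
have mulE (z : int) : z *+ q = z * q%:Z by rewrite -mulr_natr natz.
have -> : (a1, a2, (a3, a4), a5) *+ q = (a1 * q%:Z, a2 * q%:Z, (a3 * q%:Z, a4 * q%:Z), a5 * q%:Z) :> Z5.
  by rewrite -!mulE; elim: q {mulE} => [|n IH]; rewrite ?mulr0n // !mulrS IH.
by rewrite /norm5 /= -mulnn PoszM; ring.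
Qed.

Lemma config_dilate N d A q a : size a = d ->
  config N d (fun s => A (dilate q a s)) -> config (fun k => (q ^ 2 * N k)%N) d A.
Proof.
elim: d A a => [|d IH] A [|b a] //= [sz] [p [p' [h c]]].
exists (b + p *+ q), (b + p' *+ q); split; first by rewrite norm5_dilate h PoszM.
exact: (IH (fun s => A (b + p *+ q :: s) && A (b + p' *+ q :: s)) a).
Qed.

Lemma pt_join q l w (q0 : (0 < q)%N) (i : box (q * w)) (y : box l) :
  pt (box_join q0 i y) =
  (Posz (corner q l i.1.1.1), Posz (corner q l i.1.1.2),
    (Posz (corner q l i.1.2.1), Posz (corner q l i.1.2.2)), Posz (corner q l i.2)) + pt y *+ q :> Z5.
Proof.
have mulE (z : nat) : Posz z *+ q = Posz (q * z)%N by rewrite -mulr_natr natz mulrC PoszM.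
case: y => [[[a1 a2] [a3 a4]] a5].
have -> : pt ((a1, a2, (a3, a4), a5) : box l) *+ q =
   (Posz (q * a1), Posz (q * a2), (Posz (q * a3), Posz (q * a4)), Posz (q * a5)) :> Z5.
  rewrite -!mulE /pt /=; elim: q {q0 i mulE} => [|n IH]; first by rewrite !mulr0n.
  by rewrite !mulrS IH.
rewrite /pt /box_join /join_ord /=.
rewrite (join1E q l i.1.1.1) (join1E q l i.1.1.2) (join1E q l i.1.2.1) (join1E q l i.1.2.2) (join1E q l i.2).
by rewrite !PoszD.
Qed.

Lemma map_pt_assemble q l w (q0 : (0 < q)%N) (ii : seq (box (q * w))) (ys : seq (box l)) :
  map (@pt _) (assemble (box_join q0 (l := l)) ii ys) =
  dilate q (map (fun i : box (q * w) => (Posz (corner q l i.1.1.1), Posz (corner q l i.1.1.2),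
    (Posz (corner q l i.1.2.1), Posz (corner q l i.1.2.2)), Posz (corner q l i.2)) : Z5) ii)
   (map (@pt l) ys).
Proof. by elim: ii ys => [|i ii IH] [|y ys] //=; rewrite IH pt_join. Qed.

Lemma card_box_gt0 l : (0 < l)%N -> (0 < #|box l|)%N.
Proof. by move=> l0; rewrite card_box expn_gt0 l0. Qed.

(** The squared side must be at least 36 times each distance mu n_k with n_k <= NB. Rounding the
    root up to a multiple of q l at most doubles it, hence 144 = 4 * 36. *)
Lemma scale_choice (q l NB mu : nat) (u := (q * l)%N) : (0 < u)%N -> (0 < NB)%N -> (u * u <= mu)%N ->
  exists w, (36 * (NB * mu) <= (q * l * w) * (q * l * w))%N /\ ((q * l * w) * (q * l * w) <= 144 * NB * mu)%N.
Proof.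
move=> u0 NB0 hmu; have [t /andP[t1 t2]] := isqrt_exists (36 * (NB * mu)).
exists (t %/ u).+1; rewrite -/u.
have h1 : (t < u * (t %/ u).+1)%N by rewrite mulnC ltn_ceil.
have ut : (u <= t)%N.
  rewrite -ltnS ltnNge; apply/negP => h; have h3 := leq_mul h h.
  have : (mu <= NB * mu)%N by rewrite leq_pmull.
  by move: (NB * mu)%N t2 h3 hmu => X; lia.
have h2 : (u * (t %/ u).+1 <= 2 * t)%N by rewrite mulnS mulnC; have := leq_divM t u; lia.
move: (u * (t %/ u).+1)%N h1 h2 => L h1 h2; split.
  by apply: leq_trans (ltnW t2) _; apply: leq_mul.
apply: leq_trans (leq_mul h2 h2) _.
have -> : (2 * t * (2 * t) = 4 * (t * t))%N by ring.
have -> : (144 * NB * mu = 4 * (36 * (NB * mu)))%N by ring.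
by rewrite leq_mul2l t1 orbT.
Qed.

(** * Energy increment and iteration *)

Section Induction.
Variable R : realType.

Definition ind (L : nat) (A : seq Z5 -> bool) (s : seq (box L)) : R := (A (map (@pt L) s))%:R.

Lemma ind01 L A : unit_valued (@ind L A).
Proof. by move=> s; rewrite /ind ler0n lern1; case: (A _). Qed.

(** A nonzero term of the form would exhibit a configuration. *)
Lemma bform_no_config L (T : nat -> box L -> box L -> R) N d A :
  (forall k x x', (k < d)%N -> T k x x' != 0 -> dsq x x' = (N k)%:Z) -> ~ config N d A ->
  bform T d (@ind L A) = 0.
Proof.
elim: d A => [|d IH] A TN nc /=; first by rewrite /ind; move/negP/negbTE: nc => /= ->.
apply: big1 => x _; apply: big1 => x' _.
have [->|T0] := eqVneq (T d x x') 0; first by rewrite mul0r.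
rewrite (@eq_bform _ _ T d _ (@ind L (fun s => A (pt x :: s) && A (pt x' :: s)))); last first.
  by move=> s; rewrite /ind /= -natrM mulnb.
rewrite IH ?mulr0 // => [k y y' kd|c]; first by apply: TN; apply: ltnW.
by apply: nc; exists (pt x), (pt x'); rewrite -dsq_pt (TN d) // ltnSn.
Qed.

(** After j steps, avoiding all configurations at finitely many scales of Ms forces the box form on
    some box to be at most b. The box and the bound Kb may depend on Ms but not on the set A;
    squared distances carry q^(2j), as each step dilates by q. *)
Definition sparse (d : nat) (nn : nat -> nat) (q j : nat) (b : R) :=
  forall Ms : nat -> Prop, (forall n, exists2 m, (n <= m)%N & Ms m) ->
  exists l Kb, (0 < l)%N /\ forall A,
    (forall m, Ms m -> (m <= Kb)%N -> ~ config (fun k => (q ^ (2 * j) * m * nn k)%N) d A) ->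
    bform (fun=> @flat_kernel R (box l)) d (@ind l A) <= b.

Lemma mass_flat_box l : (0 < l)%N -> mass (@flat_kernel R (box l)) = 1.
Proof.
move=> l0; apply: (@mass_flat R (box l) (box l) unit id (fun=> tt) (fun i _ => i)) => //.
- by move=> x [].
- exact: card_box_gt0.
- by rewrite card_unit.
Qed.

(** Without configurations the form of T vanishes, so [bform_lower] makes the form over cells exceed
    the flat one by gam unless the latter is at most beta. The form over cells is at most b, since
    each cell is a dilate of the smaller box. Neither q nor gam depends on j. *)
Lemma energy_increment (d NB : nat) (nn : nat -> nat) (beta : R) : (0 < d)%N -> 0 < beta ->
  (forall k, (0 < nn k <= NB)%N) -> exists q (gam : R), [/\ (0 < q)%N, 0 < gam &
    forall j b, sparse d nn q j b -> sparse d nn q j.+1 (Num.max beta (b - gam))].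
Proof.
move=> d0 beta0 nnb; have NB0 : (0 < NB)%N by have /andP[a b] := nnb 0%N; apply: leq_trans b.
have [c [C1 [c0 C11 pack]]] := @analytic_package R (144 * NB) (ltac:(by rewrite muln_gt0 NB0)).
pose S : R := \sum_(i < d) ((C1 + 1) ^+ d + (C1 + 1) ^+ d * c ^+ i).
have C1p : 0 < C1 + 1 by lra.
have S0 : 0 < S.
  rewrite /S (bigD1 (Ordinal d0)) //=.
  apply: ltr_wpDr; first by apply: sumr_ge0 => i _; rewrite addr_ge0 ?mulr_ge0 ?exprn_ge0 // ltW.
  by rewrite addr_gt0 ?mulr_gt0 ?exprn_gt0.
have cd0 : 0 < c ^+ d by rewrite exprn_gt0.
(* The total error eps S is at most half of the main term c^d beta; eps <= 1 lets C1 + 1 bound both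
   masses. *)
pose eps : R := Num.min 1 (c ^+ d * beta / (2 * S)).
have eps0 : 0 < eps by rewrite lt_min ltr01 /= divr_gt0 ?mulr_gt0.
have eps1 : eps <= 1 by rewrite ge_min lexx.
have epsS : eps * S <= c ^+ d * beta / 2.
  apply: (@le_trans _ _ (c ^+ d * beta / (2 * S) * S)).
    by apply: ler_wpM2r; [exact: ltW|rewrite ge_min lexx orbT].
  by rewrite le_eqVlt; apply/orP; left; apply/eqP; field; rewrite gt_eqF.
have [q [C2 [q0 [C20 packq]]]] := pack eps eps0.
pose C3 : R := C2 ^+ 2 / eps.
have C30 : 0 <= C3 by rewrite divr_ge0 ?sqr_ge0 // ltW.
pose C : R := \sum_(i < d) c ^+ i * C3 * C2 ^+ (d - i.+1).
have C0 : 0 <= C.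
  by apply: sumr_ge0 => i _; apply: mulr_ge0; [apply: mulr_ge0 => //|]; apply: exprn_ge0; apply: ltW.
have Cp : 0 < C + 1 by lra.
exists q, (c ^+ d * beta / (2 * (C + 1))); split=> //; first by rewrite divr_gt0 ?mulr_gt0.
move=> j b sp Ms unb; have [l [Kb [l0 spl]]] := sp Ms unb.
have [m0 pk] := packq l l0.
(* The new distance is chosen after l, beyond m0 and (q l)^2, so that rounding the new side to a
   multiple of q l is harmless. *)
have [m mbig mM] := unb (m0 + (q * l) * (q * l))%N.
pose mu := (q ^ (2 * j.+1) * m)%N.
have qp : (0 < q ^ (2 * j.+1))%N by rewrite expn_gt0 q0.
have mmu : (m <= mu)%N by rewrite leq_pmull.
have ul0 : (0 < q * l)%N by rewrite muln_gt0 q0.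
have [w [w1 w2]] := @scale_choice q l NB mu ul0 NB0 (leq_trans (leq_trans (leq_addl _ _) mbig) mmu).
set L := (q * l * w)%N in w1 w2.
have mu0 : (0 < mu)%N by apply: leq_trans mmu; apply: leq_trans mbig; rewrite addn_gt0 muln_gt0 ul0 orbT.
have L0 : (0 < L)%N.
  by rewrite lt0n; apply/eqP => e; move: w1; rewrite e mul0n leqNgt muln_gt0 (muln_gt0 NB) NB0 mu0.
exists L, (maxn Kb m); split=> // A nc.
have pk' k : exists M : box L -> box L -> R,
    [/\ mass (@Tker R L (mu * nn k)) <= C1, mass M <= C1 + eps,
      forall F, unit_valued F -> - eps <= quad (fun x x' => Tker R (mu * nn k) x x' - M x x') F,
      forall x x', 0 <= M x x' <= C2 * flat_kernel R x x' &
      forall F, unit_valued F -> - eps <= quad M F - c * quad (@flat_kernel R (box L)) F +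
        C2 ^+ 2 / eps * (quad (@cell_kernel R (box L) (box (q * w)) (box l) (@box_cell q l w q0)) F -
          quad (@flat_kernel R (box L)) F)].
  have /andP[nk0 nkB] := nnb k; apply: pk.
  - by apply: leq_trans (leq_pmulr _ nk0); apply: leq_trans mmu; apply: leq_trans mbig; apply: leq_addr.
  - by rewrite /mu mulnS expnD -!mulnA dvdn_mulr // dvdn_mulr.
  - by apply: leq_trans w1; rewrite leq_mul2l mulnC leq_mul2r nkB !orbT.
  - by apply: leq_trans w2 _; rewrite leq_mul2l leq_pmulr ?orbT.
have [M hM] := choice pk'.
have L0' : 0 < L%:R :> R by rewrite ltr0n.
have w0 : (0 < w)%N by move: L0; rewrite /L muln_gt0 => /andP[].
have cI : (0 < #|box (q * w)|)%N by rewrite card_box_gt0 // muln_gt0 q0.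
have cY : (0 < #|box l|)%N by rewrite card_box_gt0.
have joinK := box_joinK (w := w) q0 l0.
have cellJ := box_cell_join (w := w) q0 (l := l).
have posJ := box_pos_join (w := w) q0 l0.
set P := @cell_kernel R (box L) (box (q * w)) (box l) (@box_cell q l w q0) in hM.
have massP : mass P = 1 := mass_cell R joinK cellJ posJ cI cY.
have UP (F : box L -> R) : unit_valued F -> quad (@flat_kernel R (box L)) F <= quad P F.
  by move=> _; exact: (@quad_flat_le_cell R _ _ _ _ _ _ joinK cellJ posJ cI F).
have T0 k (x x' : box L) : 0 <= Tker R (mu * nn k) x x' :> R by rewrite mulr_ge0 // divr_ge0 // exprn_ge0.
have massM k : mass (M k) <= C1 + 1 by have [_ h _ _ _] := hM k; lra.
have massT k : mass (@Tker R L (mu * nn k)) <= C1 + 1 by have [h _ _ _ _] := hM k; lra.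
have U0 (x x' : box L) : 0 <= flat_kernel R x x' by apply: flat_kernel_ge0.
have P0 (x x' : box L) : 0 <= P x x' by apply: cell_kernel_ge0.
have mU : mass (@flat_kernel R (box L)) <= 1 by rewrite mass_flat_box.
have mP : mass P <= 1 by rewrite massP.
have low := @bform_lower R (box L) (fun k => @Tker R L (mu * nn k)) M (@flat_kernel R (box L)) P
  eps c (C1 + 1) C2 C3 d (ltW eps0) (ltW c0) (ltac:(lra)) (ltW C20) C30 T0 massT
  (fun k => let: And5 _ _ h _ _ := hM k in h) (fun k => let: And5 _ _ _ h _ := hM k in h) massM
  (fun k => let: And5 _ _ _ _ h := hM k in h) U0 P0 mU mP UP
  (@ind L A) (@ind01 L A).
have T_0 : bform (fun k => @Tker R L (mu * nn k)) d (@ind L A) = 0.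
  apply: (bform_no_config (N := fun k => (q ^ (2 * j.+1) * m * nn k)%N)); last first.
    by apply: nc => //; apply: leq_maxr.
  move=> k x x' _; rewrite /Tker; by case: (dsq x x' =P (mu * nn k)%:Z) => [// _|_]; rewrite mulr0 eqxx.
(* A configuration inside a product of cells, rescaled by q, has squared distances multiplied by
   q^2; this turns q^(2j) into q^(2(j+1)). *)
have QP : bform (fun=> P) d (@ind L A) <= b.
  apply: (bform_cell_le joinK cellJ posJ cI) => ii sz.
  rewrite (@eq_bform _ _ _ d _ (@ind l (fun s => A (dilate q (map (fun i : box (q * w) =>
      (Posz (corner q l i.1.1.1), Posz (corner q l i.1.1.2),
       (Posz (corner q l i.1.2.1), Posz (corner q l i.1.2.2)), Posz (corner q l i.2)) : Z5) ii) s)))); last first.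
    by move=> ys; rewrite /ind map_pt_assemble.
  apply: spl => m' mM' mK' cf; have := config_dilate (ltac:(by rewrite size_map) : size (map _ ii) = d) cf.
  move=> cf'; apply: (nc m' mM' (leq_trans mK' (leq_maxl _ _))).
  apply: eq_config_dist cf' => k _; rewrite mulnS expnD; ring.
move: low; rewrite T_0 -/S -/C; move: QP; set x := bform _ d _; set y := bform _ d _ => QP low.
rewrite le_max; have [//|bx] := leP y beta; rewrite /=.
have e1 : c ^+ d * beta <= c ^+ d * y by rewrite ler_wpM2l // ltW.
have xy : y <= x.
  by apply: bform_homo => //; apply: ind01.
have e2 : C * (x - y) <= (C + 1) * (b - y).
  by apply: ler_pM => //; lra.
have e3 : c ^+ d * beta / (2 * (C + 1)) <= b - y.
  rewrite ler_pdivrMr ?mulr_gt0 //; lra.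
lra.
Qed.

(** From the trivial bound 1, more than 1 / gam steps of fixed gain gam reach beta; Q is q to the
    number of steps. *)
Lemma sparse_small (d NB : nat) (nn : nat -> nat) (beta : R) : (0 < d)%N -> 0 < beta ->
  (forall k, (0 < nn k <= NB)%N) -> exists2 Q, (0 < Q)%N &
  forall Ms : nat -> Prop, (forall n, exists2 m, (n <= m)%N & Ms m) ->
  exists l Kb, (0 < l)%N /\ forall A,
    (forall m, Ms m -> (m <= Kb)%N -> ~ config (fun k => (Q ^ 2 * m * nn k)%N) d A) ->
    bform (fun=> @flat_kernel R (box l)) d (@ind l A) <= beta.
Proof.
move=> d0 beta0 nnb; have [q [gam [q0 gam0 inc]]] := energy_increment d0 beta0 nnb.
have base : sparse d nn q 0 1.
  move=> Ms _; exists 1%N, 0%N; split=> // A _.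
  apply: bform_le1 => [k x x'|k|]; first exact: flat_kernel_ge0.
    by rewrite mass_flat_box.
  exact: ind01.
have mono j b b' : b <= b' -> sparse d nn q j b -> sparse d nn q j b'.
  move=> bb sp Ms unb; have [l [Kb [l0 h]]] := sp Ms unb.
  by exists l, Kb; split=> // A nc; apply: le_trans (h A nc) bb.
have H j : sparse d nn q j (Num.max beta (1 - j%:R * gam)).
  elim: j => [|j IH].
    by apply: mono base; rewrite mul0r subr0 le_max lexx orbT.
  apply: mono (inc _ _ IH); rewrite ge_max le_max lexx /=.
  rewrite -natr1 mulrDl mul1r; case: (leP beta (1 - j%:R * gam)) => h.
    by rewrite le_max; apply/orP; right; lra.
  by rewrite le_max; apply/orP; left; lra.
pose J := (Num.truncn gam^-1).+1.
have hJ : 1 - J%:R * gam <= beta.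
  have : gam^-1 <= J%:R by apply/ltW/truncnS_gt.
  rewrite -(ler_pM2r gam0) mulVf ?gt_eqF //; lra.
exists (q ^ J)%N; first by rewrite expn_gt0 q0.
move=> Ms unb; have [l [Kb [l0 h]]] := H J Ms unb.
exists l, Kb; split=> // A nc; apply: le_trans (h A _) _; last by rewrite ge_max lexx.
move=> m mM mK cf; apply: (nc m mM mK); apply: eq_config_dist cf => k _.
by rewrite -expnM [(J * 2)%N]mulnC.
Qed.

Fixpoint ssum (Z : finType) (d : nat) (f : seq Z -> R) : R :=
  if d is d'.+1 then \sum_z ssum d' (fun s => f (z :: s)) else f [::].

Lemma eq_ssum (Z : finType) d (f g : seq Z -> R) : f =1 g -> ssum d f = ssum d g.
Proof.
elim: d f g => [|d IH] f g fg /=; first exact: fg.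
by apply: eq_bigr => z _; apply: IH => s; apply: fg.
Qed.

Lemma ssum_sum (Z T : finType) d (f : T -> seq Z -> R) :
  ssum d (fun s => \sum_t f t s) = \sum_t ssum d (f t).
Proof.
by elim: d f => [|d IH] f //=; rewrite exchange_big; apply: eq_bigr => z _; rewrite IH.
Qed.

Lemma ssum_cauchy (Z : finType) d (f : seq Z -> R) :
  ssum d f ^+ 2 <= #|Z|%:R ^+ d * ssum d (fun s => f s ^+ 2).
Proof.
elim: d f => [|d IH] f /=; first by rewrite expr0 mul1r.
apply: le_trans (sqr_sum_le _) _; rewrite exprS -mulrA ler_wpM2l // mulr_sumr.
by apply: ler_sum => z _; apply: IH.
Qed.

Lemma ssum_ge0 (Z : finType) d (f : seq Z -> R) : (forall s, 0 <= f s) -> 0 <= ssum d f.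
Proof. by elim: d f => [|d IH] f f0 //=; apply: sumr_ge0 => z _; apply: IH. Qed.

(* Repeated Cauchy-Schwarz: the box form dominates the 2^d-th power of the density. *)
Lemma bform_flat_ge (Z : finType) d (f : seq Z -> R) (b : R) : (0 < #|Z|)%N -> 0 <= b ->
  (forall s, 0 <= f s) ->
  b * #|Z|%:R ^+ d <= ssum d f -> b ^+ (2 ^ d) <= bform (fun=> @flat_kernel R Z) d f.
Proof.
move=> Z0 b0; have ZR : 0 < #|Z|%:R :> R by rewrite ltr0n.
elim: d f b b0 => [|d IH] f b b0 f0 /= h; first by rewrite expn0 !expr1 -[b]mulr1 -(expr0 #|Z|%:R).
(* The density of the product of two slices, to which the induction hypothesis applies. *)
pose v (z z' : Z) : R := ssum d (fun s => f (z :: s) * f (z' :: s)) / #|Z|%:R ^+ d.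
have v0 z z' : 0 <= v z z' by rewrite divr_ge0 ?exprn_ge0 ?ssum_ge0 // => s; rewrite mulr_ge0.
have Zd : 0 < #|Z|%:R ^+ d :> R by rewrite exprn_gt0.
have h1 : \sum_z \sum_z' flat_kernel R z z' * v z z' ^+ (2 ^ d) <=
    \sum_z \sum_z' flat_kernel R z z' * bform (fun=> @flat_kernel R Z) d (fun s => f (z :: s) * f (z' :: s)).
  apply: ler_sum => z _; apply: ler_sum => z' _; rewrite ler_wpM2l ?flat_kernel_ge0 //.
  by apply: IH => // [s|]; [rewrite mulr_ge0|rewrite /v divfK // gt_eqF].
apply: le_trans h1.
(* Power means for the exponent 2^k, by k applications of Cauchy-Schwarz. *)
have pm k : (\sum_z \sum_z' flat_kernel R z z' * v z z') ^+ (2 ^ k) <=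
    \sum_z \sum_z' flat_kernel R z z' * v z z' ^+ (2 ^ k).
  have avgE (u : Z -> Z -> R) : \sum_z \sum_z' flat_kernel R z z' * u z z' =
      (#|Z|%:R ^+ 2)^-1 * \sum_(p : Z * Z) u p.1 p.2.
    rewrite mulr_sumr pair_bigA /=; apply: eq_bigr => -[] //.
  elim: k => [|k IHk]; first by rewrite expn0 expr1; apply: ler_sum => z _; apply: ler_sum => z' _; rewrite expr1.
  rewrite expnS mulnC exprM.
  apply: (@le_trans _ _ ((\sum_z \sum_z' flat_kernel R z z' * v z z' ^+ (2 ^ k)) ^+ 2)).
    rewrite lerXn2r ?nnegrE // ?exprn_ge0 //; apply: sumr_ge0 => z _; apply: sumr_ge0 => z' _;
      by rewrite mulr_ge0 ?flat_kernel_ge0 ?exprn_ge0.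
  rewrite !avgE exprMn; have := sqr_sum_le (fun p : Z * Z => v p.1 p.2 ^+ (2 ^ k)).
  rewrite card_prod natrM -expr2 => hc.
  apply: le_trans (ler_wpM2l _ hc) _; first by rewrite sqr_ge0.
  rewrite mulrA (_ : ((#|Z|%:R ^+ 2)^-1) ^+ 2 * #|Z|%:R ^+ 2 = (#|Z|%:R ^+ 2)^-1); last by field; rewrite gt_eqF.
  rewrite le_eqVlt; apply/orP; left; apply/eqP; congr (_ * _); apply: eq_bigr => p _.
  by rewrite -exprM.
apply: le_trans (pm d).
rewrite expnS exprM; apply: lerXn2r; rewrite ?nnegrE ?exprn_ge0 //.
  by apply: sumr_ge0 => z _; apply: sumr_ge0 => z' _; rewrite mulr_ge0 ?flat_kernel_ge0.
have e1 : \sum_z \sum_z' ssum d (fun s => f (z :: s) * f (z' :: s)) = ssum d (fun s => (\sum_z f (z :: s)) ^+ 2).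
  under eq_bigr => z _ do rewrite -ssum_sum.
  rewrite -ssum_sum; apply: eq_ssum => s; rewrite sqr_sum //.
have e2 : ssum d (fun s => \sum_z f (z :: s)) = \sum_z ssum d (fun s => f (z :: s)) by rewrite ssum_sum.
have cs := ssum_cauchy d (fun s => \sum_z f (z :: s)).
rewrite e2 -e1 in cs.
have -> : \sum_z \sum_z' flat_kernel R z z' * v z z' =
   (\sum_z \sum_z' ssum d (fun s => f (z :: s) * f (z' :: s))) / (#|Z|%:R ^+ 2 * #|Z|%:R ^+ d).
  rewrite mulr_suml; apply: eq_bigr => z _; rewrite mulr_suml; apply: eq_bigr => z' _.
  by rewrite /v /flat_kernel (invfM (#|Z|%:R ^+ 2)) mulrCA.
rewrite ler_pdivlMr; last by rewrite mulr_gt0 ?exprn_gt0.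
rewrite -(ler_pM2l Zd); apply: le_trans cs.
have -> : #|Z|%:R ^+ d * (b ^+ 2 * (#|Z|%:R ^+ 2 * #|Z|%:R ^+ d)) = (b * #|Z|%:R ^+ d.+1) ^+ 2.
  by rewrite (exprS _ d); ring.
by apply: lerXn2r h; rewrite nnegrE ?mulr_ge0 ?exprn_ge0 ?sumr_ge0 // => z _; apply: ssum_ge0.
Qed.

End Induction.

(** * From configurations to isometric copies of the rectangle *)

Local Open Scope classical_set_scope.
Local Open Scope ring_scope.

(** List positions run opposite to the indices of N, which explains d - j - 1. *)
Lemma config_lists N d A : config N d A -> exists ps ps' : seq Z5,
  [/\ size ps = d, size ps' = d,
    forall j, (j < d)%N -> norm5 (nth 0 ps' j - nth 0 ps j) = (N (d - j.+1)%N)%:Z &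
    forall s, size s = d ->
      (forall j, (j < d)%N -> nth 0 s j = nth 0 ps j \/ nth 0 s j = nth 0 ps' j) -> A s].
Proof.
elim: d A => [|d IH] A /=.
  by move=> A0; exists [::], [::]; split=> // s /size0nil ->.
move=> [p [p' [h /IH [ps [ps' [sz sz' hN hA]]]]]].
exists (p :: ps), (p' :: ps'); split=> /=.
- by rewrite sz.
- by rewrite sz'.
- by move=> [|j] jd /=; [rewrite subSS subn0|rewrite subSS hN].
move=> [|x s] //= [szs] hs.
have /andP[a1 a2] : A (p :: s) && A (p' :: s) by apply: hA => // j jd; apply: (hs j.+1).
by case: (hs 0%N (ltn0Sn _)) => /= ->.
Qed.

Definition row_of (p : Z5) : 'rV[int]_5 :=
  \row_i nth 0 [:: p.1.1.1; p.1.1.2; p.1.2.1; p.1.2.2; p.2] i.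

Lemma row_ofB p p' : row_of (p' - p) = row_of p' - row_of p.
Proof. by apply/rowP => -[[|[|[|[|[|?]]]]] ?] //; rewrite !mxE. Qed.

Lemma dotz_row_of p : dotz (row_of p) (row_of p) = norm5 p.
Proof. by rewrite /dotz !big_ord_recl big_ord0 !mxE /= /norm5; ring. Qed.

Lemma enormE (R : realType) n (x : 'rV[int]_n) : enorm R x = Num.sqrt (dotz x x)%:~R.
Proof.
rewrite /enorm /dotz rmorph_sum /=; congr Num.sqrt; apply: eq_bigr => i _.
by rewrite rmorphM expr2.
Qed.

Lemma dotzC n (x y : 'rV[int]_n) : dotz x y = dotz y x.
Proof. by apply: eq_bigr => i _; rewrite mulrC. Qed.

Lemma dotzZl n (c : int) (x y : 'rV[int]_n) : dotz (c *: x) y = c * dotz x y.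
Proof. by rewrite /dotz mulr_sumr; apply: eq_bigr => i _; rewrite mxE mulrA. Qed.

Lemma dotz_suml n (I : finType) (f : I -> 'rV[int]_n) y :
  dotz (\sum_i f i) y = \sum_i dotz (f i) y.
Proof.
rewrite /dotz exchange_big /=; apply: eq_bigr => k _.
by rewrite summxE mulr_suml.
Qed.

Lemma dotz_orthogonal n d (u : 'I_d -> 'rV[int]_n) (c : 'I_d -> int) :
  (forall i j, i != j -> dotz (u i) (u j) = 0) ->
  dotz (\sum_j c j *: u j) (\sum_j c j *: u j) = \sum_j c j ^+ 2 * dotz (u j) (u j).
Proof.
move=> ou; rewrite dotz_suml; apply: eq_bigr => i _.
rewrite dotzC dotz_suml (bigD1 i) //= big1 ?addr0 => [|j ji].
  by rewrite dotzZl dotzC dotzZl mulrA expr2.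
by rewrite dotzZl dotzC dotzZl (ou i j) ?mulr0 // eq_sym.
Qed.

Lemma dotz_eq0 n (x : 'rV[int]_n) : dotz x x = 0 -> x = 0.
Proof.
move=> h; apply/rowP => i; rewrite mxE; apply/eqP; rewrite -sqrf_eq0 expr2.
have h0 k : true -> 0 <= x 0 k * x 0 k by move=> _; rewrite -expr2 sqr_ge0.
have e : x 0 i * x 0 i = 0 := psumr_eq0P h0 h isT.
by rewrite e.
Qed.

Lemma dotz_mxvec d (M M' : 'M[int]_(d, 5)) :
  dotz (mxvec M) (mxvec M') = \sum_j dotz (row j M) (row j M').
Proof.
rewrite /dotz pair_bigA /= (reindex _ (curry_mxvec_bij d 5)) /=.
by apply: eq_bigr => -[j i] _ /=; rewrite !mxvecE !mxE.
Qed.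

Lemma scale_bool n (b : bool) (x : 'rV[int]_n) : b%:R *: x = if b then x else 0.
Proof. by case: b => /=; [exact: scale1r|exact: scale0r]. Qed.

Definition vertex n d (v0 : 'rV[int]_n) (u : 'I_d -> 'rV[int]_n) (J : {set 'I_d}) :=
  v0 + \sum_(j in J) u j.

Lemma vertexB n d (v0 : 'rV[int]_n) (u : 'I_d -> 'rV[int]_n) (J J' : {set 'I_d}) :
  vertex v0 u J - vertex v0 u J' = \sum_j ((j \in J)%:R - (j \in J')%:R) *: u j.
Proof.
rewrite /vertex opprD addrACA subrr add0r.
rewrite [X in X - _]big_mkcond [X in _ - X]big_mkcond -sumrB.
by apply: eq_bigr => j _; rewrite scalerBl !scale_bool.
Qed.

Lemma dotz_vertex n d (v0 : 'rV[int]_n) (u : 'I_d -> 'rV[int]_n) (J : {set 'I_d}) j :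
  (forall i j, i != j -> dotz (u i) (u j) = 0) ->
  dotz (vertex v0 u J - v0) (u j) = (j \in J)%:R * dotz (u j) (u j).
Proof.
move=> ou.
have -> : vertex v0 u J - v0 = vertex v0 u J - vertex v0 u finset.set0.
  by rewrite [vertex v0 u finset.set0]/vertex finset.big_set0 addr0.
rewrite vertexB dotz_suml (bigD1 j) //= big1 ?addr0 => [|i ij]; rewrite dotzZl.
  by rewrite finset.in_set0 (_ : false%:R = 0) // subr0.
by rewrite ou ?mulr0.
Qed.

(** Both sets are orthogonal boxes over the index sets J, and the squared edges have the common
    ratio mu, so matching the vertices of equal J is a similarity of ratio sqrt mu. *)
Lemma product_copy (R : realType) d (S V : set 'rV[int]_(d * 5)) (t : 'I_d -> R)
    (v0 : 'rV[int]_(d * 5)) u (mu : nat) (x w : 'I_d -> 'rV[int]_5) :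
  (0 < mu)%N -> (forall j, u j != 0) -> (forall i j, i != j -> dotz (u i) (u j) = 0) ->
  (forall j, enorm R (u j) = t j) -> V = [set vertex v0 u J | J in [set: {set 'I_d}]] ->
  (forall j, dotz (w j) (w j) = mu%:Z * dotz (u j) (u j)) ->
  pair_product x (fun j => x j + w j) `<=` S ->
  contains_product_copy S V t (Num.sqrt mu%:R).
Proof.
move=> mu0 u0 ou ut VE dw sub; exists x, (fun j => x j + w j).
have uu0 j : dotz (u j) (u j) != 0 by apply: contraNneq (u0 j) => /dotz_eq0 ->.
have muN : mu%:Z != 0 by case: (mu) mu0.
pose y (J : {set 'I_d}) := mxvec (\matrix_(j < d) (x j + (j \in J)%:R *: w j)).
(* The map must be total on Z^(5d); a vertex returns its set J through its inner products with the
   edges. *)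
pose phi v := y [set j | dotz (v - v0) (u j) != 0]%SET.
have phiE J : phi (vertex v0 u J) = y J.
  rewrite /phi; congr y; apply/setP => j; rewrite inE dotz_vertex // mulf_eq0 negb_or uu0 andbT.
  by rewrite pnatr_eq0 eqb0 negbK.
have yB J J' : dotz (y J - y J') (y J - y J') =
    mu%:Z * dotz (vertex v0 u J - vertex v0 u J') (vertex v0 u J - vertex v0 u J').
  rewrite vertexB dotz_orthogonal //.
  have -> : y J - y J' = mxvec (\matrix_(j < d) (((j \in J)%:R - (j \in J')%:R) *: w j)).
    rewrite /y -linearB /=; congr mxvec; apply/row_matrixP => j.
    by apply/rowP => i; rewrite !mxE; ring.
  rewrite dotz_mxvec mulr_sumr; apply: eq_bigr => j _.
  by rewrite !rowK dotzZl dotzC dotzZl dw; ring.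
split; first exact: sub.
  exists phi; split.
    split.
    - move=> v; rewrite VE => -[J _ <-]; rewrite phiE => j; rewrite /y mxvecK rowK scale_bool.
      by case: (j \in J); [right|left; rewrite addr0].
    - move=> v v' /set_mem hv /set_mem hv'; move: hv hv'; rewrite VE => -[J _ <-] [J' _ <-].
      rewrite !phiE => e; have := yB J J'; rewrite e subrr.
      have -> : dotz 0 0 = 0 :> int by move=> n; rewrite /dotz big1 // => i _; rewrite mxE mul0r.
      move/esym/eqP; rewrite mulf_eq0 (negbTE muN) /= => /eqP/dotz_eq0 h.
      by apply/eqP; rewrite -subr_eq0 h.
    - move=> z Pz; pose J := [set j | row j (vec_mx z) != x j]%SET.
      exists (vertex v0 u J); first by rewrite VE; exists J.
      rewrite phiE /y -[RHS]vec_mxK; congr mxvec; apply/row_matrixP => j.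
      rewrite rowK inE scale_bool; case: eqP => [->|ne] /=; first by rewrite addr0.
      by case: (Pz j) => // ->.
  move=> v v'; rewrite VE => -[J _ <-] [J' _ <-]; rewrite !phiE !enormE yB rmorphM /=.
  by rewrite sqrtrM ?ler0z.
move=> j; have -> : x j + w j - x j = w j by rewrite addrAC subrr add0r.
by rewrite -ut !enormE dw rmorphM /= sqrtrM ?ler0z.
Qed.

Definition place d (a : 'rV[int]_(d * 5)) (s : seq Z5) : 'rV[int]_(d * 5) :=
  a + mxvec (\matrix_(j < d) row_of (nth 0 s j)).

Definition hits d (S : set 'rV[int]_(d * 5)) a (s : seq Z5) : bool := `[< S (place a s) >].

Lemma config_copy (R : realType) d (S V : set 'rV[int]_(d * 5)) (t : 'I_d -> R)
    (v0 : 'rV[int]_(d * 5)) u (mu : nat) a (nn : nat -> nat) :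
  (0 < mu)%N -> (forall j, u j != 0) -> (forall i j, i != j -> dotz (u i) (u j) = 0) ->
  (forall j, enorm R (u j) = t j) -> V = [set vertex v0 u J | J in [set: {set 'I_d}]] ->
  (forall j : 'I_d, (nn (d - j.+1)%N)%:Z = dotz (u j) (u j)) ->
  config (fun k => (mu * nn k)%N) d (hits S a) -> contains_product_copy S V t (Num.sqrt mu%:R).
Proof.
move=> mu0 u0 ou ut VE hn /config_lists[ps [ps' [sz sz' hN hA]]].
apply: (@product_copy R d S V t v0 u mu (fun j => row j (vec_mx a) + row_of (nth 0 ps j))
  (fun j => row_of (nth 0 ps' j - nth 0 ps j))) => // [j|y Py].
  by rewrite dotz_row_of hN // PoszM hn.
pose s := [seq if row j (vec_mx y) == row j (vec_mx a) + row_of (nth 0 ps j)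
  then nth 0 ps j else nth 0 ps' j | j <- enum 'I_d].
have nths (j : 'I_d) : nth 0 s j = if row j (vec_mx y) == row j (vec_mx a) + row_of (nth 0 ps j)
  then nth 0 ps j else nth 0 ps' j.
  by rewrite (nth_map j) ?size_enum_ord // nth_ord_enum.
have /asboolP : hits S a s.
  apply: hA => [|j jd]; first by rewrite size_map size_enum_ord.
  by rewrite (nths (Ordinal jd)) /=; case: eqP; [left|right].
suff -> : place a s = y by [].
apply: (can_inj vec_mxK); rewrite /place linearD /= mxvecK; apply/row_matrixP => j.
rewrite linearD /= rowK nths; case: eqP => [-> //|ne]; case: (Py j) => // ->.
by rewrite row_ofB -addrA [row_of _ + (_ - _)]addrC subrK.
Qed.

(** * Counting points in cubes *)

Fixpoint lists (Z : finType) d : seq (seq Z) :=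
  if d is d'.+1 then [seq z :: s | z <- enum Z, s <- lists Z d'] else [:: [::]].

Lemma mem_lists (Z : finType) d (s : seq Z) : size s = d -> s \in lists Z d.
Proof.
elim: d s => [|d IH] [|z s] //= [sz]; apply/allpairsP; exists (z, s); split => //=.
  by rewrite mem_enum.
exact: IH.
Qed.

Lemma ssum_lists (R : realType) (Z : finType) d (f : seq Z -> R) :
  ssum d f = \sum_(s <- lists Z d) f s.
Proof.
elim: d f => [|d IH] f /=; first by rewrite big_seq1.
by rewrite big_allpairs_dep big_enum; apply: eq_big => // z _; exact: IH.
Qed.

Definition cube n (a : 'rV[int]_n) (N : nat) : set 'rV[int]_n :=
  [set x : 'rV[int]_n | forall i, (a 0 i <= x 0 i) && (x 0 i < a 0 i + N%:Z)].

Lemma place_cube d (a x : 'rV[int]_(d * 5)) l : cube a l.+1 x ->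
  exists2 s : seq (box l.+1), size s = d & x = place a (map (@pt l.+1) s).
Proof.
move=> cx; pose z (j : 'I_d) (i : nat) : 'I_l.+1 :=
  inord (absz (x 0%R (mxvec_index j (inord i : 'I_5)) - a 0%R (mxvec_index j (inord i : 'I_5)))%R).
have zE j (i : 'I_5) : Posz (z j i) = x 0 (mxvec_index j i) - a 0 (mxvec_index j i).
  have /andP[h1 h2] := cx (mxvec_index j i).
  rewrite /z inord_val; move: (x 0 _) (a 0 _) h1 h2 => X Y h1 h2.
  have h3 : (`|X - Y| < l.+1)%N by lia.
  by rewrite inordK // gez0_abs //; lia.
exists [seq ((z j 0%N, z j 1%N, (z j 2%N, z j 3%N), z j 4%N) : box l.+1) | j <- enum 'I_d].
  by rewrite size_map size_enum_ord.
apply/rowP => k; case/mxvec_indexP: k => j i.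
rewrite /place mxE mxvecE !mxE -map_comp (nth_map j) ?size_enum_ord // nth_ord_enum /=.
have e : nth 0 [:: Posz (z j 0%N); Posz (z j 1%N); Posz (z j 2%N); Posz (z j 3%N); Posz (z j 4%N)] i =
  Posz (z j i) by case: i => -[|[|[|[|[|]]]]].
by rewrite e zE addrC subrK.
Qed.

(** A list with the correct length suffices, as only upper bounds for cardinalities are drawn from
    it. *)
Lemma cube_cover (R : realType) d (S : set 'rV[int]_(d * 5)) a l : (0 < l)%N ->
  exists L : seq 'rV[int]_(d * 5), (forall x, S x -> cube a l x -> x \in L) /\
    (size L)%:R = ssum d (@ind R l (hits S a)).
Proof.
case: l => // l _.
exists [seq place a (map (@pt l.+1) s) | s <- lists (box l.+1) d & hits S a (map (@pt l.+1) s)]; split.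
  move=> x Sx /place_cube[s sz xE]; rewrite xE; apply/mapP; exists s => //.
  by rewrite mem_filter mem_lists // andbT; apply/asboolP; rewrite -xE.
rewrite size_map size_filter ssum_lists -sum1_count natr_sum big_mkcond /=.
by apply: eq_bigr => s _; rewrite /ind; case: (hits _ _ _).
Qed.

Lemma card_pts_le n (F : set 'rV[int]_n) L : (forall x, F x -> x \in L) -> (card_pts F <= size L)%N.
Proof.
move=> FL; have fin : finite_set F by apply: sub_finite_set (finite_seq L) => x /FL.
apply: uniq_leq_size; first exact: fset_uniq.
by move=> x; rewrite in_fset_set // => /set_mem/FL.
Qed.

(** The covering cubes may stick out: (N / l + 1) l <= 2 N because l <= N, which costs 2^n. *)
Lemma card_pts_tiling (R : realType) n (S : set 'rV[int]_n) (l N : nat) (b : R) a :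
  (0 < l)%N -> (l <= N)%N -> 0 <= b ->
  (forall c, exists L : seq 'rV[int]_n, (forall x, S x -> cube c l x -> x \in L) /\
    (size L)%:R <= b * l%:R ^+ n) ->
  (card_pts (S `&` cube a N))%:R <= b * (2 * N%:R) ^+ n.
Proof.
move=> l0 lN b0 H; pose K := (N %/ l).+1.
pose c (k : {ffun 'I_n -> 'I_K}) : 'rV[int]_n := \row_i (a 0 i + (l * k i)%N%:Z).
have [L hL] := choice H.
pose F := flatten [seq L (c k) | k <- enum {: {ffun 'I_n -> 'I_K}}].
have FF x : (S `&` cube a N) x -> x \in F.
  move=> [Sx cx]; pose k := [ffun i : 'I_n => inord (divn (absz (x 0%R i - a 0%R i)%R) l) : 'I_K].
  apply/flattenP; exists (L (c k)); first by apply: map_f; rewrite mem_enum.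
  have [h _] := hL (c k); apply: h => // i; have /andP[h1 h2] := cx i.
  rewrite mxE ffunE; move: (x 0 i) (a 0 i) h1 h2 => X Y h1 h2.
  have h3 : (`|X - Y| < N)%N by lia.
  rewrite inordK; last by rewrite ltnS leq_div2r // ltnW.
  have := divn_eq `|X - Y|%N l; have := ltn_pmod `|X - Y|%N l0.
  move: (`|X - Y|%N %/ l)%N (`|X - Y|%N %% l)%N => q r rl e.
  by apply/andP; split; nia.
apply: (@le_trans _ _ (size F)%:R); first by rewrite ler_nat; apply: card_pts_le.
rewrite size_flatten /shape -map_comp sumnE big_map natr_sum.
apply: (@le_trans _ _ (\sum_(k <- enum {: {ffun 'I_n -> 'I_K}}) b * l%:R ^+ n)).
  by apply: ler_sum => k _; have [_ h] := hL (c k).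
rewrite big_enum /= sumr_const card_ffun !card_ord -[leLHS]mulr_natr natrX -mulrA -exprMn.
apply: ler_wpM2l => //; apply: lerXn2r; rewrite ?nnegrE ?mulr_ge0 //.
rewrite -!natrM ler_nat /K mulnS; have := leq_divM N l; rewrite mulnC; lia.
Qed.

(** A cube of side l with density above b would have box form above b^(2^d) by [bform_flat_ge],
    which [sparse_small] excludes with beta = b^(2^d). So S is sparse in every cube of side l, hence
    in all larger ones. *)
Lemma copies_or_sparse (R : realType) d (V : set 'rV[int]_(d * 5)) (t : 'I_d -> R) (b : R) :
  (0 < d)%N -> is_rectangle V t -> 0 < b -> exists2 Q, (0 < Q)%N &
  forall Ms : nat -> Prop, (forall n, exists2 m, (n <= m)%N & Ms m) -> (forall m, Ms m -> (0 < m)%N) ->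
  exists l Kb, (0 < l)%N /\ forall S : set 'rV[int]_(d * 5),
    (forall m, Ms m -> (m <= Kb)%N -> ~ contains_product_copy S V t (Q%:R * Num.sqrt m%:R)) ->
    forall a N, (l <= N)%N -> (card_pts (S `&` cube a N))%:R <= b * (2 * N%:R) ^+ (d * 5).
Proof.
move=> hd [v0 [u [u0 ou ut VE]]] b0.
pose n j := `|dotz (u j) (u j)|%N.
have nE j : Posz (n j) = dotz (u j) (u j).
  by rewrite /n gez0_abs // sumr_ge0 // => i _; rewrite -expr2 sqr_ge0.
have n0 j : (0 < n j)%N by rewrite lt0n absz_eq0; apply: contraNneq (u0 j) => /dotz_eq0 ->.
have h k : (d - k.+1 < d)%N by lia.
pose nn k := n (Ordinal (h k)).
have nnb k : (0 < nn k <= \max_j n j)%N by rewrite n0 /=; exact: (leq_bigmax (Ordinal (h k))).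
have nnj (j : 'I_d) : (nn (d - j.+1)%N)%:Z = dotz (u j) (u j).
  rewrite -nE /nn; congr (Posz (n _)); apply: val_inj => /=; have := ltn_ord j; lia.
have [Q Q0 sp] := @sparse_small R d (\max_j n j) nn (b ^+ (2 ^ d)) hd (exprn_gt0 _ b0) nnb.
exists Q => // Ms unb M0; have [l [Kb [l0 H]]] := sp Ms unb; exists l, Kb; split=> // S nc a N lN.
apply: (card_pts_tiling _ l0 lN (ltW b0)) => c.
have [L [L1 L2]] := cube_cover R S c l0; exists L; split=> //; rewrite L2.
have le : bform (fun=> @flat_kernel R (box l)) d (@ind R l (hits S c)) <= b ^+ (2 ^ d).
  apply: H => m mM mK cf; apply: (nc m mM mK).
  have -> : Q%:R * Num.sqrt m%:R = Num.sqrt (Q ^ 2 * m)%N%:R :> R.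
    by rewrite natrM sqrtrM ?ler0n // natrX sqrtr_sqr ger0_norm.
  apply: (@config_copy R d S V t v0 u (Q ^ 2 * m)%N c nn) => //.
  by rewrite muln_gt0 expn_gt0 Q0 M0.
rewrite leNgt; apply/negP => gt.
have cb : #|box l|%:R ^+ d = l%:R ^+ (d * 5) :> R by rewrite card_box natrX -exprM mulnC.
have ld : 0 < l%:R ^+ (d * 5) :> R by rewrite exprn_gt0 ?ltr0n.
pose b' : R := ssum d (@ind R l (hits S c)) / l%:R ^+ (d * 5).
have db : b < b' by rewrite ltr_pdivlMr.
have b'0 : 0 < b' by apply: lt_trans db.
have ge : b' ^+ (2 ^ d) <= bform (fun=> @flat_kernel R (box l)) d (@ind R l (hits S c)).
  apply: bform_flat_ge; [exact: card_box_gt0|exact: ltW|by move=> s; rewrite ler0n|].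
  by rewrite cb /b' divfK // gt_eqF.
have : b ^+ (2 ^ d) < b' ^+ (2 ^ d).
  by rewrite ltr_pXn2r ?expn_gt0 ?nnegrE // ltW.
by rewrite ltNge (le_trans ge le).
Qed.

(** * Copies in a finite grid *)

Lemma grid_copy (R : realType) d (V : set 'rV[int]_(d * 5)) (t : 'I_d -> R) (delta : R) :
  (0 < d)%N -> is_rectangle V t -> 0 < delta ->
  exists N0 : nat, forall N : nat, (N0 <= N)%N -> forall S : set 'rV[int]_(d * 5),
    S `<=` grid (d * 5) N -> delta * N%:R ^+ (d * 5) <= (card_pts S)%:R ->
    exists lambda : R, [/\ sqrtN lambda, 1 <= lambda, lambda <= N%:R
      & contains_product_copy S V t lambda].
Proof.
move=> hd hV d0; have p0 : 0 < 2 ^+ (d * 5) :> R by rewrite exprn_gt0.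
(* The power of 2 compensates the covering, and the further 2 makes the contradiction strict. *)
have b0 : 0 < delta / (2 * 2 ^+ (d * 5)) by rewrite divr_gt0 ?mulr_gt0.
have [Q Q0 H] := copies_or_sparse hd hV b0.
have [l [Kb [l0 HS]]] := H (fun m => (0 < m)%N)
  (fun n => ex_intro2 _ _ n.+1 (leqnSn n) (ltn0Sn n)) (fun m h => h).
(* Scales m <= Kb suffice, so lambda = Q sqrt m <= Q Kb <= N. *)
exists (maxn l (Q * Kb.+1)) => N; rewrite geq_max => /andP[lN QN] S Sg big.
apply: contrapT => no.
have sm : (card_pts (S `&` cube (const_mx 1) N))%:R <= delta / (2 * 2 ^+ (d * 5)) * (2 * N%:R) ^+ (d * 5).
  apply: HS => // m m0 mK cp; apply: no; exists (Q%:R * Num.sqrt m%:R).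
  have s1 : 1 <= Num.sqrt m%:R :> R by rewrite -[leLHS]sqrtr1; apply: ler_wsqrtr; rewrite ler1n.
  have s0 : 0 < Num.sqrt m%:R :> R by apply: lt_le_trans s1.
  have ss : Num.sqrt m%:R * Num.sqrt m%:R = m%:R :> R by rewrite -expr2 sqr_sqrtr.
  have sle : Num.sqrt m%:R <= m%:R :> R by rewrite -[leRHS]ss ler_peMr // ltW.
  split=> //.
  - split; first by rewrite mulr_gt0 ?ltr0n.
    by rewrite exprMn sqr_sqrtr // -natrX -natrM; exact: rpred_nat.
  - by apply: mulr_ege1 => //; rewrite ler1n.
  - apply: (@le_trans _ _ (Q%:R * m%:R)); first by rewrite ler_wpM2l.
    rewrite -natrM ler_nat; apply: leq_trans QN; rewrite leq_mul2l; apply/orP; right; exact: ltnW.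
have SE : S `&` cube (const_mx 1) N = S.
  apply/seteqP; split=> [x []//|x Sx]; split=> // i; rewrite mxE; have [h1 h2] := Sg x Sx i.
  by apply/andP; split; lia.
have N0 : 0 < N%:R ^+ (d * 5) :> R by rewrite exprn_gt0 // ltr0n; apply: leq_trans lN.
move: sm; rewrite SE exprMn.
have -> : delta / (2 * 2 ^+ (d * 5)) * (2 ^+ (d * 5) * N%:R ^+ (d * 5)) = delta * N%:R ^+ (d * 5) / 2.
  by set A := _ ^+ _ in p0 *; set B := _ ^+ _ in N0 *; field; rewrite gt_eqF.
have : 0 < delta * N%:R ^+ (d * 5) by rewrite mulr_gt0.
lra.
Qed.

(** * Upper Banach density *)

Lemma cube_finite n (a : 'rV[int]_n) N : finite_set (cube a N).
Proof.
pose L := [seq (\row_i (a 0 i + (k i : nat)%:Z) : 'rV[int]_n) | k : {ffun 'I_n -> 'I_N} <- enum {: {ffun 'I_n -> 'I_N}}].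
apply: (@sub_finite_set _ _ [set` L]); last exact: finite_seq.
move=> x cx; pose z (i : 'I_n) := absz (x 0%R i - a 0%R i)%R.
have h i : (z i < N)%N.
  have /andP[] := cx i; rewrite /z; move: (x 0%R i) (a 0%R i) => X Y h1 h2; lia.
apply/mapP; exists [ffun i => Ordinal (h i)]; first by rewrite mem_enum.
apply/rowP => i; have /andP[h1 _] := cx i.
have e : a 0 i + (z i)%:Z = x 0 i by rewrite /z gez0_abs ?subr_ge0 // addrC subrK.
by rewrite mxE ffunE; exact: esym e.
Qed.

Lemma Qcube_finite (R : realType) n N : finite_set (Qcube R n N).
Proof.
apply: sub_finite_set (cube_finite (const_mx (- N%:Z)) (2 * N).+1) => x Qx i.
have [h1 h2] := Qx i; rewrite mxE.
have e : (N%:Z)%:~R = N%:R :> R by [].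
have N0 : 0 <= N%:R :> R by [].
have a1 : - N%:Z <= x 0 i by rewrite -(ler_int R) rmorphN /= e; lra.
have a2 : x 0 i <= N%:Z by rewrite -(ler_int R) e; lra.
by apply/andP; split; lia.
Qed.

Lemma card_Qcube (R : realType) n N : (N ^ n <= card_pts (Qcube R n N))%N.
Proof.
pose f (k : {ffun 'I_n -> 'I_N}) : 'rV[int]_n := \row_i ((k i : nat)%:Z - (N./2)%:Z).
have <- : size (map f (enum {: {ffun 'I_n -> 'I_N}})) = (N ^ n)%N.
  by rewrite size_map -cardE card_ffun !card_ord.
apply: uniq_leq_size.
  rewrite map_inj_uniq ?enum_uniq // => k k' /rowP e; apply/ffunP => i.
  by have := e i; rewrite !mxE => /addIr [] /val_inj.
move=> x /mapP[k _ ->]; rewrite in_fset_set; last exact: Qcube_finite.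
apply/mem_set => i; rewrite mxE.
have h1 : (N./2)%:R * 2 <= N%:R :> R by rewrite -natrM ler_nat; lia.
have h2 : (k i)%:R + 1 <= N%:R :> R by rewrite natr1 ler_nat.
have h3 : N%:R <= (N./2)%:R * 2 + 1 :> R by rewrite -natrM natr1 ler_nat; lia.
have h4 : 0 <= (k i)%:R :> R by [].
have -> : ((k i : nat)%:Z - (N./2)%:Z)%:~R = (k i)%:R - (N./2)%:R :> R by rewrite rmorphB.
by split; lra.
Qed.

(** A closed interval of length N may contain N + 1 integers, hence the side N + 1. *)
Lemma translate_sub_cube (R : realType) n (t : 'rV[R]_n) N :
  exists a, translate t (Qcube R n N) `<=` cube a N.+1.
Proof.
have ce (y : R) : exists k : int, (k - 1)%:~R < y <= k%:~R.
  by exists (Num.ceil y); first [exact: ceil_itv|exact: (real_ceil_itv (num_real y))].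
have [c hc] := choice ce.
exists (\row_i c (t 0 i - N%:R / 2)) => x [q Qq e] i.
have := congr1 (fun M : 'rV[R]_n => M 0 i) e; rewrite !mxE => xe.
have [q1 q2] := Qq i; have /andP[c1 c2] := hc (t 0 i - N%:R / 2).
move: (c _) c1 c2 => a c1 c2.
have a1 : a - 1 < x 0 i by rewrite -(ltr_int R); lra.
have a2 : x 0 i <= a + N%:Z.
  by rewrite -(ler_int R) rmorphD /= (_ : (N%:Z)%:~R = N%:R :> R) //; lra.
by apply/andP; split; lia.
Qed.

(** A translate of Q(N) fits in a cube of side N + 1 and 2 (N + 1) <= 4 N, while Q(N) has at least
    N^n points. *)
Lemma density_le (R : realType) n (S : set 'rV[int]_n) (l : nat) (b : R) : 0 <= b ->
  (forall a N, (l <= N)%N -> (card_pts (S `&` cube a N))%:R <= b * (2 * N%:R) ^+ n) ->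
  upper_banach_density R S <= b * 4 ^+ n.
Proof.
move=> b0 H; rewrite /upper_banach_density; set u := (X in limn X).
have p0 : 0 <= b * 4 ^+ n by rewrite mulr_ge0 ?exprn_ge0.
have ub N : (maxn l 1 <= N)%N -> u N <= b * 4 ^+ n.
  rewrite geq_max => /andP[lN N0].
  have NR : 1 <= N%:R :> R by rewrite ler1n.
  have cQ : N%:R ^+ n <= (card_pts (Qcube R n N))%:R :> R by rewrite -natrX ler_nat card_Qcube.
  have cQ0 : 0 < (card_pts (Qcube R n N))%:R :> R by apply: lt_le_trans cQ; rewrite exprn_gt0 // ltr0n.
  apply: ge_sup; first by eexists; exists 0.
  move=> _ [t _ <-]; rewrite ler_pdivrMr //.
  have [a sub] := translate_sub_cube t N.
  apply: (@le_trans _ _ (card_pts (S `&` cube a N.+1))%:R).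
    rewrite ler_nat; apply: card_pts_le => x [Sx tx].
    rewrite in_fset_set; first by apply/mem_set; split=> //; apply: sub.
    by apply: sub_finite_set (cube_finite a N.+1) => y [].
  apply: le_trans (H a N.+1 (leqW lN)) _; rewrite -mulrA; apply: ler_wpM2l => //.
  apply: (@le_trans _ _ (4 ^+ n * N%:R ^+ n)); last by apply: ler_wpM2l => //; rewrite exprn_ge0.
  rewrite -exprMn; apply: lerXn2r; rewrite ?nnegrE ?mulr_ge0 // -natr1; lra.
(* Without convergence [limn] takes the default value 0, and the bound is nonnegative. *)
have [cv|ncv] := pselect (cvgn u); last by rewrite (dvgP ncv); exact: p0.
by apply: limr_le cv _; exists (maxn l 1) => // N; apply: ub.
Qed.

(** If S failed at unboundedly many m, these could serve as the set of scales, and the density would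
    be at most half of 1 / (k + 1). The thresholds are discrete so that a sequence of factors Q can
    be chosen, one for each k. *)
Lemma eventually_copies (R : realType) d (V : set 'rV[int]_(d * 5)) (t : 'I_d -> R) (k : nat) :
  (0 < d)%N -> is_rectangle V t -> exists Q, (0 < Q)%N /\
  forall S : set 'rV[int]_(d * 5), k.+1%:R^-1 <= upper_banach_density R S ->
  exists Lam : int, forall lambda : R, sqrtN lambda -> Lam%:~R <= lambda ->
    contains_product_copy S V t (Q%:R * lambda).
Proof.
move=> hd hV; have p0 : 0 < 4 ^+ (d * 5) :> R by rewrite exprn_gt0.
have k0 : 0 < k.+1%:R^-1 :> R by rewrite invr_gt0 ltr0n.
have b0 : 0 < k.+1%:R^-1 / (2 * 4 ^+ (d * 5)) :> R by rewrite divr_gt0 ?mulr_gt0.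
have [Q Q0 H] := copies_or_sparse hd hV b0; exists Q; split=> // S dS.
pose Ms m := (0 < m)%N /\ ~ contains_product_copy S V t (Q%:R * Num.sqrt m%:R).
have [n hn] : exists n, forall m, (n <= m)%N -> ~ Ms m.
  apply: contrapT => no.
  have unb n : exists2 m, (n <= m)%N & Ms m.
    apply: contrapT => no2; apply: no; exists n => m nm Mm; apply: no2; by exists m.
  have [l [Kb [l0 HS]]] := H Ms unb (fun m h => proj1 h).
  have := density_le (ltW b0) (HS S (fun m h _ => proj2 h)).
  rewrite (_ : k.+1%:R^-1 / (2 * 4 ^+ (d * 5)) * 4 ^+ (d * 5) = k.+1%:R^-1 / 2) => [h|].
    by have := le_trans dS h; rewrite leNgt ltr_pdivrMr // ltr_pMr // ltr1n.
  by rewrite invfM mulrA divfK // gt_eqF.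
(* From lambda >= n + 1 >= 1 follows lambda^2 >= lambda >= n. *)
exists n.+1%:Z => lambda [l0 /intrP[z zE]] hl.
have z0 : 0 < z by rewrite -(ltr0z R) -zE exprn_gt0.
have zn : `|z|%N%:R = lambda ^+ 2 by rewrite natr_absz gtr0_norm // zE.
have lE : lambda = Num.sqrt `|z|%N%:R by rewrite zn sqrtr_sqr ger0_norm // ltW.
apply: contrapT => nc; apply: (hn `|z|%N); last by split; [lia|rewrite -lE].
rewrite -(ler_nat R) zn; have hl' : n.+1%:R <= lambda by exact: hl.
have l1 : 1 <= lambda by apply: le_trans hl'; rewrite ler1n.
apply: (@le_trans _ _ lambda); first by apply: le_trans hl'; rewrite ler_nat.
by rewrite expr2 ler_peMr // ltW.
Qed.

Theorem theorem1p3 (R : realType) (d : nat) (hd : (1 <= d)%N)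
    (V : set 'rV[int]_(d * 5)) (t : 'I_d -> R) (hV : is_rectangle V t) :
  (exists (q0 : R -> int) (lambda0 : set 'rV[int]_(d * 5) -> int),
     forall delta : R, 0 < delta -> delta <= 1 ->
       0 < q0 delta /\
       forall S : set 'rV[int]_(d * 5),
         delta <= upper_banach_density R S ->
         forall lambda : R, sqrtN lambda -> (lambda0 S)%:~R <= lambda ->
           contains_product_copy S V t ((q0 delta)%:~R * lambda))
  /\
  (forall delta : R, 0 < delta -> delta <= 1 ->
     exists N0 : nat, forall N : nat, (N0 <= N)%N ->
       forall S : set 'rV[int]_(d * 5),
         S `<=` grid (d * 5) N ->
         delta * N%:R ^+ (d * 5) <= (card_pts S)%:R ->
         exists lambda : R,
           [/\ sqrtN lambda, 1 <= lambda, lambda <= N%:R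
             & contains_product_copy S V t lambda]).
Proof.
split; last by move=> delta d0 _; apply: grid_copy.
have [Q hQ] := choice (fun k => eventually_copies k hd hV).
pose lev (x : R) := Num.truncn x^-1.
(* The threshold is attached to the level of the density of S itself, hence independent of delta;
   for density not positive it is the dummy 0. *)
have lam S : exists Lam : int, 0 < upper_banach_density R S ->
    forall lambda : R, sqrtN lambda -> Lam%:~R <= lambda ->
    contains_product_copy S V t ((Q (lev (upper_banach_density R S)))%:R * lambda).
  have [ub0|ub0] := pselect (0 < upper_banach_density R S); last by exists 0.
  have [_ h] := hQ (lev (upper_banach_density R S)).
  have [|Lam hL] := h S; last by exists Lam.
  rewrite -[leRHS]invrK lef_pV2 ?posrE ?invr_gt0 ?ltr0n //.
  exact/ltW/truncnS_gt.
have [lambda0 hl] := choice lam.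
(* The product over all coarser levels makes q0 delta a multiple of the factor
   belonging to the actual density of S, on which alone lambda0 S may depend. *)
exists (fun delta => (\prod_(j < (lev delta).+1) Q j)%N%:Z), lambda0 => delta d0 d1.
have P0 (k : nat) (P : pred 'I_k) : (0 < \prod_(j < k | P j) Q j)%N.
  by apply: prodn_cond_gt0 => j _; have [] := hQ j.
split; first by rewrite ltz_nat P0.
move=> S dS lambda [l0 li] ll; set x := upper_banach_density R S in dS.
have x0 : 0 < x by apply: lt_le_trans dS.
have kle : (lev x < (lev delta).+1)%N.
  rewrite -(ltr_nat R); apply: le_lt_trans (truncnS_gt _).
  apply: (@le_trans _ _ x^-1); last by rewrite lef_pV2 ?posrE.
  have xi : 0 <= x^-1 by rewrite invr_ge0 ltW.
  by have /andP[] := truncn_itv xi.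
(* The other factors s of the product move into lambda: s lambda is again the root of a positive
   integer, and s lambda >= lambda. *)
rewrite (bigD1 (Ordinal kle)) //=; set s := (\prod_(_ < _ | _) _)%N.
have s0 : (0 < s)%N by apply: P0.
have -> : ((Q (lev x) * s)%N%:Z)%:~R * lambda = (Q (lev x))%:R * (s%:R * lambda) :> R.
  by rewrite mulrA -natrM.
have sR : 1 <= s%:R :> R by rewrite ler1n.
apply: hl => //.
  split; first by rewrite mulr_gt0 ?ltr0n.
  by rewrite exprMn rpredM // -natrX; exact: rpred_nat.
by apply: le_trans ll _; rewrite ler_peMl // ltW.
Qed.
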